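(* Let $\Delta\subseteq\mathbb{R}^2$ be a two-dimensional lattice polygon. For every $\ell=1,\dots,N_\Delta-2$ one has $$ b_\ell-c_{N_\Delta-1-\ell}=\ell\binom{N_\Delta-1}{\ell+1}-2\binom{N_\Delta-3}{\ell-1}\mathrm{vol}(\Delta),$$ where it is understood that $b_{N_\Delta-2}=c_{N_\Delta-2}=0$.
   Context: Let $k$ be a field of characteristic $0$. A lattice polygon is the convex hull in $\mathbb{R}^2$ of finitely many points of $\mathbb{Z}^2$; $\mathrm{vol}(\Delta)$ is its Euclidean area and $N_\Delta=|\Delta\cap\mathbb{Z}^2|$. Let $S_\Delta=k[X_{i,j}\mid (i,j)\in\Delta\cap\mathbb{Z}^2]$, so that $\mathbb{P}^{N_\Delta-1}=\mathrm{Proj}\, S_\Delta$. The toric surface $X_\Delta\subseteq\mathbb{P}^{N_\Delta-1}$ is the Zariski closure of the image of $(k^* )^2\to\mathbb{P}^{N_\Delta-1}:(a,b)\mapsto(a^ib^j)_{(i,j)\in\Delta\cap\mathbb{Z}^2}$, and $I_\Delta\subseteq S_\Delta$ is its homogeneous ideal. The graded Betti numbers $\beta_{p,q}$ are the exponents in a minimal graded free resolution $\cdots\to\bigoplus_{q}S_\Delta(-q)^{\beta_{1,q}}\to\bigoplus_q S_\Delta(-q)^{\beta_{0,q}}\to S_\Delta/I_\Delta\to0$ of $S_\Delta/I_\Delta$ as a graded $S_\Delta$-module. For $1\le\ell\le N_\Delta-3$ one writes $b_\ell=\beta_{\ell,\ell+1}$ and $c_\ell=\beta_{N_\Delta-2-\ell,\,N_\Delta-\ell}$.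 *)

(* Defs.v *)
From HB Require Import structures.
From mathcomp Require Import all_boot all_order all_algebra finmap.
(* The notations of mpoly clash with those of the analysis library, so
   {mpoly k[n]}, f.@[v], f@_m and f \is d.-homog are written mpoly n k, meval v f,
   mcoeff m f and f \is ishomog1 d mdeg. *)
From mathcomp Require Import -(notations) mpoly.
From mathcomp Require Import all_classical all_reals all_analysis.

Set Implicit Arguments.
Unset Strict Implicit.
Unset Printing Implicit Defensive.

Import Order.TTheory GRing.Theory Num.Theory.

Local Open Scope classical_set_scope.
Local Open Scope ring_scope.

Section Polygons.
Variable R : realType.
Implicit Types (A Delta : set (R * R)).

Definition lincomb n (t : 'I_n -> R) (p : 'I_n -> R * R) : R * R :=
  (\sum_i t i * (p i).1, \sum_i t i * (p i).2).

Definition affine_hull A : set (R * R) :=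
  [set x | exists n (t : 'I_n -> R) (p : 'I_n -> R * R),
     [/\ forall i, A (p i), \sum_i t i = 1 & x = lincomb t p]].

Definition convex_hull A : set (R * R) :=
  [set x | exists n (t : 'I_n -> R) (p : 'I_n -> R * R),
     [/\ forall i, A (p i), forall i, 0 <= t i, \sum_i t i = 1
       & x = lincomb t p]].

Definition lattice_pt (z : int * int) : R * R := (z.1%:~R, z.2%:~R).

Definition lattice_polygon Delta :=
  exists2 V : set (int * int),
    finite_set V & Delta = convex_hull (lattice_pt @` V).

Definition two_dimensional A := affine_hull A = setT.

Definition vol A : R := fine ((lebesgue_measure \x lebesgue_measure)%E A).

(* fset_set is meaningful only for finite sets; a lattice polygon is bounded,
   so it has finitely many lattice points. *)
Definition lattice_points Delta : {fset int * int} :=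
  fset_set (lattice_pt @^-1` Delta).

Definition npoints Delta : nat := #|` lattice_points Delta|.

(* The homogeneous coordinate ring of the ambient projective space is
   mpoly (npoints Delta) k; its i-th variable is attached to the lattice point
   lpoint i. *)
Definition lpoint Delta (i : 'I_(npoints Delta)) : int * int :=
  nth (0, 0) (enum_fset (lattice_points Delta)) i.

End Polygons.

Section ToricSurface.
Variables (k : fieldType) (R : realType) (Delta : set (R * R)).
Local Notation N := (npoints Delta).

(* Subsets of P^(N-1) are given by the homogeneous coordinate vectors
   v : 'I_N -> k of their points. *)
Definition torus_image : set ('I_N -> k) :=
  [set v | exists a b : k, [/\ a != 0, b != 0 &
     v = fun i => a ^ (lpoint i).1 * b ^ (lpoint i).2]].

Definition zariski_closure (Y : set ('I_N -> k)) : set ('I_N -> k) :=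
  [set v | (exists i, v i != 0) /\
     forall d (f : mpoly N k), f \is ishomog1 d mdeg ->
       (forall w, Y w -> meval w f = 0) -> meval v f = 0].

(* An ideal generated by homogeneous polynomials vanishing on X consists of
   the polynomials all of whose homogeneous components vanish on X. *)
Definition homogeneous_ideal (X : set ('I_N -> k)) : set (mpoly N k) :=
  [set f | forall d v, X v -> meval v (pihomog mdeg d f) = 0].

Definition toric_surface := zariski_closure torus_image.

Definition toric_ideal := homogeneous_ideal toric_surface.

End ToricSurface.

Arguments toric_ideal k {R} Delta.

Section Resolutions.
Variables (k : fieldType) (n : nat).
Local Notation S := (mpoly n k).

(* Data of a sequence of maps of free modules
     ... -> F_2 -> F_1 -> F_0 -> S/I  (maps bd F 1, bd F 0, aug F)
   with F_p = \bigoplus_i S(- shift p i), i < rk p.  Elements of F_p are row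
   vectors and maps act by right multiplication; the i-th basis vector of F_p
   has degree shift p i.  The last map sends the i-th basis vector of F_0 to the
   class of aug i 0 in S/I. *)
Record free_seq := FreeSeq {
  rk : nat -> nat;
  shift : forall p, 'I_(rk p) -> int;
  bd : forall p, 'M[S]_(rk p.+1, rk p);
  aug : 'cV[S]_(rk 0) }.

(* f is zero or homogeneous of degree e, where e may be negative (in which
   case f = 0). *)
Definition homog_of_degree (e : int) (f : S) :=
  forall m, m \in msupp f -> (mdeg m)%:Z = e.

Definition graded_maps (F : free_seq) :=
  (forall p i j,
     homog_of_degree (shift (p := p.+1) i - shift j) (bd F p i j)) /\
  (forall i, homog_of_degree (shift i) (aug F i 0)).

Definition exact_seq (I : set S) (F : free_seq) :=
  [/\ forall f : S, exists u : 'rV[S]_(rk F 0), I (f - (u *m aug F) 0 0),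
      forall u : 'rV[S]_(rk F 0),
        I ((u *m aug F) 0 0) <-> exists w, u = w *m bd F 0
    & forall p (u : 'rV[S]_(rk F p.+1)),
        u *m bd F p = 0 <-> exists w, u = w *m bd F p.+1].

(* The image of F_(p+1) lies in m F_p, where m is generated by the variables. *)
Definition minimal_seq (F : free_seq) :=
  forall p i j, mcoeff (@mnm0 n) (bd F p i j) = 0.

Definition minimal_graded_free_resolution (I : set S) (F : free_seq) :=
  [/\ graded_maps F, exact_seq I F & minimal_seq F].

Definition betti (F : free_seq) (p : nat) (q : int) : nat :=
  #|[pred i : 'I_(rk F p) | shift i == q]|.

(* Used with n = npoints Delta >= 3.  By convention b_(n-2) = c_(n-2) = 0. *)
Definition b_ (F : free_seq) (l : nat) : nat :=
  if (1 <= l <= n - 3)%N then betti F l l.+1 else 0%N.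

Definition c_ (F : free_seq) (l : nat) : nat :=
  if (1 <= l <= n - 3)%N then betti F (n - 2 - l) (n - l)%N else 0%N.

End Resolutions.

(* Main.v *)
(** Let M be the coordinate ring S/I.  A pivot vertex v of Delta and the chain
    w_0, ..., w_r of the other vertices cut the cone over Delta into sectors
    spanned by v, w_i and w_(i+1).  The linear forms
    theta_0 = X_v, theta_1 = sum of X_(w_j), j even, theta_2 = sum of X_(w_j), j odd,
    multiply a monomial lying in a sector by the corner of that color of the
    sector, up to terms of larger key.  Hence they are a regular sequence on M,
    and since M is normal their quotient vanishes in degrees >= 3.
    Reducing the minimal resolution modulo the thetas and then modulo the
    remaining variables shows that its p-th term has no generators of degree
    > p + 2, and none at all for p > N - 3; it has none of degree <= p for
    p > 0.  Thus the N-th difference of the Hilbert function of M at l + 1, an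
    alternating sum of the beta_(p,l+1), involves only b_l and c_(N-1-l).
    The third difference is (1, N - 3, h), the numbers of monomials that are no
    leading terms of multiples of the thetas, and 1 + (N - 3) + h = 2 vol Delta
    by covering dilates of Delta with unit squares. *)

Require Import Defs.
From HB Require Import structures.
From mathcomp Require Import all_boot all_order all_algebra finmap.
From mathcomp Require Import -(notations) mpoly.
From mathcomp Require Import all_classical all_reals all_analysis.
From mathcomp Require Import measurable_realfun zify ring lra.
Import Order.TTheory GRing.Theory Num.Theory.

Set Implicit Arguments.
Unset Strict Implicit.
Unset Printing Implicit Defensive.

Local Open Scope ring_scope.

(** That the leading term of a theta times c is a corner of the sector of c rests on convexity: the
    coordinate along v, read off in the sector containing c, is the minimum over all sectors of
    linear forms, hence superadditive. Adding a corner outside the sector never lowers it, and if it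
    stays the same the sum lies in a later sector; this pair is the key, and its boundedness in each
    degree makes rewriting terminate. The sectors need not be unimodular, so the volume is not read
    off them: it is the leading coefficient of the Hilbert function, which is a quadratic polynomial
    once the h-vector ends in degree 2. No Tor is formed; cycles and boundaries of F modulo an ideal
    J are followed directly. Cancelling a theta then takes regularity both on S/(I + J) and on S/J,
    and for the latter each theta must be a form in variables not yet eliminated, which disjoint
    colors ensure. The length of the resolution comes out of counting the N - 3 variables left.
    Characteristic 0 provides infinitely many torus points, which make the ideal of the closure the
    kernel of a monomial map. *)

Local Notation shift := Defs.shift.
Local Notation o0 := (@Ordinal 3 0 isT).
Local Notation o1 := (@Ordinal 3 1 isT).
Local Notation o2 := (@Ordinal 3 2 isT).

(** * Homogeneous components indexed by integer degrees *)

Section HomogeneousParts.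
Variables (k : fieldType) (n : nat).
Local Notation S := (mpoly n k).
Implicit Types (f g : S) (e a : int).

Lemma mcoeff_pihomog d f m :
  mcoeff m (pihomog mdeg d f) = if mdeg m == d then mcoeff m f else 0.
Proof.
case: eqP => [md|/eqP md]; last first.
  apply: (dhomog_nemf_coeff (mf := mdeg) (d := d)) => //.
  exact: pihomogP.
rewrite pihomogE raddf_sum /= [in RHS](mpolyE f) raddf_sum /=.
rewrite big_mkcond /=; apply: eq_bigr => m' _.
case: eqP => // m'd; rewrite mcoeffZ mcoeffX.
by case: eqP => [m'm|]; rewrite ?mulr0 //; case: m'd; rewrite m'm.
Qed.

(** In a graded free module the degree [e - shift i] of an entry can be negative; the component is
    then 0, so that [hprojM] holds for every integer degree. *)
Definition hproj e f : S := if e is Posz d then pihomog mdeg d f else 0.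

Lemma mcoeff_hproj e f m :
  mcoeff m (hproj e f) = if (mdeg m)%:Z == e then mcoeff m f else 0.
Proof. by case: e => d /=; rewrite ?mcoeff_pihomog ?mcoeff0. Qed.

Arguments hproj : simpl never.

Lemma hproj_is_additive e : additive (hproj e).
Proof.
move=> f g; apply/mpolyP => m; rewrite mcoeffB !mcoeff_hproj.
by case: ifP => _; rewrite ?mcoeffB ?subr0.
Qed.

HB.instance Definition _ e :=
  GRing.isZmodMorphism.Build S S (hproj e) (hproj_is_additive e).

Lemma hproj_homog e f : homog_of_degree e (hproj e f).
Proof.
move=> m; rewrite mcoeff_msupp mcoeff_hproj.
by case: ifP => [/eqP-> //|_ /eqP].
Qed.

Lemma homog_coeff e f m : homog_of_degree e f ->
  (mdeg m)%:Z != e -> mcoeff m f = 0.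
Proof.
move=> hf ne; apply/eqP; rewrite mcoeff_eq0; apply: contra ne => mf.
by rewrite (hf m).
Qed.

Lemma hproj_id e f : homog_of_degree e f -> hproj e f = f.
Proof.
move=> hf; apply/mpolyP => m; rewrite mcoeff_hproj.
by case: eqP => // /eqP ne; rewrite (homog_coeff hf).
Qed.

Lemma homog0 e : homog_of_degree e (0 : S).
Proof. by move=> m; rewrite mcoeff_msupp mcoeff0 eqxx. Qed.

Lemma homogP e f : (forall m, mcoeff m f != 0 -> (mdeg m)%:Z = e) ->
  homog_of_degree e f.
Proof. by move=> h m; rewrite mcoeff_msupp; exact: h. Qed.

Lemma homogD e f g : homog_of_degree e f -> homog_of_degree e g ->
  homog_of_degree e (f + g).
Proof.
move=> hf hg; apply: homogP => m; rewrite mcoeffD; apply: contraNeq => ne.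
by rewrite (homog_coeff hf) // (homog_coeff hg) // addr0.
Qed.

Lemma homogN e f : homog_of_degree e f -> homog_of_degree e (- f).
Proof.
move=> hf; apply: homogP => m; rewrite mcoeffN oppr_eq0; apply: contraNeq => ne.
by rewrite (homog_coeff hf).
Qed.

Lemma homog_sum e (T : Type) (r : seq T) (P : pred T) (G : T -> S) :
  (forall i, P i -> homog_of_degree e (G i)) ->
  homog_of_degree e (\sum_(i <- r | P i) G i).
Proof.
move=> h; elim/big_rec: _ => [|i x Pi hx]; first exact: homog0.
by apply: homogD => //; exact: h.
Qed.

Lemma homogM e a f g : homog_of_degree e f -> homog_of_degree a g ->
  homog_of_degree (e + a) (f * g).
Proof.
move=> hf hg m /msuppM_le /allpairsP[[m1 m2] /= [/hf <- /hg <- ->]].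
by rewrite mdegD PoszD.
Qed.

Lemma homogX m : homog_of_degree (mdeg m)%:Z (mpolyX k m : S).
Proof.
by apply: homogP => m'; rewrite mcoeffX; case: (m =P m') => [->|_ /eqP].
Qed.

Lemma homogZ e c f : homog_of_degree e f -> homog_of_degree e (c *: f).
Proof.
move=> hf; apply: homogP => m; rewrite mcoeffZ; apply: contraNeq => ne.
by rewrite (homog_coeff hf) // mulr0.
Qed.

Lemma hproj0_homog e a f : homog_of_degree a f -> a != e -> hproj e f = 0.
Proof.
move=> hf ne; apply/mpolyP => m; rewrite mcoeff_hproj mcoeff0.
by case: eqP => // me; rewrite (homog_coeff hf) // me eq_sym.
Qed.

Lemma hprojM e a f g : homog_of_degree a g ->
  hproj e (f * g) = hproj (e - a) f * g.
Proof.
move=> hg; rewrite [in LHS](mpolyE f) [in RHS](mpolyE f).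
rewrite mulr_suml !raddf_sum mulr_suml; apply: eq_bigr => m _ /=.
have hX : homog_of_degree (mdeg m)%:Z (mcoeff m f *: mpolyX k m).
  by apply: homogZ; exact: homogX.
have [me|ne] := eqVneq (mdeg m)%:Z (e - a).
  rewrite (hproj_id (e := e)); first by rewrite hproj_id // -me.
  by rewrite (_ : e = (mdeg m)%:Z + a); [exact: homogM|rewrite me subrK].
rewrite (hproj0_homog hX ne) mul0r (hproj0_homog (homogM hX hg)) //.
by apply: contraNneq ne => <-; rewrite addrK.
Qed.

End HomogeneousParts.
Arguments hproj : simpl never.

(** * Reduction of a resolution modulo linear forms *)

Section IdealMembership.
Variables (k : fieldType) (n : nat).
Local Notation S := (mpoly n k).
Implicit Types (f g l : S) (J : S -> Prop) (e : int).

Record graded_ideal J := {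
  hip0 : J 0;
  hipD : forall f g, J f -> J g -> J (f + g);
  hipM : forall f g, J g -> J (f * g);
  hip_hproj : forall e f, J f -> J (hproj e f) }.

Lemma hip_sum J (hJ : graded_ideal J) (T : Type) (r : seq T)
    (P : pred T) (G : T -> S) :
  (forall i, P i -> J (G i)) -> J (\sum_(i <- r | P i) G i).
Proof.
move=> h; elim/big_rec: _ => [|i x Pi hx]; first exact: hip0.
by apply: hipD => //; exact: h.
Qed.

Lemma hipN J (hJ : graded_ideal J) f : J f -> J (- f).
Proof. by move=> ?; rewrite -mulN1r; exact: hipM. Qed.

Lemma hipB J (hJ : graded_ideal J) f g : J f -> J g -> J (f - g).
Proof. by move=> ? ?; apply: hipD => //; exact: hipN. Qed.

(** The ideal J + (l), through a cofactor of l that the reductions below extract. *)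
Definition add_gen J l : S -> Prop := fun f => exists2 g, J (f - l * g) & True.

Lemma add_genW J l f : graded_ideal J -> J f -> add_gen J l f.
Proof. by move=> hJ Jf; exists 0 => //; rewrite mulr0 subr0. Qed.

Lemma add_gen_self J l g : graded_ideal J -> add_gen J l (l * g).
Proof. by move=> hJ; exists g => //; rewrite subrr; exact: hip0. Qed.

Lemma add_gen_ideal J l : graded_ideal J -> homog_of_degree 1 l ->
  graded_ideal (add_gen J l).
Proof.
move=> hJ hl; split.
- exact: add_genW (hip0 hJ).
- move=> f g [f' Jf _] [g' Jg _]; exists (f' + g') => //.
  by rewrite mulrDr opprD addrACA; exact: hipD.
- move=> f g [g' Jg _]; exists (f * g') => //.
  by rewrite mulrCA -mulrBr; exact: hipM.
- move=> e f [f' Jf _]; exists (hproj (e - 1) f') => //.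
  rewrite mulrC -(hprojM _ _ hl) -raddfB mulrC; exact: hip_hproj.
Qed.

Definition nonzerodivisor_mod J l := forall f, J (l * f) -> J f.

Definition ideal_sum (I J : S -> Prop) : S -> Prop :=
  fun f => exists2 j, J j & I (f - j).

End IdealMembership.

Section Reduction.
Variables (k : fieldType) (n : nat).
Local Notation S := (mpoly n k).
Variables (I : S -> Prop) (F : free_seq k n).
Hypotheses (hI : graded_ideal I) (gradF : graded_maps F)
  (exF : exact_seq I F).
Implicit Types (J : S -> Prop) (l f g : S) (e : int).
Local Notation ideal := graded_ideal.

Definition rowin J p (u : 'rV[S]_p) := forall i, J (u 0 i).

Lemma rowin0 J p : ideal J -> rowin J (0 : 'rV_p).
Proof. by move=> hJ i; rewrite mxE; exact: hip0. Qed.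

Lemma rowinD J p (u v : 'rV_p) : ideal J ->
  rowin J u -> rowin J v -> rowin J (u + v).
Proof. by move=> hJ hu hv i; rewrite mxE; exact: hipD. Qed.

Lemma rowinB J p (u v : 'rV_p) : ideal J ->
  rowin J u -> rowin J v -> rowin J (u - v).
Proof. by move=> hJ hu hv i; rewrite !mxE; exact: hipB. Qed.

Lemma rowinZ J p f (u : 'rV_p) : ideal J -> rowin J u -> rowin J (f *: u).
Proof. by move=> hJ hu i; rewrite !mxE; exact: hipM. Qed.

Lemma rowinM J p q (u : 'rV_p) (A : 'M[S]_(p, q)) : ideal J ->
  rowin J u -> rowin J (u *m A).
Proof.
move=> hJ hu i; rewrite !mxE; apply: hip_sum => // j _.
by rewrite mulrC; exact: hipM.
Qed.

Lemma rowin_add_gen J l p (u : 'rV_p) : rowin (add_gen J l) u ->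
  exists v : 'rV_p, rowin J (u - l *: v).
Proof.
move=> hu; have /choice[v hv] : forall i, exists g, J (u 0 i - l * g).
  by move=> i; have [g Jg _] := hu i; exists g.
by exists (\row_i v i) => i; rewrite !mxE.
Qed.

Lemma rowin_add_genP J l p (u v : 'rV_p) : rowin J (u - l *: v) ->
  rowin (add_gen J l) u.
Proof. by move=> h i; exists (v 0 i) => //; have := h i; rewrite !mxE. Qed.

Lemma entryB p q (A B : 'M[S]_(p, q)) i j : (A - B) i j = A i j - B i j.
Proof. by rewrite !mxE. Qed.

Lemma entryZ p q a (A : 'M[S]_(p, q)) i j : (a *: A) i j = a * A i j.
Proof. by rewrite mxE. Qed.

Lemma bd_aug (w : 'rV[S]_(rk F 1)) : I ((w *m bd F 0 *m aug F) 0 0).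
Proof. by case: exF => _ /(_ (w *m bd F 0)) [_ +] _; apply; exists w. Qed.

Lemma bd_bd p (w : 'rV[S]_(rk F p.+2)) : w *m bd F p.+1 *m bd F p = 0.
Proof. by case: exF => _ _ /(_ p (w *m bd F p.+1)) [_ +]; apply; exists w. Qed.

(* A row [u] is a cycle of F / J F if [rowin J (u *m bd F p)], and a boundary if
   [boundary_mod J u]. *)
Definition boundary_mod J p (u : 'rV[S]_(rk F p)) :=
  exists w, rowin J (u - w *m bd F p).
Arguments boundary_mod J {p} u.

Definition exact_mod J := forall p (u : 'rV[S]_(rk F p.+1)),
  rowin J (u *m bd F p) -> boundary_mod J u.

Lemma exact_mod0 : exact_mod (fun f => f = 0).
Proof.
move=> p u hu; have [_ _ /(_ p u)[+ _]] := exF; case.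
  by apply/rowP => i; rewrite [RHS]mxE; exact: hu.
by move=> w ->; exists w => i; rewrite subrr mxE.
Qed.

(** The cokernel of F_1 -> F_0 modulo J is S/(I + J); this ties boundaries in F_0 to regularity on
    that quotient ring. *)
Lemma boundary_mod0P J (u : 'rV[S]_(rk F 0)) : ideal J ->
  boundary_mod J u <-> ideal_sum I J ((u *m aug F) 0 0).
Proof.
move=> hJ; split=> [[w hw]|[j Jj Ij]].
  exists (((u - w *m bd F 0) *m aug F) 0 0); first exact: rowinM.
  by rewrite mulmxBl entryB opprB addrC subrK; exact: bd_aug.
(* The row [u0] lifts 1, so [u - j *: u0] is sent into I as soon as u is sent to j modulo I. *)
have [h1 h2 _] := exF; have [u0 hu0] := h1 1.
have /h2[w hw] : I (((u - j *: u0) *m aug F) 0 0).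
  rewrite mulmxBl -scalemxAl entryB entryZ.
  set a := (u *m _) 0 0; set b := (u0 *m _) 0 0.
  have -> : a - j * b = (a - j) + j * (1 - b) by rewrite mulrBr mulr1 addrA subrK.
  by apply: hipD => //; exact: hipM.
exists w; rewrite -hw opprB addrC subrK => i; rewrite mxE mulrC.
exact: hipM.
Qed.

Lemma boundary_mod_add_gen J l p (u : 'rV[S]_(rk F p)) : ideal J ->
  boundary_mod J u -> boundary_mod (add_gen J l) u.
Proof. by move=> hJ [w hw]; exists w => i; apply: add_genW. Qed.

Lemma boundary_mod_lift J l p (u : 'rV[S]_(rk F p.+1)) (v : 'rV[S]_(rk F p)) :
  ideal J -> rowin J (u *m bd F p - l *: v) -> boundary_mod J v ->
  exists w, rowin J ((u - l *: w) *m bd F p).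
Proof.
move=> hJ huv [w hw]; exists w.
rewrite mulmxBl -scalemxAl.
have -> : u *m bd F p - l *: (w *m bd F p) =
    (u *m bd F p - l *: v) + l *: (v - w *m bd F p).
  by rewrite scalerBr addrA subrK.
by apply: rowinD => //; exact: rowinZ.
Qed.

Lemma boundary_mod_drop J l p (u w : 'rV[S]_(rk F p)) : ideal J ->
  boundary_mod J (u - l *: w) -> boundary_mod (add_gen J l) u.
Proof.
move=> hJ [w' hw']; exists w'; apply: (@rowin_add_genP _ _ _ _ w).
by rewrite addrAC.
Qed.

(** Applying the next boundary kills the image of u and leaves l times the boundary of v in J, where
    l can be cancelled. *)
Lemma cycle_quotient J l p (u : 'rV[S]_(rk F p.+2)) (v : 'rV[S]_(rk F p.+1)) :
  ideal J -> nonzerodivisor_mod J l ->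
  rowin J (u *m bd F p.+1 - l *: v) -> rowin J (v *m bd F p).
Proof.
move=> hJ nzd huv i; apply: nzd.
have := rowinM (bd F p) hJ huv i.
rewrite mulmxBl bd_bd sub0r -scalemxAl mxE => /(hipN hJ).
by rewrite opprK mxE.
Qed.

(** If the boundary of u is l v modulo J, then v is a cycle modulo J, hence the boundary of some w,
    and [u - l *: w] is a cycle modulo J to which the hypothesis applies. When v lies in F_0,
    regularity of l on S/(I + J) makes it a boundary instead. *)
Lemma exact_mod_add_gen J l : ideal J -> nonzerodivisor_mod J l ->
  nonzerodivisor_mod (ideal_sum I J) l -> exact_mod J ->
  exact_mod (add_gen J l).
Proof.
move=> hJ nzd nzdI exJ p u /rowin_add_gen[v hv].
have [w hw] : exists w, rowin J ((u - l *: w) *m bd F p).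
  apply: (boundary_mod_lift hJ hv).
  case: p u v hv => [|p] u v hv; last by apply: exJ; exact: cycle_quotient hv.
  apply/boundary_mod0P => //; apply: nzdI.
  have /(boundary_mod0P _ hJ) : boundary_mod J (l *: v).
    by exists u; have := rowinB hJ (rowin0 hJ) hv; rewrite sub0r opprB.
  by rewrite -scalemxAl mxE.
by apply: boundary_mod_drop => //; exact: exJ hw.
Qed.

Definition homog_row p e (u : 'rV[S]_(rk F p)) :=
  forall i, homog_of_degree (e - shift i) (u 0 i).
Arguments homog_row {p} e u.

Definition row_hproj p e (u : 'rV[S]_(rk F p)) : 'rV[S]_(rk F p) :=
  \row_i hproj (e - shift i) (u 0 i).

Lemma row_hproj_homog p e (u : 'rV[S]_(rk F p)) : homog_row e (row_hproj e u).
Proof. by move=> i; rewrite mxE; exact: hproj_homog. Qed.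

Lemma row_hproj_id p e (u : 'rV[S]_(rk F p)) : homog_row e u -> row_hproj e u = u.
Proof. by move=> hu; apply/rowP => i; rewrite mxE; exact: hproj_id. Qed.

Lemma row_hproj_bd p e (u : 'rV[S]_(rk F p.+1)) :
  row_hproj e (u *m bd F p) = row_hproj e u *m bd F p.
Proof.
apply/rowP => i; rewrite !mxE raddf_sum; apply: eq_bigr => j _ /=.
have [hbd _] := gradF; rewrite (hprojM _ _ (hbd p j i)) mxE.
by congr (hproj _ _ * _); lia.
Qed.

Lemma homog_row_bd p e (u : 'rV[S]_(rk F p.+1)) : homog_row e u ->
  homog_row e (u *m bd F p).
Proof.
by move=> hu; rewrite -(row_hproj_id hu) -row_hproj_bd; exact: row_hproj_homog.
Qed.

Lemma row_hproj_sub l p e (u v : 'rV[S]_(rk F p)) :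
  homog_of_degree 1 l -> homog_row e u ->
  row_hproj e (u - l *: v) = u - l *: row_hproj (e - 1) v.
Proof.
move=> hl hu; apply/rowP => i.
rewrite !mxE raddfB /= (hproj_id (hu i)) [l * v 0 i]mulrC (hprojM _ _ hl).
by rewrite mulrC addrAC.
Qed.

Lemma rowin_row_hproj J p e (u : 'rV[S]_(rk F p)) : ideal J ->
  rowin J u -> rowin J (row_hproj e u).
Proof. by move=> hJ hu i; rewrite mxE; exact: hip_hproj. Qed.

Lemma row_hproj_add_gen J l p e (u v : 'rV[S]_(rk F p)) : ideal J ->
  homog_of_degree 1 l -> homog_row e u -> rowin J (u - l *: v) ->
  rowin J (u - l *: row_hproj (e - 1) v).
Proof.
by move=> hJ hl hu huv; rewrite -row_hproj_sub //; exact: rowin_row_hproj.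
Qed.

(* The homology of F / J F at p vanishes in degrees > r + p, and altogether if
   p > t. *)
Definition vanishing_mod J (t : nat) (r : int) :=
  (forall e (u : 'rV[S]_(rk F 0)), homog_row e u -> r < e -> boundary_mod J u) /\
  forall p e (u : 'rV[S]_(rk F p.+1)), homog_row e u ->
    r + p.+1%:Z < e \/ (t < p.+1)%N -> rowin J (u *m bd F p) ->
    boundary_mod J u.

(* If [u *m bd F p] is [l *: v] modulo [J], then [v] is a cycle of degree [e - 1],
   hence the boundary of some [w], and [u - l *: w] is a cycle modulo [J]. *)
Lemma vanishing_mod_add_gen J l t r : ideal J -> homog_of_degree 1 l ->
  nonzerodivisor_mod J l -> vanishing_mod J t r ->
  vanishing_mod (add_gen J l) t.+1 r.
Proof.
move=> hJ hl nzd [van0 van]; split=> [e u hu re|p e u hu hpe /rowin_add_gen[v0]].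
  by apply: boundary_mod_add_gen => //; exact: van0 re.
move=> /(row_hproj_add_gen hJ hl (homog_row_bd hu)).
set v := row_hproj _ v0; have hv : homog_row (e - 1) v by exact: row_hproj_homog.
move=> huv; have [w hw] : exists w, rowin J ((u - l *: w) *m bd F p).
  apply: (boundary_mod_lift hJ huv).
  case: p u v0 v hu hpe hv huv => [|p] u v0 v hu hpe hv huv.
    by apply: van0 hv _; case: hpe; lia.
  apply: van hv _ _; first by case: hpe => ?; [left|right]; lia.
  exact: cycle_quotient huv.
(* The vanishing hypothesis speaks of homogeneous rows, so w is cut down to its component of degree
   [e - 1]. *)
pose w' := row_hproj (e - 1) w.
have hw' : rowin J ((u - l *: w') *m bd F p).
  by rewrite /w' -(row_hproj_sub w hl hu) -row_hproj_bd; exact: rowin_row_hproj.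
apply: (@boundary_mod_drop _ _ _ _ w') => //.
apply: (van p e _ _ _ hw') => [i|]; last by case: hpe => ?; [left|right]; lia.
rewrite !mxE; apply: homogD => //; apply: homogN.
have -> : e - shift i = 1 + (e - 1 - shift i) by lia.
by apply: homogM => //; exact: hproj_homog.
Qed.

End Reduction.
Arguments boundary_mod {k n} F J {p} u.

(** * Degrees of the generators of a minimal resolution *)

Section MinimalResolutions.
Variables (k : fieldType) (n : nat).
Local Notation S := (mpoly n k).
Variables (I : S -> Prop) (F : free_seq k n).
Hypotheses (hI : graded_ideal I) (gradF : graded_maps F)
  (exF : exact_seq I F) (minF : minimal_seq F).
Hypothesis I_low : forall e f, homog_of_degree e f -> e <= 1 -> I f -> f = 0.

Local Notation constant_term := (mcoeff (@mnm0 n)).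

Definition irrelevant_ideal (f : S) := constant_term f = 0.

Lemma boundary_constant_term p (w : 'rV[S]_(rk F p.+1)) j :
  constant_term ((w *m bd F p) 0 j) = 0.
Proof.
rewrite mxE raddf_sum big1 // => i _.
by rewrite /= rmorphM /= minF mulr0.
Qed.

Lemma delta_homog p (i : 'I_(rk F p)) :
  homog_row (F := F) (shift i) (delta_mx 0 i : 'rV[S]_(rk F p)).
Proof.
move=> j; rewrite mxE eqxx /=; case: eqP => [->|_]; last exact: homog0.
by rewrite subrr -mpolyX0; have := @homogX k _ (@mnm0 n); rewrite mdeg0.
Qed.

Lemma delta_entry p (i : 'I_p) : (delta_mx 0 i : 'rV[S]_p) 0 i = 1.
Proof. by rewrite mxE !eqxx. Qed.

Lemma delta_mul p q (i : 'I_p) (A : 'M[S]_(p, q)) j :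
  (delta_mx 0 i *m A : 'rV[S]_q) 0 j = A i j.
Proof. by rewrite -rowE mxE. Qed.

Lemma delta_not_boundary p (i : 'I_(rk F p)) :
  ~ boundary_mod F irrelevant_ideal (delta_mx 0 i : 'rV[S]_(rk F p)).
Proof.
move=> [w /(_ i)]; rewrite /irrelevant_ideal entryB delta_entry raddfB /=.
rewrite boundary_constant_term subr0 mcoeff1 eqxx; exact/eqP/oner_neq0.
Qed.

Lemma constant_termM (f g : S) :
  constant_term (f * g) = constant_term f * constant_term g.
Proof. exact: rmorphM. Qed.

(** By minimality a basis vector is a cycle modulo the irrelevant ideal and is never a boundary
    there; hence it sits where the homology of F modulo that ideal may survive. *)
Lemma vanishing_mod_shift t r (p : nat) (i : 'I_(rk F p)) :
  vanishing_mod F irrelevant_ideal t r -> shift i <= r + p%:Z /\ (p <= t)%N.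
Proof.
case: p i => [|p] i [van0 van].
  split=> //; rewrite addr0 leNgt; apply/negP => /(van0 _ _ (@delta_homog _ i)).
  exact: delta_not_boundary.
suff h : ~ (r + p.+1%:Z < shift i \/ (t < p.+1)%N) by split; lia.
move=> /(van _ _ _ (@delta_homog _ i)) h; apply: (@delta_not_boundary _ i).
by apply: h => j; rewrite delta_mul; exact: minF.
Qed.

Lemma homog_lt0 e (f : S) : homog_of_degree e f -> e < 0 -> f = 0.
Proof.
move=> hf e0; apply/mpolyP => m; rewrite mcoeff0 (homog_coeff hf) //.
by apply: contraTneq e0 => <-.
Qed.

Lemma homog_constant_term e (f : S) : homog_of_degree e f -> e != 0 ->
  constant_term f = 0.
Proof. by move=> hf e0; rewrite (homog_coeff hf) // mdeg0 eq_sym. Qed.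

Lemma not_boundary0 (u : 'rV[S]_(rk F 0)) i :
  constant_term (u 0 i) != 0 -> ~ I ((u *m aug F) 0 0).
Proof.
move=> ui; have [_ /(_ u)[+ _] _] := exF => /[apply] -[w uw].
by move: ui; rewrite uw boundary_constant_term eqxx.
Qed.

(** Otherwise the entry a_i of [aug] has no constant term. With [u0] a lift of 1, the row e_i - a_i
    u0 is sent into I, hence is a boundary, yet its i-th entry has constant term 1, against
    minimality. *)
Lemma shift_0 (i : 'I_(rk F 0)) : shift i = 0.
Proof.
have [_ haug] := gradF; have hi := haug i.
have [//|ne] := eqVneq (shift i) 0; exfalso.
have [/(_ 1)[u0 hu0] _ _] := exF.
apply: (@not_boundary0 (delta_mx 0 i - aug F i 0 *: u0) i).
  rewrite entryB entryZ delta_entry raddfB /= constant_termM.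
  by rewrite (homog_constant_term hi) // mul0r subr0 mcoeff1 eqxx oner_neq0.
rewrite mulmxBl -scalemxAl entryB entryZ delta_mul -[X in X - _]mulr1 -mulrBr.
exact: hipM.
Qed.

Lemma aug_constant i : exists2 a : k, a != 0 & aug F i 0 = mpolyC n a.
Proof.
have [_ haug] := gradF; have hi := haug i; rewrite shift_0 in hi.
have Ei : aug F i 0 = mpolyC n (constant_term (aug F i 0)).
  apply/mpolyP => m; rewrite mcoeffC; have [->|ne] := eqVneq m (@mnm0 n).
    by rewrite mulr1.
  by rewrite mulr0 (homog_coeff hi) // eqz_nat mdeg_eq0.
exists (constant_term (aug F i 0)) => //; apply/eqP => a0.
apply: (@not_boundary0 (delta_mx 0 i) i).
  by rewrite delta_entry mcoeff1 eqxx oner_neq0.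
by rewrite delta_mul Ei a0 mpolyC0; exact: hip0.
Qed.

(** Two basis vectors of F_0 map to nonzero constants a and b, so b e_i - a e_j maps to 0 and would
    be a boundary with a unit entry. *)
Lemma rk0_le1 (i j : 'I_(rk F 0)) : i = j.
Proof.
apply/eqP/negPn/negP => ne.
have [a a0 Ei] := aug_constant i; have [b b0 Ej] := aug_constant j.
pose x : 'rV[S]_(rk F 0) := mpolyC n b *: delta_mx 0 i.
pose y : 'rV[S]_(rk F 0) := mpolyC n a *: delta_mx 0 j.
have xE : (x *m aug F) 0 0 = mpolyC n b * mpolyC n a.
  by rewrite -scalemxAl entryZ delta_mul Ei.
have yE : (y *m aug F) 0 0 = mpolyC n a * mpolyC n b.
  by rewrite -scalemxAl entryZ delta_mul Ej.
apply: (@not_boundary0 (x - y) i).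
  rewrite entryB !entryZ delta_entry mxE eqxx (negPf ne) mulr1 mulr0 subr0.
  by rewrite mcoeffC eqxx mulr1.
have E : (x *m aug F - y *m aug F) 0 0 = 0.
  rewrite entryB; apply: etrans (congr2 (fun s t => s - t) xE yE) _.
  by rewrite [X in X - _]mulrC subrr.
by rewrite mulmxBl E; exact: hip0.
Qed.

Lemma delta_not_cycle p (i : 'I_(rk F p.+1)) :
  (delta_mx 0 i : 'rV[S]_(rk F p.+1)) *m bd F p <> 0.
Proof.
move=> h; have [_ _ /(_ p (delta_mx 0 i))[/(_ h)[w hw] _]] := exF.
have := delta_entry i; rewrite hw => /(congr1 constant_term).
by rewrite boundary_constant_term mcoeff1 eqxx => /eqP; rewrite eq_sym oner_eq0.
Qed.

(** In a lower degree the whole i-th row of the boundary map vanishes, so that a basis vector is a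
    cycle, which minimality forbids. For F_1 the row vanishes because I has no nonzero element of
    degree at most 1; further on because its entries have degree at most 0 and no constant term. *)
Lemma shift_ge p (i : 'I_(rk F p.+1)) : p.+2%:Z <= shift i.
Proof.
elim: p i => [|p IH] i; rewrite leNgt; apply/negP => hi;
  apply: (delta_not_cycle (i := i)); apply/rowP => j; rewrite delta_mul mxE.
  have [a a0 Ej] := aug_constant j.
  have [hbd _] := gradF; have hij := hbd 0%N i j.
  have hI0 : I (bd F 0 i j * mpolyC n a).
    rewrite -Ej; have := bd_aug exF (delta_mx 0 i).
    rewrite mxE (bigD1 j) //= delta_mul big1 ?addr0 // => j' /eqP[].
    exact: rk0_le1.
  have /eqP : bd F 0 i j * mpolyC n a = 0.
    apply: (@I_low (shift i)) => //.
    rewrite -[shift i]addr0; apply: homogM.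
      by move: hij; rewrite shift_0 subr0.
    apply: homogP => m; rewrite mcoeffC.
    by case: (m =P @mnm0 n) => [->|_]; rewrite ?mdeg0 // mulr0 eqxx.
  by rewrite mulf_eq0 mpolyC_eq0 (negPf a0) orbF => /eqP.
have [hbd _] := gradF; have hij := hbd p.+1 i j.
have hj := IH j; have [e0|e0] := eqVneq (shift i - shift j) 0; last first.
  by apply: homog_lt0 hij _; lia.
apply/mpolyP => m; rewrite mcoeff0; have [->|ne] := eqVneq m (@mnm0 n).
  exact: minF.
by rewrite (homog_coeff hij) // e0 eqz_nat mdeg_eq0.
Qed.

End MinimalResolutions.
Arguments irrelevant_ideal {k n} f.

(** * Hilbert functions and Betti numbers *)

(** Rank-nullity makes the alternating sum telescope: cut off after Q, it differs from h by the
    signed rank of [A Q], and this rank is 0 at Q = P. *)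
Lemma euler_exact (k : fieldType) (d : nat -> nat) (h : nat)
    (A : forall p, 'M[k]_(d p.+1, d p)) (B : 'M[k]_(d 0, h)) (P : nat) :
  row_full B ->
  (forall u : 'rV_(d 0), u *m B = 0 <-> exists w, u = w *m A 0) ->
  (forall p (u : 'rV_(d p.+1)),
     u *m A p = 0 <-> exists w, u = w *m A p.+1) ->
  d P.+1 = 0%N ->
  h%:Z = \sum_(p < P.+1) (-1) ^+ p * (d p)%:Z.
Proof.
move=> fullB exB exA dP.
have ker_rank a b c (M : 'M[k]_(b, c)) (L : 'M[k]_(a, b)) :
    (forall u : 'rV_b, u *m M = 0 <-> exists w, u = w *m L) ->
    (\rank L + \rank M = b)%N.
  move=> hML; have /eqmx_rank <- : (kermx M == L)%MS.
    apply/andP; split; apply/row_subP => i.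
      have /hML[w ->] : row i (kermx M) *m M = 0.
        by apply/eqP; rewrite -sub_kermx row_sub.
      exact: submxMl.
    by apply/sub_kermxP/hML; exists (delta_mx 0 i); rewrite rowE.
  by rewrite mxrank_ker subnK // rank_leq_row.
suff hP Q : h%:Z = \sum_(p < Q.+1) (-1) ^+ p * (d p)%:Z
    + (-1) ^+ Q.+1 * (\rank (A Q))%:Z.
  rewrite (hP P); have -> : \rank (A P) = 0%N.
    by apply/eqP; rewrite -leqn0 -dP rank_leq_row.
  by rewrite mulr0 addr0.
elim: Q => [|Q ->].
  have := ker_rank _ _ _ _ _ exB; rewrite (eqP fullB) big_ord1.
  by rewrite expr0 expr1 mul1r mulN1r => /(congr1 Posz) <-; rewrite PoszD addrC addKr.
have dE : (d Q.+1)%:Z = (\rank (A Q.+1))%:Z + (\rank (A Q))%:Z.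
  by rewrite -PoszD (ker_rank _ _ _ _ _ (exA Q)).
rewrite [in RHS]big_ord_recr /= dE (exprS _ Q.+1); ring.
Qed.

Section GradedPiece.
Variables (k : fieldType) (n : nat) (r : nat) (s : 'I_r -> int) (e : nat).
Hypothesis s_ge0 : forall i, 0 <= s i.
Local Notation S := (mpoly n k).

(** Monomial basis of the degree e part of the direct sum of the S(- s i). The bound [e.+1] makes
    the type finite and, [s] being nonnegative, excludes no monomial. *)
Definition piece_index :=
  {x : 'I_r * bmultinom n e.+1 | (mdeg (bmnm x.2))%:Z + s x.1 == e%:Z}.
Local Notation T := piece_index.
Local Notation d := #|{: T}|.

Definition index_gen (t : 'I_d) : 'I_r := (val (enum_val t)).1.
Definition index_mon (t : 'I_d) : multinom n := bmnm (val (enum_val t)).2.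
Definition monomial_row (t : 'I_d) : 'rV[S]_r :=
  mpolyX k (index_mon t) *: delta_mx 0 (index_gen t).
Definition of_coords (v : 'rV[k]_d) : 'rV[S]_r :=
  \sum_t mpolyC n (v 0 t) *: monomial_row t.
Definition coords (u : 'rV[S]_r) : 'rV[k]_d :=
  \row_t mcoeff (index_mon t) (u 0 (index_gen t)).

Definition graded_row (u : 'rV[S]_r) :=
  forall i, homog_of_degree (e%:Z - s i) (u 0 i).

Lemma index_degree t : (mdeg (index_mon t))%:Z + s (index_gen t) = e%:Z.
Proof. by rewrite /index_mon /index_gen; case: (enum_val t) => x /= /eqP. Qed.

Lemma index_inj t t' :
  index_gen t = index_gen t' -> index_mon t = index_mon t' -> t = t'.
Proof.
move=> hg hm; apply: enum_val_inj; apply: val_inj.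
move: hg hm; rewrite /index_gen /index_mon.
by case: (val _) => i m; case: (val _) => i' m' /= -> /val_inj ->.
Qed.

Lemma index_ex i m : (mdeg m)%:Z + s i = e%:Z ->
  exists2 t, index_gen t = i & index_mon t = m.
Proof.
move=> hm; have hb : (mdeg m < e.+1)%N by have := s_ge0 i; lia.
have hx : (mdeg (bmnm (i, BMultinom hb).2))%:Z + s (i, BMultinom hb).1 == e%:Z.
  by rewrite /= hm.
exists (enum_rank (exist _ (i, BMultinom hb) hx : T));
  by rewrite /index_gen /index_mon enum_rankK.
Qed.

Lemma mcoeff_of_coords v i m : mcoeff m (of_coords v 0 i) =
  \sum_t v 0 t * ((index_gen t == i) && (index_mon t == m))%:R.
Proof.
rewrite summxE raddf_sum /=; apply: eq_bigr => t _.
rewrite !mxE eqxx /= mcoeffCM eq_sym; case: eqP => _ /=.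
  by rewrite mulr1 mcoeffX.
by rewrite mulr0 mcoeff0.
Qed.

Lemma of_coordsK : cancel of_coords coords.
Proof.
move=> v; apply/rowP => t; rewrite mxE mcoeff_of_coords (bigD1 t) //=.
rewrite !eqxx mulr1 big1 ?addr0 // => t' ne.
case: eqP => [hg|_]; last by rewrite mulr0.
case: eqP => [hm|_]; last by rewrite mulr0.
by rewrite (index_inj hg hm) eqxx in ne.
Qed.

Lemma of_coords_graded v : graded_row (of_coords v).
Proof.
move=> i; apply: homogP => m; rewrite mcoeff_of_coords => /eqP nz.
have [t] : exists t, (index_gen t == i) && (index_mon t == m).
  have [/existsP//|/existsPn h] :=
    boolP [exists t, (index_gen t == i) && (index_mon t == m)].
  by case: nz; rewrite big1 // => t _; rewrite (negPf (h t)) mulr0.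
by case/andP => /eqP <- /eqP <-; rewrite -(index_degree t) addrK.
Qed.

Lemma coordsK u : graded_row u -> of_coords (coords u) = u.
Proof.
move=> hu; apply/rowP => i; apply/mpolyP => m; rewrite mcoeff_of_coords.
have [hm|ne] := eqVneq ((mdeg m)%:Z + s i) e%:Z; last first.
  rewrite (homog_coeff (hu i)) ?big1 // => [t _|]; last by lia.
  case: andP => [[/eqP hi /eqP hmt]|_]; last by rewrite mulr0.
  by move: ne; rewrite -hi -hmt index_degree eqxx.
have [t hi hmt] := index_ex hm.
rewrite (bigD1 t) //= hi hmt !eqxx mulr1 mxE hi hmt big1 ?addr0 // => t' ne.
case: andP => [[/eqP hi' /eqP hm']|_]; last by rewrite mulr0.
by rewrite (@index_inj t' t) ?eqxx ?hi ?hmt in ne.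
Qed.

Lemma coords0 : coords 0 = 0.
Proof. by apply/rowP => t; rewrite !mxE mcoeff0. Qed.

End GradedPiece.

Section PieceMatrix.
Variables (k : fieldType) (n : nat) (r r' : nat).
Variables (s : 'I_r -> int) (s' : 'I_r' -> int) (e : nat).
Local Notation S := (mpoly n k).
Variable (D : 'M[S]_(r, r')).

Definition piece_matrix :
    'M[k]_(#|{: piece_index n s e}|, #|{: piece_index n s' e}|) :=
  \matrix_(t, t') coords s' e (monomial_row k t *m D) 0 t'.

Lemma mul_piece_matrix v :
  v *m piece_matrix = coords s' e (of_coords v *m D).
Proof.
apply/rowP => t'; rewrite [LHS]mxE [RHS]mxE mulmx_suml summxE raddf_sum /=.
by apply: eq_bigr => t _; rewrite [X in _ * X]mxE [X in _ * X]mxE -scalemxAl entryZ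
  [RHS]mcoeffCM.
Qed.

End PieceMatrix.

Section Euler.
Variables (k : fieldType) (n : nat).
Local Notation S := (mpoly n k).
Variables (I : S -> Prop) (F : free_seq k n).
Hypotheses (hI : graded_ideal I) (gradF : graded_maps F)
  (exF : exact_seq I F).
Hypothesis shift_lower : forall p (i : 'I_(rk F p)), p%:Z <= shift i.
Variables (e h : nat) (ev : S -> 'rV[k]_h).
Hypotheses (evD : forall f g, ev (f + g) = ev f + ev g)
  (evC : forall c f, ev (mpolyC n c * f) = c *: ev f)
  (ev_ker : forall f, homog_of_degree e%:Z f -> (I f <-> ev f = 0))
  (ev_surj : forall v, exists2 f, homog_of_degree e%:Z f & ev f = v).

Local Notation d p := #|{: piece_index n (@shift k n F p) e}|.

Lemma shift_nonneg p (i : 'I_(rk F p)) : 0 <= shift i.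
Proof. by have := shift_lower i; lia. Qed.

Lemma bd_graded p u : graded_row (@shift _ _ F p.+1) e u ->
  graded_row (@shift _ _ F p) e (u *m bd F p).
Proof. by move=> hu; exact: (homog_row_bd gradF). Qed.

Lemma aug_hproj (u : 'rV[S]_(rk F 0)) :
  hproj e%:Z ((u *m aug F) 0 0) = (row_hproj e%:Z u *m aug F) 0 0.
Proof.
rewrite !mxE raddf_sum; apply: eq_bigr => j _ /=.
by have [_ haug] := gradF; rewrite (hprojM _ _ (haug j)) mxE.
Qed.

Lemma aug_homog (u : 'rV[S]_(rk F 0)) : graded_row (@shift _ _ F 0) e u ->
  homog_of_degree e%:Z ((u *m aug F) 0 0).
Proof.
move=> hu; have <- : row_hproj e%:Z u = u by exact: row_hproj_id.
by rewrite -aug_hproj; exact: hproj_homog.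
Qed.

Lemma ev0 : ev 0 = 0.
Proof. by apply: (addrI (ev 0)); rewrite -evD !addr0. Qed.

Lemma ev_sum (T : Type) (r : seq T) (G : T -> S) :
  ev (\sum_(i <- r) G i) = \sum_(i <- r) ev (G i).
Proof. exact: (big_morph ev evD ev0). Qed.

Definition aug_matrix : 'M[k]_(d 0, h) :=
  \matrix_(t, c) ev ((monomial_row k t *m aug F) 0 0) 0 c.

Lemma mul_aug_matrix (v : 'rV[k]_(d 0)) :
  v *m aug_matrix = ev ((of_coords v *m aug F) 0 0).
Proof.
apply/rowP => c; rewrite [LHS]mxE mulmx_suml summxE ev_sum summxE.
by apply: eq_bigr => t _; rewrite [X in _ * X]mxE -scalemxAl entryZ evC [RHS]mxE.
Qed.

Lemma piece_exact p (v : 'rV[k]_(d p)) (w : 'rV[S]_(rk F p.+1)) :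
  of_coords v = w *m bd F p ->
  exists w', v = w' *m piece_matrix (@shift _ _ F p.+1) (@shift _ _ F p) e (bd F p).
Proof.
move=> vw; exists (coords _ e (row_hproj e%:Z w)).
rewrite mul_piece_matrix coordsK; last exact: row_hproj_homog.
  rewrite -(row_hproj_bd gradF) -vw -[LHS]of_coordsK row_hproj_id //.
  exact: of_coords_graded.
exact: shift_nonneg.
Qed.

(** F_p starts in degree p or later, so its degree e part vanishes for p > P and the exact complex
    of degree e parts is finite. *)
Lemma euler_pieces (P : nat) : (e <= P)%N ->
  h%:Z = \sum_(p < P.+1) (-1) ^+ p * (d p)%:Z.
Proof.
move=> eP; have [ex1 ex2 ex3] := exF.
apply: (@euler_exact k (fun p => d p) h
  (fun p => piece_matrix (@shift _ _ F p.+1) (@shift _ _ F p) e (bd F p)) aug_matrix).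
- have surj (c : 'I_h) : exists v : 'rV[k]_(d 0), v *m aug_matrix = delta_mx 0 c.
    have [f hf <-] := ev_surj (delta_mx 0 c); have [u hu] := ex1 f.
    exists (coords _ e (row_hproj e%:Z u)); rewrite mul_aug_matrix coordsK; last 2 first.
    + exact: shift_nonneg.
    + exact: row_hproj_homog.
    rewrite -aug_hproj; set g := hproj _ _.
    have hfg : homog_of_degree e%:Z (g - f).
      by apply: homogD; [exact: hproj_homog|exact: homogN].
    have /(ev_ker hfg) : I (g - f).
      have := hipN hI (hip_hproj hI e%:Z hu).
      by rewrite raddfB /= (hproj_id hf) opprB.
    move=> /(congr1 (+%R (ev f))); rewrite addr0 -evD addrC subrK.
    exact.
  have /choice[v hv] := surj; apply/row_fullP; exists (\matrix_c v c).
  apply/row_matrixP => c; rewrite row_mul rowK hv row1.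
  by [].
- move=> u; rewrite mul_aug_matrix; split.
    move/(ev_ker (aug_homog (of_coords_graded (v := u)))) => /ex2[w hw].
    exact: piece_exact hw.
  case=> w ->; apply/ev_ker; first exact/aug_homog/of_coords_graded.
  rewrite mul_piece_matrix coordsK.
  + exact: bd_aug.
  + exact: shift_nonneg.
  + exact/bd_graded/of_coords_graded.
- move=> p u; rewrite mul_piece_matrix; split.
    move=> h0; have : of_coords u *m bd F p = 0.
      rewrite -[LHS](@coordsK k n _ (@shift _ _ F p) e) ?h0.
      + by rewrite /of_coords big1 // => t _; rewrite mxE mpolyC0 scale0r.
      + exact: shift_nonneg.
      + exact/bd_graded/of_coords_graded.
    by case/ex3 => w hw; exact: piece_exact hw.
  case=> w ->; rewrite mul_piece_matrix coordsK.
  + by rewrite (bd_bd exF) coords0.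
  + exact: shift_nonneg.
  + exact/bd_graded/of_coords_graded.
- apply: eq_card0 => -[[i m] /= hx]; have /eqP him := hx; exfalso.
  by have := shift_lower i; move: him eP; lia.
Qed.

End Euler.

Section Difference.
Implicit Types (f g : int -> int) (q a : int) (n : nat).

Definition diff f q : int := f q - f (q - 1).

Definition difference n f := iter n diff f.

Arguments difference : simpl never.

Lemma differenceS n f q :
  difference n.+1 f q = difference n f q - difference n f (q - 1).
Proof. by []. Qed.

Lemma differenceSr n f : difference n.+1 f = difference n (diff f).
Proof. exact: iterSr. Qed.

(** Backward differences at q look only at arguments up to q, so an Euler sum truncated at P, valid
    up to degree P, may replace the Hilbert function. *)
Lemma difference_ext_le n f g b : (forall q, q <= b -> f q = g q) ->
  forall q, q <= b -> difference n f q = difference n g q.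
Proof.
move=> fg; elim: n => [|n IH] q qb; first exact: fg.
by rewrite !differenceS !IH //; lia.
Qed.

Lemma difference_shift n f a q :
  difference n (fun x => f (x - a)) q = difference n f (q - a).
Proof.
elim: n q => [//|n IH] q; rewrite !differenceS !IH.
by congr (_ - difference n f _); lia.
Qed.

Lemma difference_sum n (T : Type) (r : seq T) (P : pred T) (G : T -> int -> int) q :
  difference n (fun x => \sum_(i <- r | P i) G i x) q =
  \sum_(i <- r | P i) difference n (G i) q.
Proof.
elim: n q => [//|n IH] q; rewrite differenceS !IH -sumrB.
by apply: eq_bigr.
Qed.

Lemma difference_scale n c f q :
  difference n (fun x => c * f x) q = c * difference n f q.
Proof. by elim: n q => [//|n IH] q; rewrite !differenceS !IH mulrBr. Qed.

Definition indicator a : int -> int := fun q => (q == a)%:Z.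

Lemma difference_indicator n q : difference n (indicator 0) q =
  if q is Posz d then (-1) ^+ d * 'C(n, d)%:Z else 0.
Proof.
elim: n q => [|n IH] q.
  by rewrite /difference /= /indicator; case: q => [[|d]|d];
    rewrite ?bin0n ?mulr0 //= mulr1.
rewrite differenceS !IH; case: q => [[|d]|d].
- by rewrite !bin0 subr0.
- have -> : (d.+1%:Z - 1) = d%:Z :> int by lia.
  by rewrite binS PoszD exprS; ring.
- by have -> : (Negz d - 1) = Negz d.+1 :> int by lia.
Qed.

(** Hilbert function of a polynomial ring in n + 1 variables, with value 0 in negative degrees. *)
Definition mono_count n : int -> int :=
  fun q => if q is Posz d then 'C(d + n, d)%:Z else 0.

Lemma diff_mono_count n : diff (mono_count n.+1) =1 mono_count n.
Proof.
case=> [[|d]|d]; rewrite /diff //.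
  by rewrite /= !bin0 subr0.
have -> : (d.+1%:Z - 1) = d%:Z :> int by lia.
by rewrite /= !addnS !addSn binS PoszD addrK.
Qed.

Lemma difference_ext n f g : f =1 g -> difference n f =1 difference n g.
Proof. by move=> fg q; apply: (@difference_ext_le n f g q). Qed.

Lemma difference_mono_count n : difference n.+1 (mono_count n) =1 indicator 0.
Proof.
elim: n => [|n IH] q; last first.
  by rewrite differenceSr (difference_ext _ (@diff_mono_count n)) IH.
rewrite /difference /= /diff /indicator; case: q => [[|d]|d] //.
have -> : (d.+1%:Z - 1) = d%:Z :> int by lia.
by rewrite /= !addn0 !binn subrr.
Qed.

End Difference.
Arguments difference : simpl never.

Lemma card_degree n d b : (d < b)%N ->
  #|[pred m : bmultinom n.+1 b | mdeg (bmnm m) == d]| = 'C(d + n, d).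
Proof.
move=> db; rewrite -size_basis cardE -(size_map (@bmnm _ _)).
apply/perm_size/uniq_perm; rewrite ?uniq_basis //.
  by rewrite map_inj_uniq ?enum_uniq //; exact: val_inj.
move=> m; rewrite -basis_cover; apply/mapP/idP.
  by case=> m'; rewrite mem_enum inE => hm' ->.
move=> /eqP hm; have hb : (mdeg m < b)%N by rewrite hm.
by exists (BMultinom hb); rewrite // mem_enum inE /= hm.
Qed.

Lemma card_piece_index n r (s : 'I_r -> int) e : (forall i, 0 <= s i) ->
  #|{: piece_index n.+1 s e}|%:Z = \sum_i mono_count n (e%:Z - s i).
Proof.
move=> s0; rewrite card_sig -sum1_card.
rewrite (eq_bigl (fun x : 'I_r * bmultinom n.+1 e.+1 =>
  true && ((mdeg (bmnm x.2))%:Z + s x.1 == e%:Z))) //.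
rewrite -(pair_big_dep xpredT (fun i (m : bmultinom n.+1 e.+1) =>
  (mdeg (bmnm m))%:Z + s i == e%:Z) (fun _ _ => 1%N)).
rewrite (big_morph Posz PoszD (erefl _)); apply: eq_bigr => i _.
rewrite sum1_card /mono_count; have si := s0 i.
case E : (e%:Z - s i) => [d|d].
  congr Posz; rewrite -(@card_degree n d e.+1); last by lia.
  apply: eq_card => m; change (((mdeg (bmnm m))%:Z + s i == e%:Z) = (mdeg (bmnm m) == d)).
  by apply/eqP/eqP; lia.
rewrite eq_card0 // => m; change (((mdeg (bmnm m))%:Z + s i == e%:Z) = false).
by apply/eqP; lia.
Qed.

Section BettiDifference.
Variables (k : fieldType) (n : nat).
Local Notation N := n.+3.
Variable (F : free_seq k N).
Hypotheses (shift_0 : forall i : 'I_(rk F 0), shift i = 0)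
  (shift_ge : forall p (i : 'I_(rk F p.+1)), p.+2%:Z <= shift i)
  (shift_le : forall p (i : 'I_(rk F p)), shift i <= 2 + p%:Z /\ (p <= n)%N).

Lemma betti_eq0 p q : (forall i : 'I_(rk F p), shift i <> q) -> betti F p q = 0%N.
Proof. by move=> h; apply: eq_card0 => i; rewrite !inE; apply/eqP/h. Qed.

Variables (H : nat -> nat) (h2 : int).
Definition hilbert (q : int) : int := if q is Posz e then (H e)%:Z else 0.
Hypothesis euler : forall e P, (e <= P)%N -> (H e)%:Z =
  \sum_(p < P.+1) (-1) ^+ p * #|{: piece_index N (@shift k N F p) e}|%:Z.
Hypothesis diff3 : forall q, difference 3 hilbert q =
  indicator 0 q + n%:Z * indicator 1 q + h2 * indicator 2 q.

(** The N-th difference turns the Hilbert function of S(- shift i) into the indicator of [shift i],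
    so the Euler sum becomes a signed count of generators of degree q. *)
Lemma difference_hilbert q P : q <= P%:Z ->
  difference N hilbert q = \sum_(p < P.+1) (-1) ^+ p * (betti F p q)%:Z.
Proof.
move=> qP.
have shift_nneg p (i : 'I_(rk F p)) : 0 <= shift i.
  case: p i => [|p] i; first by rewrite shift_0.
  by have := shift_ge i; lia.
rewrite (@difference_ext_le _ _ (fun x => \sum_(p < P.+1) (-1) ^+ p *
    \sum_i mono_count n.+2 (x - @shift k N F p i)) _ _ _ qP).
  rewrite difference_sum; apply: eq_bigr => p _.
  rewrite difference_scale difference_sum; congr (_ * _).
  rewrite /betti -sum1_card (big_morph Posz PoszD (erefl _)) [RHS]big_mkcond /=.
  apply: eq_bigr => i _; rewrite difference_shift difference_mono_count.
  by rewrite /indicator inE subr_eq0 eq_sym; case: eqP.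
case=> [e|e] he; rewrite /hilbert.
  rewrite (euler he); apply: eq_bigr => p _.
  by rewrite card_piece_index // => i; exact: shift_nneg.
rewrite big1 // => p _; rewrite big1 ?mulr0 // => i _; rewrite /mono_count.
by case E : (_ - _) => [d|d] //; have := shift_nneg _ i; move: E; lia.
Qed.

Lemma betti_difference l : (1 <= l <= n.+1)%N ->
  (b_ F l)%:Z - (c_ F (n.+2 - l))%:Z =
  n%:Z * 'C(n, l)%:Z - 'C(n, l.+1)%:Z - h2 * 'C(n, l.-1)%:Z.
Proof.
case: l => [//|l] /andP[_ ln].
(* The conventions at both ends agree with the resolution: [b_] at n + 1 would count generators
   beyond the length n, and [c_] at n + 1 generators of F_0 in degree 2. *)
have bE : b_ F l.+1 = betti F l.+1 l.+2.
  rewrite /b_; case: ifP => // hl; rewrite betti_eq0 // => i.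
  by have [_] := shift_le i; lia.
have cE : c_ F (n.+2 - l.+1) = betti F l l.+2.
  rewrite /c_; case: ifP => hl.
    by congr betti; lia.
  rewrite betti_eq0 // => i; have l0 : l = 0%N by lia.
  by subst l; rewrite shift_0.
have := @difference_hilbert l.+2 l.+2 (lexx _).
(* In degree l + 2 the terms with p < l have stopped, at degree p + 2, and the one with p = l + 2
   has not started, at degree p + 1; only p = l and p = l + 1 remain. *)
rewrite 3!big_ord_recr /= big1 => [|p _]; last first.
  rewrite betti_eq0 ?mulr0 // => i; have [hi _] := shift_le i.
  by have := ltn_ord p; lia.
rewrite (@betti_eq0 l.+2 l.+2) => [|i]; last by have := shift_ge i; lia.
rewrite bE cE mulr0 addr0 add0r.
have -> : difference N hilbert l.+2 = difference n (difference 3 hilbert) l.+2.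
  by rewrite /difference -iterD addn3.
rewrite (difference_ext _ diff3).
have Ea a : difference n (indicator a) l.+2 = difference n (indicator 0) (l.+2%:Z - a).
  rewrite -difference_shift; apply: difference_ext => x.
  by rewrite /indicator subr_eq0.
have -> : difference n (fun q => indicator 0 q + n%:Z * indicator 1 q + h2 * indicator 2 q)
   l.+2 = difference n (indicator 0) l.+2 + n%:Z * difference n (indicator 1) l.+2
     + h2 * difference n (indicator 2) l.+2.
  pose G (i : 'I_3) := fun q => [:: 1; n%:Z; h2]`_i * indicator i%:Z q.
  have := @difference_sum n _ (index_enum 'I_3) xpredT G l.+2.
  rewrite (@difference_ext _ _ (fun q => indicator 0 q + n%:Z * indicator 1 q
     + h2 * indicator 2 q)) => [->|q].
    by rewrite !big_ord_recl big_ord0 /G !difference_scale /= addr0 mul1r addrA.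
  by rewrite !big_ord_recl big_ord0 /G /= addr0 mul1r addrA.
rewrite !Ea !difference_indicator subr0.
have -> : l.+2%:Z - 1 = l.+1%:Z by lia.
have -> : l.+2%:Z - 2 = l%:Z by lia.
rewrite !exprS => E.
(* With the sign replaced by either of its two values the identity becomes linear. *)
have : (-1) ^+ l = 1 :> int \/ (-1) ^+ l = -1 :> int.
  by rewrite -signr_odd; case: (odd l); [right; exact: expr1|left; exact: expr0].
move: E; move: ((-1) ^+ l) => s E [] sE; move: E; rewrite sE; lia.
Qed.

End BettiDifference.

(** * Regular sequences from leading terms *)

Lemma sum_ord3 (V : nmodType) (P : pred 'I_3) (G : 'I_3 -> V) :
  \sum_(s | P s) G s = (if P o0 then G o0 else 0) + (if P o1 then G o1 else 0)
    + (if P o2 then G o2 else 0).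
Proof.
rewrite big_mkcond /= !big_ord_recl big_ord0 addr0 addrA.
rewrite (_ : lift ord0 (lift ord0 ord0) = o2); last exact: val_inj.
rewrite (_ : lift ord0 ord0 = o1); last exact: val_inj.
by rewrite (_ : ord0 = o0); last exact: val_inj.
Qed.

Definition step nv (lead : 'I_3 -> multinom nv -> multinom nv) s c :=
  mnm_add c (lead s c).

Definition theta (k : fieldType) nv (W : 'I_3 -> seq (multinom nv)) s : mpoly nv k :=
  \sum_(x <- W s) mpolyX k x.

(* [C] is the monomial basis of M; [theta W s] maps a monomial [c] to
   [step lead s c] plus monomials of larger [key]. *)
Record leading_terms nv (C : pred (multinom nv)) (key deg : multinom nv -> nat)
    (bound : nat -> nat) (W : 'I_3 -> seq (multinom nv))
    (lead : 'I_3 -> multinom nv -> multinom nv) : Prop := {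
  lt_uniq : forall s, uniq (W s);
  lt_lead_mem : forall s c, C c -> lead s c \in W s;
  lt_closed : forall s c x, C c -> x \in W s -> C (mnm_add c x);
  lt_deg : forall s c x, x \in W s -> deg (mnm_add c x) = (deg c).+1;
  lt_bound : forall c, C c -> (key c <= bound (deg c))%N;
  lt_key_lead : forall s c x, C c -> x \in W s -> x != lead s c ->
    (key (step lead s c) < key (mnm_add c x))%N;
  lt_step_inj : forall s c c', C c -> C c' ->
    step lead s c = step lead s c' -> c = c';
  lt_step_comm : forall s s' c c', s != s' -> C c -> C c' ->
    step lead s c = step lead s' c' -> exists2 c'', C c'' & c = step lead s' c'';
  lt_step_swap : forall s s' c, C c ->
    step lead s (step lead s' c) = step lead s' (step lead s c) }.

Section LeadingTerms.
Variables (k : fieldType) (nv : nat).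
Local Notation S := (mpoly nv k).
Local Notation mon := (multinom nv).
Local Notation X := (@mpolyX nv k).
Variables (C : pred mon) (key deg : mon -> nat) (bound : nat -> nat).
Variables (W : 'I_3 -> seq mon) (lead : 'I_3 -> mon -> mon).
Hypothesis leadH : leading_terms C key deg bound W lead.
Let W_uniq := lt_uniq leadH.
Let lead_mem := lt_lead_mem leadH.
Let C_step := lt_closed leadH.
Let deg_step := lt_deg leadH.
Let key_bound := lt_bound leadH.
Let key_lead := lt_key_lead leadH.
Let step_inj := lt_step_inj leadH.
Lemma step_comm (s s' : 'I_3) c c' : (s' < s)%N -> C c -> C c' ->
  step lead s c = step lead s' c' -> exists2 c'', C c'' & c = step lead s' c''.
Proof.
move=> lt; apply: (lt_step_comm leadH).
by rewrite -val_eqE; apply: contraTneq lt => ->; rewrite ltnn.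
Qed.

Local Notation step := (step lead).
Local Notation theta := (theta k W).

Definition supported (P : pred mon) (g : S) := forall c, mcoeff c g != 0 -> P c.

(** Standard monomials: c is not the leading monomial of theta_s times a monomial, for any s in
    A. *)
Definition off (A : pred 'I_3) c := forall s c', A s -> C c' -> step s c' <> c.

Implicit Types (P : pred mon) (A : pred 'I_3) (Q : pred nat) (c : mon).

Lemma supported0 P : supported P 0.
Proof. by move=> c; rewrite mcoeff0 eqxx. Qed.

Lemma supportedX P c : P c -> supported P (X c).
Proof. by move=> Pc c'; rewrite mcoeffX; case: (c =P c') => [<-|_ /eqP]. Qed.

Lemma supportedD P f g : supported P f -> supported P g -> supported P (f + g).
Proof.
move=> hf hg c; rewrite mcoeffD; have [->|] := eqVneq (mcoeff c f) 0.
  by rewrite add0r; exact: hg.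
by move=> /hf.
Qed.

Lemma supportedZ P a f : supported P f -> supported P (a *: f).
Proof.
move=> hf c; rewrite mcoeffZ => h; apply: hf; apply: contraNneq h => ->.
by rewrite mulr0.
Qed.

Lemma supportedN P f : supported P f -> supported P (- f).
Proof. by move=> hf; rewrite -scaleN1r; exact: supportedZ. Qed.

Lemma supported_sum P (I : Type) (r : seq I) (Q : pred I) (G : I -> S) :
  (forall i, Q i -> supported P (G i)) -> supported P (\sum_(i <- r | Q i) G i).
Proof.
move=> h; elim/big_rec: _ => [|i x Qi hx]; first exact: supported0.
by apply: supportedD => //; exact: h.
Qed.

Lemma supported_thetaM s f : supported C f -> supported C (theta s * f).
Proof.
move=> hf; rewrite /theta mulr_suml big_seq; apply: supported_sum => w wW.
rewrite mulrC (mpolyE f) mulr_suml big_seq; apply: supported_sum => c cf.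
rewrite -scalerAl -mpolyXD; apply/supportedZ/supportedX/(C_step _ wW).
by apply: hf; rewrite -mcoeff_msupp.
Qed.

Lemma theta_step s c : C c -> theta s * X c =
  X (step s c) + \sum_(w <- W s | w != lead s c) X (mnm_add c w).
Proof.
move=> Cc; rewrite /theta (bigD1_seq (lead s c)) /= ?lead_mem //.
rewrite mulrDl -mpolyXD addmC; congr (_ + _); rewrite mulr_suml.
by apply: eq_bigr => w _; rewrite -mpolyXD addmC.
Qed.

(** Division with remainder by the thetas in A; Q carries a degree condition through the
    rewriting. *)
Definition reducible (A : pred 'I_3) (Q : pred nat) (f : S) :=
  exists h : 'I_3 -> S, exists g : S, [/\ forall s, supported C (h s),
    supported (fun c => C c && Q (deg c)) g,
    forall c, mcoeff c g != 0 -> off A c &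
    f = \sum_(s | A s) theta s * h s + g].

Lemma reducible0 A Q : reducible A Q 0.
Proof.
exists (fun=> 0), 0; split=> [s|||]; [exact: supported0|exact: supported0| |].
  by move=> c; rewrite mcoeff0 eqxx.
by rewrite big1 ?addr0 // => s _; rewrite mulr0.
Qed.

Lemma reducibleD A Q f f' : reducible A Q f -> reducible A Q f' ->
  reducible A Q (f + f').
Proof.
move=> [h [g [hh hg og ->]]] [h' [g' [hh' hg' og' ->]]].
exists (fun s => h s + h' s), (g + g'); split.
- by move=> s; exact: supportedD.
- exact: supportedD.
- move=> c; rewrite mcoeffD; have [->|] := eqVneq (mcoeff c g) 0.
    by rewrite add0r; exact: og'.
  by move=> /og.
- rewrite addrACA -big_split /=; congr (_ + _); apply: eq_bigr => s _.
  by rewrite mulrDr.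
Qed.

Lemma reducibleZ A Q a f : reducible A Q f -> reducible A Q (a *: f).
Proof.
move=> [h [g [hh hg og ->]]]; exists (fun s => a *: h s), (a *: g); split.
- by move=> s; exact: supportedZ.
- exact: supportedZ.
- move=> c; rewrite mcoeffZ => ne; apply: og; apply: contraNneq ne => ->.
  by rewrite mulr0.
- by rewrite scalerDr scaler_sumr; congr (_ + _); apply: eq_bigr => s _;
    rewrite scalerAr.
Qed.

Lemma reducible_sum A Q (I : eqType) (r : seq I) (P : pred I) (G : I -> S) :
  (forall i, i \in r -> P i -> reducible A Q (G i)) ->
  reducible A Q (\sum_(i <- r | P i) G i).
Proof.
move=> h; rewrite big_seq_cond; elim/big_rec: _ => [|i x /andP[ir Pi] hx].
  exact: reducible0.
by apply: reducibleD => //; exact: h.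
Qed.

(** If c leads theta_s times a monomial, it is replaced by the other terms of this product: they
    have the same degree and larger keys, and keys are bounded in each degree. *)
Lemma monomial_reducible A Q c : C c -> Q (deg c) -> reducible A Q (X c).
Proof.
have [m] := ubnP (bound (deg c) - key c)%N; elim: m c => // m IH c hm Cc Qc.
have [[s [c' [As Cc' cE]]]|noff] := pselect
    (exists s c', [/\ A s, C c' & step s c' = c]); last first.
  exists (fun=> 0), (X c); split=> [s|||].
  - exact: supported0.
  - by apply: supportedX; rewrite Cc.
  - move=> c'; rewrite mcoeffX; case: (c =P c') => [<- _|_ /eqP//] s c'' As Cc'' E.
    by apply: noff; exists s, c''.
  - by rewrite big1 ?add0r // => s _; rewrite mulr0.
have -> : X c = theta s * X c' - \sum_(w <- W s | w != lead s c') X (mnm_add c' w).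
  by rewrite theta_step // cE addrK.
apply: reducibleD.
  exists (fun s' => if s' == s then X c' else 0), 0; split.
  - by move=> s'; case: ifP => _; [exact: supportedX|exact: supported0].
  - exact: supported0.
  - by move=> ?; rewrite mcoeff0 eqxx.
  - rewrite (bigD1 s) //= eqxx big1 ?addr0 // => s' /andP[_ /negPf ->].
    by rewrite mulr0.
rewrite -scaleN1r; apply: reducibleZ; apply: reducible_sum => w wW ne.
have hk := key_lead Cc' wW ne; rewrite cE in hk.
have dE : deg (mnm_add c' w) = deg c.
  by rewrite (deg_step _ wW) -cE /step (deg_step _ (lead_mem s Cc')).
have Cw := C_step Cc' wW.
by apply: IH; rewrite ?dE //; have := key_bound Cw; rewrite dE; lia.
Qed.

Lemma supported_reducible A Q f :
  supported (fun c => C c && Q (deg c)) f -> reducible A Q f.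
Proof.
move=> hf; rewrite (mpolyE f); apply: reducible_sum => c cf _.
apply: reducibleZ; move: cf; rewrite mcoeff_msupp => /hf/andP[].
exact: monomial_reducible.
Qed.

(** A leading term of least key among all the products cannot cancel. Non-leading terms have larger
    keys, and two equal leading terms of different colors would, by commutation, force the
    coefficient of the larger color to contain a monomial led by the smaller one, which the second
    hypothesis excludes. *)
Lemma leading_independent (g : 'I_3 -> S) :
  (forall s, supported C (g s)) ->
  (forall s c, mcoeff c (g s) != 0 -> off (fun s' : 'I_3 => s' < s)%N c) ->
  \sum_s theta s * g s = 0 -> forall s, g s = 0.
Proof.
move=> gC goff sum0 s0; apply/eqP/negPn/negP => gs0.
pose P m := [exists s, has (fun c => key (step s c) == m) (msupp (g s))].
have exP : exists m, P m.
  have [c cs] : exists c, c \in msupp (g s0).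
    by case E : (msupp (g s0)) gs0 => [|c r]; rewrite -?msupp_eq0 ?E // => _;
      exists c; rewrite mem_head.
  by exists (key (step s0 c)); apply/existsP; exists s0; apply/hasP; exists c.
case: (ex_minnP exP) => m /existsP[s /hasP[c cs /eqP cm]] minm.
have Cc : C c by apply: (gC s); rewrite -mcoeff_msupp.
have key_min s' c' : c' \in msupp (g s') -> (m <= key (step s' c'))%N.
  by move=> h; apply: minm; apply/existsP; exists s'; apply/hasP; exists c'.
have coefE s' : mcoeff (step s c) (theta s' * g s') =
    if s' == s then mcoeff c (g s) else 0.
  rewrite [in LHS](mpolyE (g s')) mulr_sumr raddf_sum /=.
  have termE c' : c' \in msupp (g s') ->
      mcoeff (step s c) (theta s' * (mcoeff c' (g s') *: X c')) =
      if (s' == s) && (c' == c) then mcoeff c (g s) else 0.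
    move=> c's; have Cc' : C c' by apply: (gC s'); rewrite -mcoeff_msupp.
    rewrite -scalerAr mcoeffZ theta_step // mcoeffD mcoeffX raddf_sum /= big1_seq.
      rewrite addr0; have [stepE|ne] := eqVneq (step s' c') (step s c); last first.
        rewrite mulr0; case: andP => // -[/eqP s's /eqP c'c].
        by rewrite s's c'c eqxx in ne.
      have s's : s' = s.
        apply/eqP/negPn/negP => nes.
        have := goff s c; rewrite -mcoeff_msupp => /(_ cs) offc.
        have := goff s' c'; rewrite -mcoeff_msupp => /(_ c's) offc'.
        case: (ltngtP s' s) => [lt|lt|/val_inj eq]; last by rewrite eq eqxx in nes.
          by have [c'' Cc'' E] := step_comm lt Cc Cc' (esym stepE);
            exact: (offc s' c'' lt Cc'').
        by have [c'' Cc'' E] := step_comm lt Cc' Cc stepE;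
          exact: (offc' s c'' lt Cc'').
      by subst s'; rewrite (step_inj Cc' Cc stepE) !eqxx mulr1.
    move=> w /andP[ne wW]; rewrite mcoeffX; case: eqP => // E.
    have := key_lead Cc' wW ne; rewrite E cm => h.
    by have := key_min _ _ c's; rewrite leqNgt h.
  have [s's|ne] := eqVneq s' s; last first.
    by rewrite big1_seq // => c' /andP[_ /termE ->]; rewrite (negPf ne).
  subst s'; rewrite (bigD1_seq c) ?msupp_uniq //= termE // !eqxx /=.
  by rewrite big1_seq ?addr0 // => c' /andP[ne /termE ->]; rewrite (negPf ne) andbF.
have := congr1 (mcoeff (step s c)) sum0; rewrite mcoeff0 raddf_sum /=.
rewrite (bigD1 s) //= coefE eqxx big1 ?addr0 => [/eqP|s' ne].
  by rewrite mcoeff_eq0 cs.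
by rewrite coefE (negPf ne).
Qed.

Lemma theta_regular0 f : supported C f ->
  theta o0 * f = 0 -> f = 0.
Proof.
move=> fC f0; pose g (s : 'I_3) := if s == o0 then f else 0.
rewrite -[f]/(g o0); apply: leading_independent.
- by move=> s; rewrite /g; case: ifP => _; [exact: fC|exact: supported0].
- move=> s c; rewrite /g; case: (s =P _) => [-> _ s' c' //|_].
  by rewrite mcoeff0 eqxx.
- by rewrite sum_ord3 /g /= !mulr0 !addr0.
Qed.

Lemma theta_regular1 f a : supported C f -> supported C a ->
  theta o1 * f = theta o0 * a ->
  exists2 b, supported C b & f = theta o0 * b.
Proof.
move=> fC aC E.
have [h [g [hC gC goff fE]]] : reducible (fun s => s < 1)%N xpredT f.
  by apply: supported_reducible => c /fC ->.
have gC' : supported C g by move=> c /gC /andP[].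
have {}fE : f = theta o0 * h o0 + g.
  by rewrite {1}fE sum_ord3 /= !addr0.
exists (h o0) => //; rewrite {1}fE.
suff -> : g = 0 by rewrite addr0.
pose G (s : 'I_3) := [:: theta o1 * h o0 - a; g; 0]`_s.
rewrite -[g]/(G o1); apply: leading_independent.
- case=> -[|[|[|//]]] i; rewrite /G /=.
  + apply: supportedD; first exact: supported_thetaM.
    exact: supportedN.
  + exact: gC'.
  + exact: supported0.
- case=> -[|[|[|//]]] i c; rewrite /G /=.
  + by move=> _ s.
  + by move=> /goff h1 s c' s1; exact: h1.
  + by rewrite mcoeff0 eqxx.
- rewrite sum_ord3 /G /= mulr0 !addr0.
  move: E; rewrite fE mulrDr mulrBr => <-; ring.
Qed.

Lemma theta_regular2 f a b : supported C f -> supported C a -> supported C b ->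
  theta o2 * f =
    theta o0 * a + theta o1 * b ->
  exists a' b', [/\ supported C a', supported C b' &
    f = theta o0 * a' + theta o1 * b'].
Proof.
move=> fC aC bC E.
have [h [g [hC gC goff fE]]] : reducible (fun s => s < 2)%N xpredT f.
  by apply: supported_reducible => c /fC ->.
have gC' : supported C g by move=> c /gC /andP[].
have {}fE : f = theta o0 * h o0 +
    theta o1 * h o1 + g.
  by rewrite {1}fE sum_ord3 /= !addr0.
exists (h o0), (h o1); split=> //; rewrite {1}fE.
suff -> : g = 0 by rewrite addr0.
(* Independence also wants the coefficient of theta_1 reduced modulo theta_0; the part removed moves
   to the coefficient of theta_0. *)
pose b1 := theta o2 * h o1 - b.
have b1C : supported C b1.
  by apply: supportedD; [exact: supported_thetaM|exact: supportedN].
have [h' [g' [hC' gC1 goff' bE]]] : reducible (fun s => s < 1)%N xpredT b1.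
  by apply: supported_reducible => c /b1C ->.
have {}bE : b1 = theta o0 * h' o0 + g'.
  by rewrite {1}bE sum_ord3 /= !addr0.
pose G (s : 'I_3) := [:: theta o2 * h o0 - a +
  theta o1 * h' o0; g'; g]`_s.
rewrite -[g]/(G o2); apply: leading_independent.
- case=> -[|[|[|//]]] i; rewrite /G /=.
  + apply: supportedD; last exact: supported_thetaM.
    by apply: supportedD; [exact: supported_thetaM|exact: supportedN].
  + by move=> c /gC1 /andP[].
  + exact: gC'.
- case=> -[|[|[|//]]] i c; rewrite /G /=.
  + by move=> _ s.
  + by move=> /goff' h1 s c' s1; exact: h1.
  + by move=> /goff h1 s c' s1; exact: h1.
- rewrite sum_ord3 /G /=.
  have -> : g' = b1 - theta o0 * h' o0.
    by rewrite bE addrAC subrr add0r.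
  have Ea : theta o0 * a =
      theta o2 * f - theta o1 * b.
    by rewrite E addrK.
  rewrite mulrDr mulrBr Ea fE /b1; ring.
Qed.

Lemma theta_top Q f :
  (forall c, C c -> Q (deg c) -> exists s, exists2 c', C c' & step s c' = c) ->
  supported (fun c => C c && Q (deg c)) f ->
  exists2 h : 'I_3 -> S, forall s, supported C (h s) & f = \sum_s theta s * h s.
Proof.
move=> top /(@supported_reducible xpredT)[h [g [hC gC goff ->]]].
exists h => //; suff -> : g = 0 by rewrite addr0.
apply/mpolyP => c; rewrite mcoeff0; apply/eqP/negPn/negP => cg.
have /andP[Cc Qc] := gC c cg; have [s [c' Cc' E]] := top c Cc Qc.
exact: goff c cg s c' isT Cc' E.
Qed.

End LeadingTerms.

(** * Sectors of the cone over a polygon *)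

Definition pt3 := (int * int * int)%type.

Definition det3 (a b c : pt3) : int :=
  a.1.1 * (b.1.2 * c.2 - b.2 * c.1.2) - a.1.2 * (b.1.1 * c.2 - b.2 * c.1.1)
  + a.2 * (b.1.1 * c.1.2 - b.1.2 * c.1.1).

Lemma det3D a b c c' : det3 a b (c + c') = det3 a b c + det3 a b c'.
Proof. by case: c c' => [[x y] d] [[x' y'] d']; rewrite /det3 /=; ring. Qed.

Lemma det3N a b c : det3 a b (- c) = - det3 a b c.
Proof. by case: c => [[x y] d]; rewrite /det3 /=; ring. Qed.

Lemma det3_rot a b c : det3 a b c = det3 c a b.
Proof. by rewrite /det3; ring. Qed.

Lemma det3_swap a b c : det3 a b c = - det3 a c b.
Proof. by rewrite /det3; ring. Qed.

Lemma det3_alt a b : det3 a b b = 0.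
Proof. by rewrite /det3; ring. Qed.

Lemma det3_cramer v a b c p q : det3 v a b * det3 p q c =
  det3 c a b * det3 p q v + det3 v c b * det3 p q a + det3 v a c * det3 p q b.
Proof. by rewrite /det3; ring. Qed.

Lemma det3_cramer_degree v a b c : v.2 = 1 -> a.2 = 1 -> b.2 = 1 ->
  det3 v a b * c.2 = det3 c a b + det3 v c b + det3 v a c.
Proof. by rewrite /det3 => -> -> ->; ring. Qed.

(* Lattice points of the cone are written in homogeneous coordinates.  [ray i]
   vanishes on the plane of v and w_i, [far i] on that of w_i and w_(i+1). *)
Definition ray (v : pt3) (w : nat -> pt3) i c := det3 v (w i) c.
Definition far (w : nat -> pt3) i c := det3 c (w i) (w i.+1).

(** The corners of a convex polygon in cyclic order: [fan_ray] orders the chain by angle as seen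
    from v, [fan_far] makes the line of each chain edge a supporting line, and [fan_far_eq0] keeps
    all other chain corners off it. *)
Record fan (v : pt3) (w : nat -> pt3) (r : nat) : Prop := {
  fan_size : (0 < r)%N;
  fan_apex_degree : v.2 = 1;
  fan_degree : forall i, (i <= r)%N -> (w i).2 = 1;
  fan_ray : forall i j, (i < j <= r)%N -> 0 < ray v w i (w j);
  fan_far : forall i j, (i < r)%N -> (j <= r)%N -> 0 <= far w i (w j);
  fan_far_eq0 : forall i j, (i < r)%N -> (j <= r)%N -> far w i (w j) = 0 ->
    j = i \/ j = i.+1 }.

Section Fan.
Variables (v : pt3) (w : nat -> pt3) (r : nat).
Local Notation ray := (ray v w).
Local Notation far := (far w).
Local Notation D i := (ray i (w i.+1)).
Hypothesis vwr_fan : fan v w r.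
Let r_gt0 := fan_size vwr_fan.
Let v_deg := fan_apex_degree vwr_fan.
Let w_deg := fan_degree vwr_fan.
Let ray_gt0 := fan_ray vwr_fan.
Let far_ge0 := fan_far vwr_fan.
Let far_eq0 := fan_far_eq0 vwr_fan.

Lemma rayD i c c' : ray i (c + c') = ray i c + ray i c'.
Proof. exact: det3D. Qed.

Lemma rayB i c c' : ray i (c - c') = ray i c - ray i c'.
Proof. by rewrite rayD /ray det3N. Qed.

Lemma farE i c : far i c = det3 (w i) (w i.+1) c.
Proof. by rewrite det3_rot. Qed.

Lemma farD i c c' : far i (c + c') = far i c + far i c'.
Proof. by rewrite !farE det3D. Qed.

Lemma farB i c c' : far i (c - c') = far i c - far i c'.
Proof. by rewrite farD !farE det3N. Qed.

Lemma far_v i : far i v = D i.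
Proof. by []. Qed.

Lemma ray_v i : ray i v = 0.
Proof. by rewrite /ray /det3; ring. Qed.

Lemma ray_self i : ray i (w i) = 0.
Proof. exact: det3_alt. Qed.

Lemma far_self i : far i (w i) = 0.
Proof. by rewrite /far /det3; ring. Qed.

Lemma far_next i : far i (w i.+1) = 0.
Proof. by rewrite /far /det3; ring. Qed.

Lemma ray_back i : ray i.+1 (w i) = - D i.
Proof. by rewrite /ray det3_swap. Qed.

Lemma D_gt0 i : (i < r)%N -> 0 < D i.
Proof. by move=> ir; apply: ray_gt0; rewrite leqnn. Qed.

Lemma ray_cramer i j c :
  D i * ray j c = - ray i.+1 c * ray j (w i) + ray i c * ray j (w i.+1).
Proof.
rewrite {1}/ray (det3_cramer v (w i) (w i.+1) c v (w j)) -/(ray j v) ray_v mulr0 add0r.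
by rewrite (det3_swap v c) -/(ray i.+1 c).
Qed.

Lemma far_cramer i j c : D i * far j c =
  far i c * D j - ray i.+1 c * far j (w i) + ray i c * far j (w i.+1).
Proof.
rewrite !(farE j) {1}/ray (det3_cramer v (w i) (w i.+1) c (w j) (w j.+1)) -(farE j v) far_v.
by rewrite (det3_swap v c) -/(ray i.+1 c) mulNr.
Qed.

Lemma degree_cramer i c : (i < r)%N ->
  D i * c.2 = far i c - ray i.+1 c + ray i c.
Proof.
move=> ir; rewrite {1}/ray (@det3_cramer_degree v (w i) (w i.+1) c) //.
- by rewrite (det3_swap v c).
- by apply: w_deg; rewrite ltnW.
- exact: w_deg.
Qed.

Definition cone (c : pt3) : bool :=
  [&& 0 <= ray 0 c, ray r c <= 0 & all (fun i => 0 <= far i c) (iota 0 r)].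

Definition sector c := find (fun i => ray i.+1 c <= 0) (iota 0 r).

(** The plane of v and w_i is excluded for i > 0, so that the sectors partition the cone; this
    strictness also decides the ties in [key_add_far]. *)
Definition in_sector i c :=
  [&& 0 <= far i c, ray i.+1 c <= 0 & if i == 0%N then 0 <= ray 0 c else 0 < ray i c].

Lemma coneP c : reflect [/\ 0 <= ray 0 c, ray r c <= 0 &
  forall i, (i < r)%N -> 0 <= far i c] (cone c).
Proof.
apply: (iffP and3P) => -[h1 h2 h3]; split=> //.
  by move=> i ir; apply: (allP h3); rewrite mem_iota.
by apply/allP => i; rewrite mem_iota; exact: h3.
Qed.

Lemma coneD c c' : cone c -> cone c' -> cone (c + c').
Proof.
move=> /coneP[a1 a2 a3] /coneP[b1 b2 b3]; apply/coneP; split.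
- by rewrite rayD addr_ge0.
- by rewrite rayD; lia.
- by move=> i ir; rewrite farD addr_ge0 ?a3 ?b3.
Qed.

Lemma cone_sector c : cone c -> (sector c < r)%N /\ in_sector (sector c) c.
Proof.
move=> /coneP[h0 hr hf].
have hs : has (fun i => ray i.+1 c <= 0) (iota 0 r).
  apply/hasP; exists r.-1; first by rewrite mem_iota; lia.
  by rewrite prednK.
have slt : (sector c < r)%N by move: hs; rewrite has_find size_iota.
split=> //; apply/and3P; split; first exact: hf.
  by have := nth_find 0%N hs; rewrite -/(sector c) nth_iota.
case: eqP => // /eqP s0; have sp : ((sector c).-1 < sector c)%N by lia.
have := @before_find _ 0%N (fun i => ray i.+1 c <= 0) (iota 0 r) _ sp.
by rewrite nth_iota ?prednK ?lt0n //=; lia.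
Qed.

Lemma in_sector_ray_ge0 i c : in_sector i c -> 0 <= ray i c.
Proof. by case/and3P => _ _; case: eqP => [->//|_ /ltW]. Qed.

(** By Cramer's rule D i times c is a nonnegative combination of v, w_i and w_(i+1), so a linear
    form takes on c the sign that it has on these three. *)
Lemma in_sector_cone i c : (i < r)%N -> in_sector i c -> cone c /\ sector c = i.
Proof.
move=> ir hc; have ri := in_sector_ray_ge0 hc; case/and3P: hc => hf hr hi.
have Di := D_gt0 ir.
have ray_w a b : (a <= b)%N -> (b <= r)%N -> 0 <= ray a (w b).
  rewrite leq_eqVlt => /orP[/eqP ->|ab br]; first by rewrite ray_self.
  by apply/ltW/ray_gt0; rewrite ab.
have ray_w' a b : (a <= b)%N -> (b <= r)%N -> ray b (w a) <= 0.
  move=> ab br; have := ray_w a b ab br.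
  by rewrite /ray det3_swap oppr_ge0.
have pos j : (0 < j)%N -> (j <= i)%N -> 0 < ray j c.
  move=> j0 ji; rewrite -(pmulr_rgt0 _ Di) ray_cramer.
  have i0 : (i == 0%N) = false by lia.
  rewrite i0 in hi; apply: ltr_wpDl.
    by rewrite mulr_ge0 ?oppr_ge0 // ray_w // ltnW.
  by rewrite mulr_gt0 // ray_gt0; lia.
split; last first.
  apply/eqP; rewrite eqn_leq; apply/andP; split; rewrite leqNgt; apply/negP.
    move=> /(@before_find _ 0%N); rewrite nth_iota //= add0n hr.
    by [].
  move=> si; have hs : has (fun i => ray i.+1 c <= 0) (iota 0 r).
    by rewrite has_find size_iota; exact: ltn_trans ir.
  have := nth_find 0%N hs; rewrite -/(sector c) nth_iota; last exact: ltn_trans ir.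
  by rewrite add0n leNgt pos.
apply/coneP; split.
- rewrite -(pmulr_rge0 _ Di) ray_cramer; apply: addr_ge0.
    by rewrite mulr_ge0 ?oppr_ge0 // ray_w // ltnW.
  by rewrite mulr_ge0 // ray_w.
- rewrite -(pmulr_rle0 _ Di) ray_cramer -oppr_ge0 opprD; apply: addr_ge0.
    by rewrite mulNr opprK -mulrNN mulr_ge0 ?oppr_ge0 // ray_w' // ltnW.
  by rewrite -mulrN mulr_ge0 ?oppr_ge0 // ray_w'.
- move=> j jr; rewrite -(pmulr_rge0 _ Di) far_cramer; apply: addr_ge0.
    apply: addr_ge0; first by rewrite mulr_ge0 // ltW // D_gt0.
    by rewrite -mulNr mulr_ge0 ?oppr_ge0 // far_ge0 // ltnW.
  by rewrite mulr_ge0 // far_ge0.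
Qed.

(* [far i c / D i] is the coordinate of [c] along [v] in its sector; [codet i]
   clears the denominators uniformly in [i]. *)
Definition codet i := \prod_(j < r | j != i :> nat) D j.

Lemma prod_codet i : (i < r)%N -> \prod_(j < r) D j = D i * codet i.
Proof. by move=> ir; rewrite (bigD1 (Ordinal ir)). Qed.

Lemma codet_gt0 i : 0 < codet i.
Proof. by apply: prodr_gt0 => j _; exact: D_gt0. Qed.

Definition level c := far (sector c) c * codet (sector c).

(** Lexicographic order of level and sector in one natural number, the sector being below r. *)
Definition key c : nat := (`|level c| * r + sector c)%N.

Lemma codet_cross i k a b : (i < r)%N -> (k < r)%N ->
  (a * codet i) * (D i * D k) = (D k * a) * \prod_(j < r) D j /\
  (b * codet k) * (D i * D k) = (D i * b) * \prod_(j < r) D j.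
Proof. by move=> ir kr; rewrite {1}(prod_codet ir) (prod_codet kr); split; ring. Qed.

Lemma level_ge0 c : cone c -> 0 <= level c.
Proof.
move=> cc; have [sr /and3P[h _ _]] := cone_sector cc.
by rewrite mulr_ge0 // ltW // codet_gt0.
Qed.

Lemma key_ltP c c' : cone c -> cone c' ->
  level c < level c' \/ (level c = level c' /\ (sector c < sector c')%N) ->
  (key c < key c')%N.
Proof.
move=> cc cc'; have [sr _] := cone_sector cc; have [sr' _] := cone_sector cc'.
have := level_ge0 cc; have := level_ge0 cc'; rewrite /key.
case: (level c) => // a; case: (level c') => // b _ _ /= [lt|[[->] lt]]; last first.
  by rewrite ltn_add2l.
have ab : (a.+1 <= b)%N by lia.
have := leq_mul ab (leqnn r); rewrite mulSn => h.
by apply: (leq_trans _ (leq_addr _ _)); apply: (leq_trans _ h); rewrite addnC ltn_add2r.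
Qed.

(** Expanding c in its sector i, D i times [far k (c + w j)] is D k times [far i c] plus three
    nonnegative terms, so the level cannot drop. If it stays, w_j lies on the edge line of the new
    sector k, so j is k or k + 1, and k differs from i. *)
Lemma key_add_far c j : cone c -> (j <= r)%N -> cone (c + w j) ->
  j != sector c -> j != (sector c).+1 -> (key c < key (c + w j)%R)%N.
Proof.
move=> cc jr cc' ji ji1; have [ir hi] := cone_sector cc.
have [kr hk] := cone_sector cc'; apply: key_ltP => //.
set i := sector c in ir hi ji ji1 *; set k := sector (c + w j) in kr hk *.
have Di := D_gt0 ir; have Dk := D_gt0 kr.
have P0 : 0 < \prod_(j < r) D j by apply: prodr_gt0 => m _; exact: D_gt0.
have E : D i * far k (c + w j) = D k * far i c + (- ray i.+1 c * far k (w i))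
    + ray i c * far k (w i.+1) + D i * far k (w j).
  by rewrite farD mulrDr (far_cramer i k c); ring.
have ri := in_sector_ray_ge0 hi; have /and3P[fi ri1 hi0] := hi.
have e1 : 0 <= - ray i.+1 c * far k (w i).
  by rewrite mulr_ge0 ?oppr_ge0 // far_ge0 // ltnW.
have e2 : 0 <= ray i c * far k (w i.+1) by rewrite mulr_ge0 // far_ge0.
have e3 : 0 <= D i * far k (w j) by rewrite mulr_ge0 ?(ltW Di) // far_ge0.
have [C1 C2] := codet_cross (far i c) (far k (c + w j)) ir kr.
have DD : 0 < D i * D k by exact: mulr_gt0.
rewrite /level -/i -/k -(ltr_pM2r DD) C1 C2 (ltr_pM2r P0).
have [lt|ge] := ltP (D k * far i c) (D i * far k (c + w j)); [by left|right].
have [z2 z3] : ray i c * far k (w i.+1) = 0 /\ D i * far k (w j) = 0 by lia.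
split.
  apply: (mulIf (lt0r_neq0 DD)); rewrite C1 C2; congr (_ * _); lia.
have /(far_eq0 kr jr) jk : far k (w j) = 0.
  by apply/eqP; move/eqP: z3; rewrite mulf_eq0 (gt_eqF Di).
case: (ltngtP i k) => // [ki|ik]; last by case: jk; lia.
(* Were k < i, then i > 0 and [ray i c] is strictly positive, so the vanishing of the second extra
   term would put w_(i+1) on edge line k. *)
have i0 : (i == 0%N) = false by lia.
rewrite i0 in hi0; move/eqP: z2; rewrite mulf_eq0 (gt_eqF hi0) /= => /eqP.
by move=> /(far_eq0 kr ir); lia.
Qed.

(** The coordinate of c along v is at most the sum of its three coordinates in the sector, which is
    its degree. *)
Lemma key_bound c : cone c ->
  (key c <= absz ((\prod_(j < r) D j) * c.2)%R * r + r)%N.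
Proof.
move=> cc; have [ir hi] := cone_sector cc.
have ri := in_sector_ray_ge0 hi; have /and3P[fi ri1 _] := hi.
apply: leq_add; last exact: ltnW.
apply: leq_mul => //; have := level_ge0 cc.
have : level c <= \prod_(j < r) D j * c.2.
  rewrite (prod_codet ir) mulrAC degree_cramer // ler_wpM2r ?(ltW (codet_gt0 _)) //.
  by lia.
by lia.
Qed.

(* Color 0 is the pivot, and the chain is colored alternately with 1 and 2, so
   that each sector has one corner of each color. *)
Definition lead (s : 'I_3) i : pt3 :=
  match nat_of_ord s with
  | 0%N => v
  | 1%N => if odd i then w i.+1 else w i
  | _ => if odd i then w i else w i.+1
  end.

Definition color_class (s : 'I_3) : seq pt3 :=
  if s == 0%N :> nat then [:: v]
  else [seq w j | j <- iota 0 r.+1 & odd j == (s == 2 :> nat)].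

Lemma lead_cases (s : 'I_3) i :
  [\/ s = 0%N :> nat /\ lead s i = v,
      [/\ (0 < s)%N, lead s i = w i & odd i = (s == 2 :> nat)] |
      [/\ (0 < s)%N, lead s i = w i.+1 & odd i.+1 = (s == 2 :> nat)]].
Proof.
case: s => -[|[|[|//]]] p; rewrite /lead /=; first by constructor 1.
  by case: (odd i); [constructor 3|constructor 2].
by case: (odd i); [constructor 2|constructor 3].
Qed.

Lemma lead_in_color s i : (i < r)%N -> lead s i \in color_class s.
Proof.
move=> ir; rewrite /color_class.
case: (lead_cases s i) => [[s0 ->]|[s0 -> so]|[s0 -> so]].
- by rewrite s0 mem_head.
- by rewrite (gtn_eqF s0); apply: map_f; rewrite mem_filter mem_iota so eqxx add0n; lia.
- by rewrite (gtn_eqF s0); apply: map_f; rewrite mem_filter mem_iota so eqxx add0n; lia.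
Qed.

Lemma in_sector_add_lead s i c : (i < r)%N -> in_sector i c ->
  in_sector i (c + lead s i).
Proof.
move=> ir; have Di := D_gt0 ir; rewrite /in_sector !rayD farD.
case: (lead_cases s i) => [[_ ->]|[_ -> _]|[_ -> _]] /and3P[h1 h2 h3].
- rewrite far_v !ray_v !addr0; apply/and3P; split=> //.
  by rewrite addr_ge0 // ltW.
- rewrite far_self ray_back ray_self !addr0; apply/and3P; split=> //; first by lia.
  by case: eqP h3 => [i0|_] // h3; rewrite i0 ray_self addr0.
- rewrite far_next ray_self !addr0; apply/and3P; split=> //.
  by case: eqP h3 => [i0|_] h3; move: Di; rewrite ?i0; lia.
Qed.

Lemma sector_add_lead s c : cone c -> cone (c + lead s (sector c)) /\
  sector (c + lead s (sector c)) = sector c.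
Proof.
move=> cc; have [ir hi] := cone_sector cc.
exact: in_sector_cone (in_sector_add_lead s ir hi).
Qed.

Lemma key_add_lead (s : 'I_3) c : cone c -> (0 < s)%N ->
  key (c + lead s (sector c)) = key c.
Proof.
move=> cc s0; have [_ E] := sector_add_lead s cc.
rewrite /key /level E farD; set i := sector c.
by case: (lead_cases s i) => [[]|[_ -> _]|[_ -> _]]; rewrite ?far_self ?far_next ?addr0 //; lia.
Qed.

(** A lead corner of color 1 or 2 lies on the far edge of the sector and leaves the key unchanged,
    while a corner of that color outside the sector raises it; color 0 has a single element. *)
Lemma color_class_key s c a : cone c -> a \in color_class s ->
  a != lead s (sector c) -> cone (c + a) ->
  (key (c + lead s (sector c))%R < key (c + a)%R)%N.
Proof.
move=> cc; have [ir hi] := cone_sector cc; case: (posnP s) => [s0|s0].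
  have -> : lead s (sector c) = v by rewrite /lead s0.
  by rewrite /color_class s0 inE => ->.
rewrite key_add_lead // => aW ne.
have [j [jr js aE]] : exists j, [/\ (j <= r)%N, odd j = (s == 2 :> nat) & a = w j].
  move: aW; rewrite /color_class (gtn_eqF s0) => /mapP[j].
  by rewrite mem_filter mem_iota => /andP[/eqP js jr] ->; exists j.
rewrite aE => cc'; apply: key_add_far => //; apply/eqP => jE; move: ne; rewrite aE jE;
  case: (lead_cases s (sector c)) => [[]|[_ -> so]|[_ -> so]]; rewrite ?eqxx //; try lia.
all: by move: js; rewrite jE -so /=; case: odd.
Qed.

(** In the coordinates of one simplicial sector, c + a = c' + b with distinct corners a and b makes
    the coordinate of c along b that of c' plus 1. *)
Lemma in_sector_sub_lead (s s' : 'I_3) i c c' : (i < r)%N -> s != s' ->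
  in_sector i c -> in_sector i c' -> c + lead s i = c' + lead s' i ->
  in_sector i (c - lead s' i).
Proof.
move=> ir ss' /and3P[f1 r1 n1] /and3P[f2 r2 n2] E; have Di := D_gt0 ir.
have ne : (s != s' :> nat) by [].
have := ltn_ord s; have := ltn_ord s'.
have := congr1 (far i) E; have := congr1 (ray i) E; have := congr1 (ray i.+1) E.
rewrite !farD !rayD /in_sector farB !rayB.
case: (lead_cases s i) => [[s0 ->]|[s0 -> so]|[s0 -> so]];
case: (lead_cases s' i) => [[s0' ->]|[s0' -> so']|[s0' -> so']];
rewrite ?far_v ?ray_v ?far_self ?ray_self ?far_next ?ray_back => E1 E2 E3 l1 l2;
try (exfalso; move: so so' => /=; case: (odd i) => /=; lia);
try lia; apply/and3P; split; try lia;
move: n1 n2; case: eqP => [i0|_]; rewrite -?{2 4}i0 ?ray_v; move: E2; rewrite ?i0 ?ray_v ?ray_self; lia.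
Qed.

Lemma lead_ex i : exists s s' : 'I_3, lead s i = w i /\ lead s' i = w i.+1.
Proof.
case E : (odd i).
  by exists (@Ordinal 3 2 isT), (@Ordinal 3 1 isT); rewrite /lead /= E.
by exists (@Ordinal 3 1 isT), (@Ordinal 3 2 isT); rewrite /lead /= E.
Qed.

(** The three coordinates of c add up to its degree, so one of them is at least 1 and the
    corresponding corner can be subtracted. *)
Lemma in_sector_top i c : (i < r)%N -> in_sector i c -> 3 <= c.2 ->
  exists s, in_sector i (c - lead s i).
Proof.
move=> ir /and3P[f1 r1 n1] c3; have Di := D_gt0 ir.
have h1 : D i * 3 <= far i c - ray i.+1 c + ray i c.
  by rewrite -degree_cramer // ler_pM2l.
have [s [s' [E E']]] := lead_ex i.
have [hf|hf] := leP (D i) (far i c).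
  exists (@Ordinal 3 0 isT); rewrite /in_sector /lead /= farB !rayB far_v !ray_v.
  rewrite !subr0; apply/and3P; split=> //; first by rewrite subr_ge0.
have [hr|hr] := leP (D i) (- ray i.+1 c).
  exists s; rewrite /in_sector E farB !rayB far_self ray_back subr0.
  rewrite f1 /=; apply/andP; split; first by lia.
  move: n1; case: eqP => [i0|_]; last by rewrite ray_self subr0.
  by rewrite i0 ray_self subr0.
(* With the other two coordinates below 1 this one exceeds 1, so the strict inequality at the
   excluded ray survives the subtraction. *)
exists s'; rewrite /in_sector E' farB !rayB far_next ray_self !subr0.
rewrite f1 r1 /=; move: n1; case: eqP => [i0|_] n1; move: h1 hr hf Di; rewrite ?i0; lia.
Qed.

End Fan.

(** * Lattice points over a triangle as sums of points of the triangle *)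

Section UnimodularDecomposition.
Implicit Types (a b c e q z : pt3).

(** Dual description by linear forms [det3 p p']: it involves no rational coefficients and is
    visibly transitive. *)
Definition in_cone_of a b e c := forall p p', 0 <= det3 p p' a ->
  0 <= det3 p p' b -> 0 <= det3 p p' e -> 0 <= det3 p p' c.

Lemma in_cone_of_det a b e c : 0 < det3 a b e -> 0 <= det3 c b e ->
  0 <= det3 a c e -> 0 <= det3 a b c -> in_cone_of a b e c.
Proof.
move=> D0 h1 h2 h3 p p' ha hb he; rewrite -(pmulr_rge0 _ D0) (det3_cramer a b e).
by rewrite !addr_ge0 // mulr_ge0.
Qed.

Lemma in_cone_of_trans a b e a' b' e' c : in_cone_of a b e a' ->
  in_cone_of a b e b' -> in_cone_of a b e e' -> in_cone_of a' b' e' c ->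
  in_cone_of a b e c.
Proof. by move=> ha hb he hc p p' h1 h2 h3; apply: hc; [exact: ha|exact: hb|exact: he]. Qed.

Lemma pt3_ext c c' : c.1.1 = c'.1.1 -> c.1.2 = c'.1.2 -> c.2 = c'.2 -> c = c'.
Proof. by case: c c' => [[x y] d] [[x' y'] d'] /= -> -> ->. Qed.

Lemma pt3_lin (u v : pt3) : [/\ (u + v).1.1 = u.1.1 + v.1.1,
  (u + v).1.2 = u.1.2 + v.1.2 & (u + v).2 = u.2 + v.2].
Proof. by case: u v => [[x y] d] [[x' y'] d']. Qed.

Lemma pt3N (u : pt3) :
  [/\ (- u).1.1 = - u.1.1, (- u).1.2 = - u.1.2 & (- u).2 = - u.2].
Proof. by case: u => [[x y] d]. Qed.

Lemma pt3_natmul (u : pt3) n : [/\ (u *+ n).1.1 = u.1.1 * n%:Z,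
  (u *+ n).1.2 = u.1.2 * n%:Z & (u *+ n).2 = u.2 * n%:Z].
Proof.
elim: n => [|n [h1 h2 h3]]; first by rewrite mulr0n !mulr0.
rewrite mulrS; have [-> -> ->] := pt3_lin u (u *+ n).
by rewrite h1 h2 h3; split; lia.
Qed.

(** A lattice point outside the sublattice spanned by a, b and e, reduced modulo it into the
    half-open parallelepiped, has degree 1 or 2; in degree 2 its mirror image a + b + e - q is
    taken. *)
Lemma lattice_point_in_triangle a b e : a.2 = 1 -> b.2 = 1 -> e.2 = 1 ->
  1 < det3 a b e -> exists q, [/\ q.2 = 1,
    0 <= det3 q b e < det3 a b e, 0 <= det3 a q e < det3 a b e &
    0 <= det3 a b q < det3 a b e].
Proof.
move=> a1 b1 e1 D1; set D := det3 a b e in D1 *.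
have D0 : 0 < D by lia.
have [z nz] : exists z, ~ [/\ (D %| det3 z b e)%Z, (D %| det3 a z e)%Z &
    (D %| det3 a b z)%Z].
  apply: contrapT => /forallNP h.
  have /contrapT[/dvdzP[x1 E1] /dvdzP[x2 E2] /dvdzP[x3 E3]] := h (1, 0, 0).
  have /contrapT[/dvdzP[y1 F1] /dvdzP[y2 F2] /dvdzP[y3 F3]] := h (0, 1, 0).
  have /contrapT[/dvdzP[z1 G1] /dvdzP[z2 G2] /dvdzP[z3 G3]] := h (0, 0, 1).
  (* The matrix of cofactors has determinant D^2; were all its entries divisible by D, then D^3
     would divide D^2. *)
  have := erefl (D ^+ 2).
  have {1}-> : D ^+ 2 = det3 (det3 (1, 0, 0) b e, det3 (0, 1, 0) b e, det3 (0, 0, 1) b e)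
      (det3 a (1, 0, 0) e, det3 a (0, 1, 0) e, det3 a (0, 0, 1) e)
      (det3 a b (1, 0, 0), det3 a b (0, 1, 0), det3 a b (0, 0, 1)).
    by rewrite /D /det3 /=; ring.
  rewrite E1 E2 E3 F1 F2 F3 G1 G2 G3.
  have -> : det3 (x1 * D, y1 * D, z1 * D) (x2 * D, y2 * D, z2 * D)
      (x3 * D, y3 * D, z3 * D) =
      D ^+ 2 * (D * det3 (x1, y1, z1) (x2, y2, z2) (x3, y3, z3)).
    by rewrite /det3 /=; ring.
  move=> E; have : D * det3 (x1, y1, z1) (x2, y2, z2) (x3, y3, z3) = 1.
    by apply: (mulfI (lt0r_neq0 (exprn_gt0 2 D0))); rewrite mulr1.
  move: (det3 _ _ _) => t tD; have /orP[t1|t0] : (0 < t) || (t <= 0) by lia.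
    by have : D * 1 <= D * t by [rewrite ler_pM2l //; lia]; lia.
  by have : D * t <= 0 by [rewrite pmulr_rle0]; lia.
have modzE m : (m %% D)%Z = m - (m %/ D)%Z * D.
  by rewrite {2}(divz_eq m D) addrC addKr.
pose x := (det3 z b e %/ D)%Z; pose y := (det3 a z e %/ D)%Z.
pose u := (det3 a b z %/ D)%Z.
pose q : pt3 := (z.1.1 - x * a.1.1 - y * b.1.1 - u * e.1.1,
  z.1.2 - x * a.1.2 - y * b.1.2 - u * e.1.2, z.2 - x * a.2 - y * b.2 - u * e.2).
have q1 : det3 q b e = (det3 z b e %% D)%Z.
  by rewrite modzE -/x /q /D /det3 /=; ring.
have q2 : det3 a q e = (det3 a z e %% D)%Z.
  by rewrite modzE -/y /q /D /det3 /=; ring.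
have q3 : det3 a b q = (det3 a b z %% D)%Z.
  by rewrite modzE -/u /q /D /det3 /=; ring.
have Dn0 : D != 0 by lia.
have r1 : 0 <= det3 q b e < D by rewrite q1 modz_ge0 //= ltz_pmod.
have r2 : 0 <= det3 a q e < D by rewrite q2 modz_ge0 //= ltz_pmod.
have r3 : 0 <= det3 a b q < D by rewrite q3 modz_ge0 //= ltz_pmod.
have nz' : ~ (det3 q b e = 0 /\ det3 a q e = 0 /\ det3 a b q = 0).
  rewrite q1 q2 q3 => -[h1 [h2 h3]]; apply: nz.
  by split; apply/dvdz_mod0P.
have dE : D * q.2 = det3 q b e + det3 a q e + det3 a b q by exact: det3_cramer_degree.
have [q1E|q2E] : q.2 = 1 \/ q.2 = 2.
  have lo : 0 < D * q.2 by lia.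
  have hi : D * q.2 < D * 3 by lia.
  by rewrite (pmulr_rgt0 _ D0) in lo; rewrite (ltr_pM2l D0) in hi; lia.
  by exists q.
rewrite q2E in dE.
exists (a + b + e - q).
have dB c c' : det3 c c' (a + b + e - q) =
    det3 c c' a + det3 c c' b + det3 c c' e - det3 c c' q.
  by rewrite !det3D det3N.
have q2' : (a + b + e - q).2 = 1.
  have [_ _ ->] := pt3_lin (a + b + e) (- q); have [_ _ ->] := pt3N q.
  have [_ _ ->] := pt3_lin (a + b) e; have [_ _ ->] := pt3_lin a b.
  by rewrite a1 b1 e1 q2E.
have E1 : det3 (a + b + e - q) b e = D - det3 q b e.
  by rewrite -!(det3_rot b e) dB /D /det3; ring.
have E2 : det3 a (a + b + e - q) e = D - det3 a q e.
  by rewrite (det3_rot a _ e) dB /D /det3; ring.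
have E3 : det3 a b (a + b + e - q) = D - det3 a b q.
  by rewrite dB /D /det3; ring.
by rewrite E1 E2 E3; split=> //; lia.
Qed.

(** For c and q with barycentric coordinates (x, y, z) and (al, be, ga), the smallest of the ratios
    x / al, y / be, z / ga with positive denominator tells which corner q can replace so that the
    smaller triangle still contains c. *)
Lemma min_ratio (x y z al be ga : int) : 0 <= x -> 0 <= y -> 0 <= z ->
  0 <= al -> 0 <= be -> 0 <= ga -> 0 < al + be + ga ->
  [\/ [/\ 0 < al, x * be <= y * al & x * ga <= z * al],
      [/\ 0 < be, y * ga <= z * be & y * al <= x * be] |
      [/\ 0 < ga, z * al <= x * ga & z * be <= y * ga]].
Proof.
move=> x0 y0 z0 al0 be0 ga0 s0.
have [al1|al1] := ltP 0 al; last first.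
  have -> : al = 0 by lia.
  rewrite !mulr0; have [be1|be1] := ltP 0 be; last first.
    have -> : be = 0 by lia.
    by constructor 3; split; rewrite ?mulr0 ?mulr_ge0 //; lia.
  have [h|h] := leP (y * ga) (z * be).
    by constructor 2; split; rewrite ?mulr_ge0.
  by constructor 3; split; [nia|rewrite mulr_ge0|exact: ltW].
have [h1|h1] := leP (x * be) (y * al).
  have [h2|h2] := leP (x * ga) (z * al); first by constructor 1.
  constructor 3; split; [nia|exact: ltW|].
  rewrite -(ler_pM2r al1).
  have a1 : z * al * be <= x * ga * be by rewrite ler_wpM2r // ltW.
  have a2 : x * be * ga <= y * al * ga by rewrite ler_wpM2r.
  lia.
have [h2|h2] := leP (y * ga) (z * be).
  by constructor 2; split=> //; [nia|exact: ltW].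
have be1 : 0 < be by nia.
constructor 3; split; [nia| |exact: ltW].
rewrite -(ler_pM2r be1).
have a1 : z * be * al <= y * ga * al by rewrite ler_wpM2r // ltW.
have a2 : y * al * ga <= x * be * ga by rewrite ler_wpM2r // ltW.
lia.
Qed.

Definition decomposable a b e c := exists s : seq pt3,
  [/\ (size s)%:Z = c.2, c = \sum_(x <- s) x &
      forall x, x \in s -> x.2 = 1 /\ in_cone_of a b e x].

Lemma decomposable_rot a b e c : decomposable a b e c -> decomposable b e a c.
Proof.
move=> [s [h1 h2 h3]]; exists s; split=> // x /h3[x1 xc]; split=> //.
by move=> p p' ? ? ?; exact: xc.
Qed.

(* Induction on the determinant, subdividing the triangle at a lattice point of
   it that is not a corner; unimodular triangles are clear. *)
Lemma triangle_decomposition a b e c : a.2 = 1 -> b.2 = 1 -> e.2 = 1 ->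
  0 < det3 a b e -> 0 <= det3 c b e -> 0 <= det3 a c e -> 0 <= det3 a b c ->
  decomposable a b e c.
Proof.
have [m] := ubnP `|det3 a b e|%N; elim: m a b e c => // m IH a b e c hm a1 b1 e1 D0.
(* The corner a' is replaced by q: the determinant drops, and the last two inequalities say that c
   keeps nonnegative coordinates. *)
have subcase a' b' e' q : (`|det3 a' b' e'| < m.+1)%N -> a'.2 = 1 -> b'.2 = 1 -> e'.2 = 1 ->
    0 < det3 a' b' e' -> q.2 = 1 -> 0 < det3 q b' e' < det3 a' b' e' ->
    0 <= det3 a' q e' -> 0 <= det3 a' b' q -> 0 <= det3 c b' e' ->
    det3 c b' e' * det3 a' q e' <= det3 a' c e' * det3 q b' e' ->
    det3 c b' e' * det3 a' b' q <= det3 a' b' c * det3 q b' e' ->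
    decomposable a' b' e' c.
  move=> hm' a1' b1' e1' D0' q1 /andP[al0 alD] be0 ga0 c0 h1 h2.
  have [|||s [s1 s2 s3]] := IH q b' e' c _ q1 b1' e1' al0 c0.
  - by lia.
  - rewrite -(pmulr_rge0 _ D0'); have -> : det3 a' b' e' * det3 q c e' =
      det3 a' c e' * det3 q b' e' - det3 c b' e' * det3 a' q e' by rewrite /det3; ring.
    by rewrite subr_ge0.
  - rewrite -(pmulr_rge0 _ D0'); have -> : det3 a' b' e' * det3 q b' c =
      det3 a' b' c * det3 q b' e' - det3 c b' e' * det3 a' b' q by rewrite /det3; ring.
    by rewrite subr_ge0.
  exists s; split=> // x /s3[x1 xc]; split=> //.
  apply: in_cone_of_trans xc => //.
  by apply: in_cone_of_det => //; exact: ltW.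
move=> c1 c2 c3; have [D1|D1] := leP (det3 a b e) 1.
  have DE : det3 a b e = 1 by lia.
  set x := det3 c b e in c1 *; set y := det3 a c e in c2 *; set z := det3 a b c in c3 *.
  have cE : [/\ c.1.1 = a.1.1 * x + b.1.1 * y + e.1.1 * z,
     c.1.2 = a.1.2 * x + b.1.2 * y + e.1.2 * z & c.2 = a.2 * x + b.2 * y + e.2 * z].
    by split; rewrite -[LHS]mul1r -DE /x /y /z /det3; ring.
  exists (nseq `|x| a ++ nseq `|y| b ++ nseq `|z| e); split.
  - case: cE => _ _ ->; rewrite !size_cat !size_nseq a1 b1 e1; lia.
  - rewrite !big_cat /= !big_nseq /=.
    have iterE (u : pt3) n : iter n (+%R u) 0 = u *+ n.
      by elim: n => [|n IHn] //=; rewrite IHn mulrS.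
    rewrite !iterE; case: cE => E1 E2 E3.
    have [Ax Ay Ad] := pt3_natmul a `|x|; have [Bx By Bd] := pt3_natmul b `|y|.
    have [Ex Ey Ed] := pt3_natmul e `|z|.
    have [S1 S2 S3] := pt3_lin (a *+ `|x|) (b *+ `|y| + e *+ `|z|).
    have [T1 T2 T3] := pt3_lin (b *+ `|y|) (e *+ `|z|).
    by apply: pt3_ext; rewrite ?S1 ?S2 ?S3 ?T1 ?T2 ?T3 ?Ax ?Ay ?Ad ?Bx ?By ?Bd ?Ex ?Ey ?Ed
      ?E1 ?E2 ?E3 ?gez0_abs // addrA.
  - move=> u; rewrite !mem_cat !mem_nseq.
    by case/or3P => /andP[_ /eqP ->]; split=> // p p'.
have [q [q1 /andP[al0 alD] /andP[be0 beD] /andP[ga0 gaD]]] :=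
  lattice_point_in_triangle a1 b1 e1 D1.
have dE : det3 a b e * 1 = det3 q b e + det3 a q e + det3 a b q.
  by rewrite -q1; exact: det3_cramer_degree.
rewrite mulr1 in dE.
have [|[h1 h2 h3]|[h1 h2 h3]|[h1 h2 h3]] := min_ratio c1 c2 c3 al0 be0 ga0.
- by lia.
- by apply: (subcase a b e q) => //; rewrite h1.
- apply: decomposable_rot; apply: decomposable_rot.
  have R p : det3 b e p = det3 p b e by rewrite (det3_rot b e p).
  have R1 p : det3 p e a = det3 a p e by rewrite (det3_rot p e a).
  have R2 p : det3 b p a = det3 a b p by rewrite (det3_rot b p a).
  apply: (subcase b e a q) => //; rewrite ?R ?R1 ?R2 // ?h1 //.
- apply: decomposable_rot.
  have R p : det3 e a p = det3 a p e by rewrite (det3_rot a p e).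
  have R1 p : det3 p a b = det3 a b p by rewrite (det3_rot a b p).
  have R2 p : det3 e p b = det3 p b e by rewrite (det3_rot p b e).
  by apply: (subcase e a b q) => //; rewrite ?R ?R1 ?R2 // ?h1.
Qed.

End UnimodularDecomposition.

(** * Lattice points as monomials in three variables *)

Section MonomialPoints.
Variable B : nat.

(* The point (x, y, d) is encoded by the exponents (x + B d, y + B d, d), with B
   so large that they are nonnegative. *)
Definition monomial_point (m : multinom 3) : pt3 :=
  ((m o0)%:Z - B%:Z * (m o2)%:Z, (m o1)%:Z - B%:Z * (m o2)%:Z, (m o2)%:Z).

Definition point_monomial (p : pt3) : multinom 3 :=
  Multinom [tuple absz (p.1.1 + B%:Z * p.2); absz (p.1.2 + B%:Z * p.2); absz p.2].

Definition fits (p : pt3) :=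
  [/\ 0 <= p.1.1 + B%:Z * p.2, 0 <= p.1.2 + B%:Z * p.2 & 0 <= p.2].

Lemma multinom3P (m m' : multinom 3) : m o0 = m' o0 -> m o1 = m' o1 ->
  m o2 = m' o2 -> m = m'.
Proof.
move=> h0 h1 h2; apply/mnmP => -[[|[|[|//]]] i].
- by rewrite (_ : Ordinal i = o0) //; exact: val_inj.
- by rewrite (_ : Ordinal i = o1) //; exact: val_inj.
- by rewrite (_ : Ordinal i = o2) //; exact: val_inj.
Qed.

Lemma point_monomialE p : [/\ point_monomial p o0 = absz (p.1.1 + B%:Z * p.2),
  point_monomial p o1 = absz (p.1.2 + B%:Z * p.2) & point_monomial p o2 = absz p.2].
Proof. by []. Qed.

Lemma point_monomialK p : fits p -> monomial_point (point_monomial p) = p.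
Proof.
case: p => [[x y] d] [] /= h0 h1 h2; rewrite /monomial_point.
have [-> -> ->] := point_monomialE (x, y, d).
by rewrite /= !gez0_abs // !addrK.
Qed.

Lemma monomial_point_inj : injective monomial_point.
Proof.
move=> m m' [h0 h1 h2]; apply: multinom3P => //; move: h0 h1; rewrite h2; lia.
Qed.

Lemma monomial_pointD m m' :
  monomial_point (mnm_add m m') = monomial_point m + monomial_point m'.
Proof.
have [E1 E2 E3] := pt3_lin (monomial_point m) (monomial_point m').
by apply: pt3_ext; rewrite ?E1 ?E2 ?E3 /= !mnmDE; lia.
Qed.

Lemma fitsD p q : fits p -> fits q -> fits (p + q).
Proof.
move=> [a1 a2 a3] [b1 b2 b3]; have [E1 E2 E3] := pt3_lin p q.
by rewrite /fits E1 E2 E3; split; lia.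
Qed.

(** Fitting is the nonnegativity of three linear forms, each of which is some [det3 p p']. *)
Lemma in_cone_of_fits a b e c : in_cone_of a b e c ->
  fits a -> fits b -> fits e -> fits c.
Proof.
move=> h [a1 a2 a3] [b1 b2 b3] [e1 e2 e3].
have E1 p : det3 (0, 1, 0) (- B%:Z, 0, 1) p = p.1.1 + B%:Z * p.2.
  by rewrite /det3 /=; ring.
have E2 p : det3 (1, 0, 0) (0, B%:Z, -1) p = p.1.2 + B%:Z * p.2.
  by rewrite /det3 /=; ring.
have E3 p : det3 (1, 0, 0) (0, 1, 0) p = p.2 by rewrite /det3 /=; ring.
by split; [rewrite -E1|rewrite -E2|rewrite -E3]; apply: h; rewrite ?E1 ?E2 ?E3.
Qed.

End MonomialPoints.

Section FanMonomials.
Variables (v : pt3) (w : nat -> pt3) (r B : nat).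
Hypotheses (vwr_fan : fan v w r) (v_fits : fits B v)
  (w_fits : forall i, (i <= r)%N -> fits B (w i)).
Local Notation cone := (cone v w r).
Local Notation sector := (sector v w r).
Local Notation in_sector := (in_sector v w).
Local Notation pt := (monomial_point B).
Let r_gt0 := fan_size vwr_fan.
Let w_deg := fan_degree vwr_fan.
Let ray_gt0 := fan_ray vwr_fan.
Local Notation mono := (point_monomial B).

Lemma ray_le i j : (i <= j)%N -> (j <= r)%N -> 0 <= ray v w i (w j).
Proof.
rewrite leq_eqVlt => /orP[/eqP -> _|ij jr]; first by rewrite ray_self.
by apply/ltW/ray_gt0; rewrite ij.
Qed.

Lemma ray_ge i j : (i <= j)%N -> (j <= r)%N -> ray v w j (w i) <= 0.
Proof.
move=> ij jr; have := ray_le ij jr.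
by rewrite /ray det3_swap oppr_ge0.
Qed.

Lemma cone_v : cone v.
Proof.
apply/coneP; split; rewrite ?ray_v // => i ir; rewrite far_v; exact: ltW (D_gt0 vwr_fan ir).
Qed.

Lemma cone_w i : (i <= r)%N -> cone (w i).
Proof.
move=> ir; apply/coneP; split; [exact: ray_le|exact: ray_ge|move=> j jr].
exact: (fan_far vwr_fan).
Qed.

Lemma in_cone_of_cone a b e c : in_cone_of a b e c -> cone a -> cone b -> cone e ->
  cone c.
Proof.
move=> h /coneP[a1 a2 a3] /coneP[b1 b2 b3] /coneP[e1 e2 e3]; apply/coneP; split.
- exact: h.
- rewrite -oppr_ge0 /ray -det3_swap det3_rot -det3_rot.
  have E p : det3 (w r) v p = - ray v w r p by rewrite /ray /det3; ring.
  have -> : det3 v c (w r) = det3 (w r) v c by rewrite det3_rot.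
  by apply: h; rewrite E oppr_ge0.
- move=> i ir; rewrite farE; apply: h; rewrite -farE; [exact: a3|exact: b3|exact: e3].
Qed.

Lemma cone_decomposition c : cone c -> exists s : seq pt3,
  [/\ (size s)%:Z = c.2, c = \sum_(x <- s) x &
      forall x, x \in s -> [/\ x.2 = 1, cone x & fits B x]].
Proof.
move=> cc; have [ir hi] := cone_sector vwr_fan cc; set i := sector c in ir hi.
have ri := in_sector_ray_ge0 hi; have /and3P[fi ri1 _] := hi.
have ir' := ltnW ir.
have [|||||||s [s1 s2 s3]] := @triangle_decomposition v (w i) (w i.+1) c.
- exact: (fan_apex_degree vwr_fan).
- exact: w_deg.
- exact: w_deg.
- exact: (D_gt0 vwr_fan ir).
- exact: fi.
- by rewrite det3_swap oppr_ge0.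
- exact: ri.
exists s; split=> // x /s3[x1 xc]; split=> //.
  by apply: in_cone_of_cone xc _ _ _; [exact: cone_v|exact: cone_w|exact: cone_w].
by apply: in_cone_of_fits xc _ _ _ => //; exact: w_fits.
Qed.

(** The offset B, chosen for the corners, works at every height because fitting is additive. *)
Lemma cone_fits c : cone c -> fits B c.
Proof.
move=> /cone_decomposition[s [_ -> hs]]; rewrite big_seq.
elim/big_rec: _ => [|x y /hs[_ _ fx] fy]; last exact: fitsD.
by split; rewrite /= ?mulr0.
Qed.

Definition cone_monomial m := cone (pt m).
Definition monomial_key m := key v w r (pt m).
Definition monomial_height (m : multinom 3) : nat := m o2.
Definition color_monomials s := [seq mono p | p <- color_class v w r s].
Definition lead_monomial s m := mono (lead v w s (sector (pt m))).

Lemma color_class_cone s p : p \in color_class v w r s ->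
  [/\ cone p, fits B p & p.2 = 1].
Proof.
rewrite /color_class; case: ifP => _.
  by rewrite inE => /eqP ->; split=> //; [exact: cone_v|exact: (fan_apex_degree vwr_fan)].
case/mapP => j; rewrite mem_filter mem_iota add0n ltnS => /and3P[_ _ jr] ->.
by split; [exact: cone_w|exact: w_fits|exact: w_deg].
Qed.

Lemma w_inj i j : (i <= r)%N -> (j <= r)%N -> w i = w j -> i = j.
Proof.
move=> ir jr wij; case: (ltngtP i j) => // ij.
  by have := @ray_gt0 i j; rewrite ij jr -wij ray_self ltxx => /(_ isT).
by have := @ray_gt0 j i; rewrite ij ir wij ray_self ltxx => /(_ isT).
Qed.

Lemma color_class_uniq s : uniq (color_class v w r s).
Proof.
rewrite /color_class; case: ifP => _ //.
rewrite map_inj_in_uniq ?filter_uniq ?iota_uniq // => i j.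
rewrite !mem_filter !mem_iota !add0n !ltnS => /and3P[_ _ ir] /and3P[_ _ jr].
exact: w_inj.
Qed.

Lemma color_monomials_uniq s : uniq (color_monomials s).
Proof.
rewrite map_inj_in_uniq ?color_class_uniq // => p q.
move=> /color_class_cone[_ pf _] /color_class_cone[_ qf _] E.
by rewrite -(point_monomialK pf) E point_monomialK.
Qed.

Lemma lead_color s m : cone_monomial m ->
  lead v w s (sector (pt m)) \in color_class v w r s.
Proof. by move=> cm; apply: lead_in_color; have [] := cone_sector vwr_fan cm. Qed.

Lemma pt_step s m : cone_monomial m ->
  pt (step lead_monomial s m) = pt m + lead v w s (sector (pt m)).
Proof.
move=> cm; have [_ lf _] := color_class_cone (lead_color s cm).
by rewrite monomial_pointD point_monomialK.
Qed.

Lemma lead_monomial_mem s m : cone_monomial m ->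
  lead_monomial s m \in color_monomials s.
Proof. by move=> cm; apply: map_f; exact: lead_color. Qed.

Lemma cone_monomial_step s m x : cone_monomial m -> x \in color_monomials s ->
  cone_monomial (mnm_add m x).
Proof.
move=> cm /mapP[p /color_class_cone[pc pf _] ->].
by rewrite /cone_monomial monomial_pointD point_monomialK //; exact: (coneD vwr_fan).
Qed.

Lemma height_step s m x : x \in color_monomials s ->
  monomial_height (mnm_add m x) = (monomial_height m).+1.
Proof.
move=> /mapP[p /color_class_cone[_ _ p1] ->].
have [_ _ E] := point_monomialE B p.
by rewrite /monomial_height mnmDE E p1 addn1.
Qed.

Lemma monomial_key_bound m : cone_monomial m ->
  (monomial_key m <= absz ((\prod_(j < r) ray v w j (w j.+1)) *
     (monomial_height m)%:Z)%R * r + r)%N.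
Proof. exact: (key_bound vwr_fan). Qed.

Lemma monomial_key_lead s m x : cone_monomial m -> x \in color_monomials s ->
  x != lead_monomial s m ->
  (monomial_key (step lead_monomial s m) < monomial_key (mnm_add m x))%N.
Proof.
move=> cm xs; have := cone_monomial_step cm xs; move: xs => /mapP[p pW ->] cx ne.
have [pc pf _] := color_class_cone pW.
rewrite /monomial_key pt_step // monomial_pointD point_monomialK //.
apply: (color_class_key vwr_fan) => //; last by rewrite -[p in cone (_ + p)](point_monomialK pf) -monomial_pointD.
by apply: contraNneq ne => ->.
Qed.

Lemma sector_step s m : cone_monomial m ->
  sector (pt (step lead_monomial s m)) = sector (pt m).
Proof.
by move=> cm; rewrite pt_step //; apply: (proj2 (sector_add_lead vwr_fan _ _)).
Qed.

Lemma step_monomial_inj s m m' : cone_monomial m -> cone_monomial m' ->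
  step lead_monomial s m = step lead_monomial s m' -> m = m'.
Proof.
move=> cm cm' E; have := sector_step s cm; rewrite E sector_step // => sE.
apply: (monomial_point_inj (B := B)); have := congr1 pt E.
by rewrite !pt_step // sE => /addIr.
Qed.

Lemma sector_sub_lead s s' m m' : s != s' ->
  cone_monomial m -> cone_monomial m' ->
  step lead_monomial s m = step lead_monomial s' m' ->
  exists2 m'', cone_monomial m'' & m = step lead_monomial s' m''.
Proof.
move=> ss' cm cm' E; have [ir hi] := cone_sector vwr_fan cm.
have [_ hi'] := cone_sector vwr_fan cm'.
have sE : sector (pt m') = sector (pt m).
  by rewrite -(sector_step s' cm') -E sector_step.
rewrite sE in hi'; have := congr1 pt E; rewrite !pt_step // sE => E'.
have := in_sector_sub_lead vwr_fan ir ss' hi hi' E'.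
set p := _ - _ => hp; have [pc ps] := in_sector_cone vwr_fan ir hp.
exists (mono p); first by rewrite /cone_monomial point_monomialK //; exact: cone_fits.
apply: (monomial_point_inj (B := B)); rewrite pt_step.
  by rewrite point_monomialK ?ps ?subrK //; exact: cone_fits.
by rewrite /cone_monomial point_monomialK //; exact: cone_fits.
Qed.

Lemma step_top m : cone_monomial m -> (3 <= monomial_height m)%N ->
  exists s, exists2 m', cone_monomial m' & step lead_monomial s m' = m.
Proof.
move=> cm m3; have [ir hi] := cone_sector vwr_fan cm.
have [s hs] := in_sector_top vwr_fan ir hi m3.
have [pc ps] := in_sector_cone vwr_fan ir hs.
exists s, (mono (pt m - lead v w s (sector (pt m)))).
  by rewrite /cone_monomial point_monomialK //; exact: cone_fits.
apply: (monomial_point_inj (B := B)); rewrite pt_step.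
  by rewrite point_monomialK ?ps ?subrK //; exact: cone_fits.
by rewrite /cone_monomial point_monomialK //; exact: cone_fits.
Qed.

Lemma step_swap s s' m : cone_monomial m ->
  step lead_monomial s (step lead_monomial s' m) =
  step lead_monomial s' (step lead_monomial s m).
Proof.
move=> cm; have cs t : cone_monomial (step lead_monomial t m).
  by apply: (cone_monomial_step cm); exact: lead_monomial_mem.
apply: (monomial_point_inj (B := B)).
by rewrite (pt_step s (cs s')) (pt_step s' (cs s)) !sector_step // !pt_step // addrAC.
Qed.

Lemma fan_leading_terms : leading_terms cone_monomial monomial_key monomial_height
  (fun h => absz ((\prod_(j < r) ray v w j (w j.+1)) * h%:Z)%R * r + r)%N
  color_monomials lead_monomial.
Proof.
split.
- exact: color_monomials_uniq.
- exact: lead_monomial_mem.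
- exact: cone_monomial_step.
- exact: height_step.
- exact: monomial_key_bound.
- exact: monomial_key_lead.
- exact: step_monomial_inj.
- exact: sector_sub_lead.
- exact: step_swap.
Qed.

End FanMonomials.

(** * Elimination of variables by linear forms *)

Section Elimination.
Variables (k : fieldType) (n : nat).
Local Notation S := (mpoly n k).
Local Notation "''X' i" := (mpolyX k (mnm1 i) : S) (at level 8, i at level 2, format "''X' i").
Implicit Types (J : S -> Prop) (f g : S) (P Q : pred 'I_n).

Definition subst (h : 'I_n -> S) : S -> S := mmap (mpolyC n (R := k)) h.

HB.instance Definition _ h := GRing.RMorphism.on (subst h).

Lemma substE h f : subst h f = \sum_(m <- msupp f) mpolyC n (mcoeff m f) * mmap1 h m.
Proof. by []. Qed.

Lemma substC h c : subst h (mpolyC n c) = mpolyC n c.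
Proof. exact: mmapC. Qed.

Lemma substX h i : subst h 'X i = h i.
Proof. by rewrite /subst mmapX mmap1U. Qed.

Lemma subst_comp h h' f : subst h' (subst h f) = subst (fun i => subst h' (h i)) f.
Proof.
rewrite [subst h f]substE [RHS]substE raddf_sum; apply: eq_bigr => m _ /=.
rewrite rmorphM /= substC; congr (_ * _).
by rewrite /mmap1 rmorph_prod; apply: eq_bigr => i _; rewrite rmorphXn.
Qed.

Lemma subst_id f : subst (fun i => 'X i) f = f.
Proof.
rewrite substE [RHS]mpolyE; apply: eq_bigr => m _.
by rewrite mul_mpolyC mmap1_id.
Qed.

Lemma subst_congr J h : graded_ideal J -> (forall i, J ('X i - h i)) ->
  forall f, J (f - subst h f).
Proof.
move=> hJ hX f.
have JM a b a' b' : J (a - b) -> J (a' - b') -> J (a * a' - b * b').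
  move=> h1 h2; have -> : a * a' - b * b' = a' * (a - b) + b * (a' - b') by ring.
  by apply: hipD => //; exact: hipM.
have Jexp a b m : J (a - b) -> J (a ^+ m - b ^+ m).
  move=> h1; elim: m => [|m IH]; first by rewrite !expr0 subrr; exact: hip0.
  by rewrite !exprS; exact: JM.
rewrite -{1}(subst_id f) !substE -sumrB; apply: hip_sum => // m _.
rewrite -mulrBr; apply: hipM => //.
rewrite /mmap1; apply: (big_rec2 (fun a b => J (a - b))) => [|i a b _ hab].
  by rewrite subrr; exact: hip0.
by apply: JM => //; exact: Jexp.
Qed.

(* Modulo [J] the variables in [P] are expressed through the other ones, which
   remain algebraically independent. *)
Definition elimination P J := graded_ideal J /\
  exists h, [/\ forall i, ~~ P i -> h i = 'X i,
    forall f, J f -> subst h f = 0 & forall i, J ('X i - h i)].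

Definition linear_form Q : S := \sum_(i | Q i) 'X i.

Lemma linear_form_homog Q : homog_of_degree 1 (linear_form Q).
Proof.
by apply: homog_sum => i _; have := @homogX k _ (mnm1 i); rewrite mdeg1.
Qed.

Lemma linear_form_neq0 Q p : Q p -> linear_form Q != 0.
Proof.
move=> Qp; apply/eqP => /(congr1 (mcoeff (mnm1 p))).
rewrite mcoeff0 /linear_form raddf_sum /= (bigD1 p) //= mcoeffXU eqxx.
rewrite big1 ?addr0 => [/eqP|i /andP[_ /negPf ip]]; first by rewrite oner_eq0.
by rewrite mcoeffXU ip.
Qed.

Lemma zero_ideal : graded_ideal (fun f : S => f = 0).
Proof.
split=> //; first by move=> f g -> ->; rewrite addr0.
- by move=> f g ->; rewrite mulr0.
- by move=> e f ->; rewrite raddf0.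
Qed.

Lemma elimination0 : elimination pred0 (fun f => f = 0).
Proof.
split; first exact: zero_ideal.
exists (fun i => 'X i); split=> // [f ->|i]; first by rewrite raddf0.
by rewrite subrr.
Qed.

(** The substitution identifies S/J with the polynomial ring in the remaining variables, a domain in
    which the form is nonzero. *)
Lemma elimination_nonzerodivisor P J Q p : elimination P J ->
  (forall i, Q i -> ~~ P i) -> Q p -> nonzerodivisor_mod J (linear_form Q).
Proof.
move=> [hJ [h [hP hJ0 hX]]] QP Qp f /hJ0.
have -> : subst h (linear_form Q * f) = linear_form Q * subst h f.
  rewrite rmorphM; congr (_ * _); rewrite /linear_form raddf_sum.
  by apply: eq_bigr => i /QP Pi; rewrite /= substX hP.
move/eqP; rewrite mulf_eq0 (negPf (linear_form_neq0 Qp)) /= => /eqP f0.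
by have := subst_congr hJ hX f; rewrite f0 subr0.
Qed.

Lemma elimination_step P J Q p : elimination P J ->
  (forall i, Q i -> ~~ P i) -> Q p ->
  elimination [predU1 p & P] (add_gen J (linear_form Q)).
Proof.
move=> [hJ [h [hP hJ0 hX]]] QP Qp.
have hl := @linear_form_homog Q; have hJl := add_gen_ideal hJ hl.
split=> //.
(* The form is solved for X_p: this substitution sends X_p to minus the other terms, hence the form
   to 0. *)
pose s i := if i == p then 'X p - linear_form Q else 'X i.
exists (fun i => subst s (h i)); split.
- move=> i; rewrite !inE negb_or => /andP[ip Pi].
  by rewrite hP // substX /s (negPf ip).
- move=> f [g /hJ0 Jg _]; rewrite -subst_comp -(subrK (linear_form Q * g) f).
  rewrite raddfD /= Jg add0r !rmorphM /=.
  have -> : subst h (linear_form Q) = linear_form Q.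
    by rewrite /linear_form raddf_sum; apply: eq_bigr => i /QP Pi; rewrite /= substX hP.
  suff -> : subst s (linear_form Q) = 0 by rewrite mul0r.
  rewrite {1}/linear_form raddf_sum /= (bigD1 p) //= substX /s eqxx.
  rewrite (eq_bigr (fun i => 'X i)) => [|i /andP[_ ip]]; last first.
    by rewrite substX (negPf ip).
  by rewrite {1}/linear_form (bigD1 p) //= opprD addrA subrr sub0r addNr.
- move=> i; have -> : 'X i - subst s (h i) = ('X i - h i) + (h i - subst s (h i)).
    by rewrite addrA subrK.
  apply: hipD => //; first exact: add_genW.
  apply: subst_congr => // j; rewrite /s; case: eqP => [->|_].
    rewrite opprB addrC subrK.
    by have := @add_gen_self _ _ J (linear_form Q) 1 hJ; rewrite mulr1.
  by rewrite subrr; exact: hip0.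
Qed.

End Elimination.

(** * The toric ideal as the kernel of a monomial map *)

Record toric_points N (v : pt3) (w : nat -> pt3) (r B : nat) (a : 'I_N -> pt3) : Prop := {
  tp_fan : fan v w r;
  tp_apex_fits : fits B v;
  tp_fits : forall i, (i <= r)%N -> fits B (w i);
  tp_inj : injective a;
  tp_cone : forall i, cone v w r (a i);
  tp_degree : forall i, (a i).2 = 1;
  tp_surj : forall p, cone v w r p -> p.2 = 1 -> exists i, a i = p }.

Section ToricMap.
Variables (k : fieldType) (N : nat) (v : pt3) (w : nat -> pt3) (r B : nat).
Variable a : 'I_N -> pt3.
Hypothesis toric_a : toric_points v w r B a.
Let vwr_fan := tp_fan toric_a.
Let v_fits := tp_apex_fits toric_a.
Let w_fits := tp_fits toric_a.
Let a_inj := tp_inj toric_a.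
Let a_cone := tp_cone toric_a.
Let a_deg := tp_degree toric_a.
Let a_surj := tp_surj toric_a.
Local Notation S := (mpoly N k).
Local Notation T := (mpoly 3 k).
Local Notation pt := (monomial_point B).
Local Notation mono := (point_monomial B).
Local Notation C := (cone_monomial v w r B).
Local Notation Wm := (color_monomials v w r B).
Local Notation ht := monomial_height.
Local Notation thetaT s := (theta k Wm s).

(** The monomials of the cone span the image, so S modulo the kernel is M, realized inside a
    polynomial ring in three variables. *)
Definition toric_map : S -> T := mmap (mpolyC 3 (R := k)) (fun i => mpolyX k (mono (a i))).

HB.instance Definition _ := GRing.RMorphism.on toric_map.

Definition weight (m : multinom N) : multinom 3 :=
  \big[@mnm_add 3/@mnm0 3]_i mnm_muln (mono (a i)) (m i).

Lemma toric_mapX m : toric_map (mpolyX k m) = mpolyX k (weight m).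
Proof. by rewrite /toric_map mmapX /mmap1 mprodXnE. Qed.

Lemma toric_mapC c f : toric_map (mpolyC N c * f) = c *: toric_map f.
Proof. by rewrite /toric_map rmorphM /= mmapC mul_mpolyC. Qed.

Lemma toric_mapZ c f : toric_map (c *: f) = c *: toric_map f.
Proof. by rewrite -mul_mpolyC toric_mapC. Qed.

Lemma toric_mapE f :
  toric_map f = \sum_(m <- msupp f) mcoeff m f *: mpolyX k (weight m).
Proof.
rewrite {1}(mpolyE f) raddf_sum; apply: eq_bigr => m _.
by rewrite /= toric_mapZ toric_mapX.
Qed.

Lemma a_fits i : fits B (a i).
Proof. exact: (cone_fits vwr_fan). Qed.

Lemma weightE m j : weight m j = (\sum_i mono (a i) j * m i)%N.
Proof. by rewrite mnm_sumE; apply: eq_bigr => i _; rewrite mulmnE. Qed.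

Lemma weightD m m' : weight (mnm_add m m') = mnm_add (weight m) (weight m').
Proof.
apply/mnmP => j; rewrite mnmDE !weightE -big_split /=; apply: eq_bigr => i _.
by rewrite mnmDE mulnDr.
Qed.

Lemma weight1 i : weight (mnm1 i) = mono (a i).
Proof.
apply/mnmP => j; rewrite weightE (bigD1 i) //= mnm1E eqxx muln1 big1 ?addn0 // => i' ne.
by rewrite mnm1E eq_sym (negPf ne) muln0.
Qed.

Lemma weight_height m : ht (weight m) = mdeg m.
Proof.
rewrite /monomial_height weightE mdegE; apply: eq_bigr => i _.
by have [_ _ ->] := point_monomialE B (a i); rewrite a_deg mul1n.
Qed.

Lemma weight0 : weight (@mnm0 N) = @mnm0 3.
Proof.
by apply/mnmP => j; rewrite weightE mnm0E big1 // => i _; rewrite mnm0E muln0.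
Qed.

Lemma mnm_rec (P : multinom N -> Prop) : P (@mnm0 N) ->
  (forall i m, P m -> P (mnm_add (mnm1 i) m)) -> forall m, P m.
Proof.
move=> P0 PS m; have [d] := ubnP (mdeg m); elim: d m => // d IH m md.
have [->//|m0] := eqVneq m (@mnm0 N).
have [/existsP[i mi]|/existsPn h] := boolP [exists i, m i != 0%N]; last first.
  by case/eqP: m0; apply/mnmP => i; rewrite mnm0E; apply/eqP; have := h i; rewrite negbK.
have le : mnm_add (mnm1 i) (mnm_sub m (mnm1 i)) = m.
  by rewrite addmC submK // lep1mP.
rewrite -le; apply: PS; apply: IH.
by move: md; rewrite -{1}le mdegD mdeg1; lia.
Qed.

Lemma weight_cone m : C (weight m).
Proof.
elim/mnm_rec: m => [|i m IH].
  rewrite weight0 /cone_monomial (_ : pt (@mnm0 3) = 0); last first.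
    by rewrite /monomial_point !mnm0E mulr0 subr0.
  by apply/coneP; split; rewrite /ray /far /det3 /=; lia.
rewrite weightD weight1 /cone_monomial monomial_pointD point_monomialK; last exact: a_fits.
exact: (coneD vwr_fan).
Qed.

(** Normality enters here: the summands of a point of the cone are points of the polygon, that is,
    images of variables. *)
Lemma weight_surj c : C c -> exists m, weight m = c.
Proof.
move=> /(cone_decomposition vwr_fan v_fits w_fits)[s [_ E hs]].
have [m mE] : exists m, pt (weight m) = \sum_(x <- s) x.
  elim: s {E} hs => [|x s IH] hs.
    by exists (@mnm0 N); rewrite weight0 big_nil /monomial_point !mnm0E mulr0 subr0.
  have [m mE] : exists m, pt (weight m) = \sum_(x <- s) x.
    by apply: IH => y ys; apply: hs; rewrite in_cons ys orbT.
  have [x1 xc _] := hs x (mem_head _ _); have [i ix] := a_surj xc x1.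
  exists (mnm_add (mnm1 i) m); rewrite weightD weight1 monomial_pointD mE big_cons.
  by rewrite point_monomialK ?ix //; rewrite -ix; exact: a_fits.
by exists m; apply: (monomial_point_inj (B := B)); rewrite mE -E.
Qed.

Lemma mcoeff_toric_map f c : mcoeff c (toric_map f) =
  \sum_(m <- msupp f) mcoeff m f * (weight m == c)%:R.
Proof.
rewrite toric_mapE raddf_sum; apply: eq_bigr => m _.
by rewrite /= mcoeffZ mcoeffX.
Qed.

Lemma toric_map_supported f : supported C (toric_map f).
Proof.
rewrite toric_mapE; apply: supported_sum => m _.
by apply: supportedZ; apply: supportedX; exact: weight_cone.
Qed.

Lemma toric_map_homog e f : homog_of_degree e f ->
  supported (fun c => C c && ((ht c)%:Z == e)) (toric_map f).
Proof.
move=> hf; rewrite toric_mapE big_seq; apply: supported_sum => m mf.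
by apply: supportedZ; apply: supportedX; rewrite weight_cone weight_height hf /=.
Qed.

Lemma toric_map_surj (g : T) : supported C g -> exists f, toric_map f = g /\
  forall e, (forall c, mcoeff c g != 0 -> (ht c)%:Z = e) -> homog_of_degree e f.
Proof.
move=> gC; have /choice[m hm] : forall c, exists m, C c -> weight m = c.
  move=> c; have [Cc|nC] := boolP (C c); last by exists (@mnm0 N).
  by have [m <-] := weight_surj Cc; exists m.
exists (\sum_(c <- msupp g) mcoeff c g *: mpolyX k (m c)); split.
  rewrite [RHS]mpolyE raddf_sum big_seq [RHS]big_seq; apply: eq_bigr => c cg.
  rewrite /= toric_mapZ toric_mapX hm //.
  by apply: gC; rewrite -mcoeff_msupp.
move=> e he; rewrite big_seq; apply: homog_sum => c; rewrite mcoeff_msupp => cg.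
apply: homogZ; have := @homogX k _ (m c).
by rewrite -weight_height hm ?he //; exact: gC.
Qed.

Lemma mcoeff_toric_hproj e f c : mcoeff c (toric_map (hproj e f)) =
  if (ht c)%:Z == e then mcoeff c (toric_map f) else 0.
Proof.
case: eqP => [ce|/eqP ne]; last first.
  apply/eqP; apply: contraNT ne => /(toric_map_homog (@hproj_homog _ _ e f)).
  by case/andP.
rewrite -[f in RHS](subrK (hproj e f)) raddfD mcoeffD /=.
rewrite [X in _ = X + _]mcoeff_toric_map.
rewrite [X in _ = X + _]big1_seq ?add0r // => m /andP[_]; rewrite mcoeff_msupp mcoeffB mcoeff_hproj.
case: (weight m =P c) => [wE|_]; last by rewrite mulr0.
by rewrite -weight_height wE ce eqxx subrr eqxx.
Qed.

Definition toric_kernel f := toric_map f = 0.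

Lemma toric_kernel_ideal : graded_ideal toric_kernel.
Proof.
rewrite /toric_kernel; split.
- exact: raddf0.
- by move=> f g f0 g0; rewrite raddfD /= f0 g0 addr0.
- by move=> f g g0; rewrite rmorphM /= g0 mulr0.
- move=> e f f0; apply/mpolyP => c.
  by rewrite mcoeff_toric_hproj f0 mcoeff0 if_same.
Qed.

(** In degree at most 1 distinct monomials have distinct weights, because the points a_i are
    distinct, so nothing cancels in the image. *)
Lemma toric_kernel_low e f : homog_of_degree e f -> e <= 1 -> toric_kernel f -> f = 0.
Proof.
move=> hf e1 f0; apply/mpolyP => m; rewrite mcoeff0; apply/eqP/negPn/negP => mf.
have md : (mdeg m)%:Z = e by apply: hf; rewrite mcoeff_msupp.
have := congr1 (mcoeff (weight m)) f0; rewrite mcoeff_toric_map mcoeff0.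
rewrite (bigD1_seq m) ?msupp_uniq ?mcoeff_msupp //= eqxx mulr1 big1_seq ?addr0 => [/eqP|m'].
  by rewrite (negPf mf).
move=> /andP[ne m'f]; case: eqP => [wE|_]; last by rewrite mulr0.
have m'd : (mdeg m')%:Z = e by exact: hf.
have [d0|d1] : mdeg m = 0%N \/ mdeg m = 1%N by lia.
  have /eqP := d0; rewrite mdeg_eq0 => /eqP mE.
  have : mdeg m' == 0%N by lia.
  by rewrite mdeg_eq0 => /eqP m'E; rewrite m'E mE eqxx in ne.
have /mdeg1P[i /eqP mE] : mdeg m == 1%N by rewrite d1.
have /mdeg1P[j /eqP m'E] : mdeg m' == 1%N by lia.
move: wE; rewrite mE m'E !weight1 => /(congr1 pt).
rewrite !point_monomialK; [|exact: a_fits|exact: a_fits] => /a_inj ij.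
by rewrite mE m'E ij eqxx in ne.
Qed.

Definition color s : pred 'I_N := fun i => a i \in color_class v w r s.

Lemma toric_map_color s : toric_map (linear_form k (color s)) = thetaT s.
Proof.
rewrite /linear_form raddf_sum /theta /color_monomials big_map /=.
rewrite (eq_bigr (fun i => mpolyX k (mono (a i)))) => [|i _]; last first.
  by rewrite toric_mapX weight1.
rewrite -(big_map a (fun p => p \in color_class v w r s) (fun p => mpolyX k (mono p))).
rewrite -big_filter; apply: perm_big; apply: uniq_perm.
- by rewrite filter_uniq // map_inj_uniq // index_enum_uniq.
- exact: (color_class_uniq vwr_fan).
- move=> p; rewrite mem_filter; case pW : (p \in color_class v w r s) => //=.
  have [pc _ p1] := color_class_cone vwr_fan v_fits w_fits pW.
  have [i <-] := a_surj pc p1.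
  by apply: map_f; rewrite mem_index_enum.
Qed.

Local Notation Th s := (linear_form k (color s)).
Local Notation J0 := (fun f : S => f = 0).
Local Notation J1 := (add_gen J0 (Th o0)).
Local Notation J2 := (add_gen J1 (Th o1)).
Local Notation J3 := (add_gen J2 (Th o2)).

(** Membership in the kernel plus [J1] becomes a statement inside M, where regularity of the thetas
    is known. *)
Lemma toric_sum1 f : ideal_sum toric_kernel J1 f <->
  exists g, toric_map f = thetaT o0 * toric_map g.
Proof.
split=> [[j [g /eqP]]|[g E]].
  rewrite subr_eq0 => /eqP -> _ fj; exists g.
  rewrite -toric_map_color -rmorphM /=; apply/eqP; rewrite -subr_eq0 -raddfB.
  exact/eqP.
exists (Th o0 * g); first by exists g; rewrite ?subrr.
by rewrite /toric_kernel raddfB /= rmorphM /= toric_map_color E subrr.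
Qed.

Lemma toric_sum2 f : ideal_sum toric_kernel J2 f <->
  exists g g', toric_map f = thetaT o0 * toric_map g + thetaT o1 * toric_map g'.
Proof.
split=> [[j [g' [g /eqP]]]|[g [g' E]]].
  rewrite subr_eq0 => /eqP jE _ _ fj; exists g, g'.
  rewrite -!toric_map_color -!rmorphM -raddfD /=; apply/eqP.
  by rewrite -subr_eq0 -raddfB -jE subrK; exact/eqP.
exists (Th o0 * g + Th o1 * g').
  by exists g' => //; exists g; rewrite ?addrK ?subrr.
by rewrite /toric_kernel raddfB /= raddfD /= !rmorphM /= !toric_map_color E subrr.
Qed.

Lemma toric_sum3 f g g' g'' : toric_map f = thetaT o0 * toric_map g +
    thetaT o1 * toric_map g' + thetaT o2 * toric_map g'' ->
  ideal_sum toric_kernel J3 f.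
Proof.
move=> E; exists (Th o0 * g + Th o1 * g' + Th o2 * g'').
  by exists g'' => //; exists g' => //; exists g; rewrite ?addrK ?subrr.
by rewrite /toric_kernel raddfB /= !raddfD /= !rmorphM /= !toric_map_color E -!opprD subrr.
Qed.

Let leadH := fan_leading_terms vwr_fan v_fits w_fits.

Lemma toric_sum0 f : ideal_sum toric_kernel J0 f <-> toric_map f = 0.
Proof.
split=> [[_ -> ]|f0]; first by rewrite subr0.
by exists 0; rewrite // subr0.
Qed.

Lemma toric_nonzerodivisor0 :
  nonzerodivisor_mod (ideal_sum toric_kernel J0) (Th o0).
Proof.
move=> f /toric_sum0; rewrite rmorphM /= toric_map_color => E.
apply/toric_sum0; apply: (theta_regular0 leadH) E.
exact: toric_map_supported.
Qed.

Lemma toric_nonzerodivisor1 :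
  nonzerodivisor_mod (ideal_sum toric_kernel J1) (Th o1).
Proof.
move=> f /toric_sum1[g]; rewrite rmorphM /= toric_map_color => E.
have [b bC fE] := theta_regular1 leadH (@toric_map_supported f) (@toric_map_supported g) E.
by have [b' [bE _]] := toric_map_surj bC; apply/toric_sum1; exists b'; rewrite bE.
Qed.

Lemma toric_nonzerodivisor2 :
  nonzerodivisor_mod (ideal_sum toric_kernel J2) (Th o2).
Proof.
move=> f /toric_sum2[g [g']]; rewrite rmorphM /= toric_map_color => E.
have [b [b' [bC bC' fE]]] := theta_regular2 leadH (@toric_map_supported f)
  (@toric_map_supported g) (@toric_map_supported g') E.
have [c [cE _]] := toric_map_surj bC; have [c' [cE' _]] := toric_map_surj bC'.
by apply/toric_sum2; exists c, c'; rewrite cE cE'.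
Qed.

Lemma toric_top e f : homog_of_degree e f -> 2 < e -> ideal_sum toric_kernel J3 f.
Proof.
move=> /toric_map_homog hf e2.
have [h hC fE] := @theta_top _ _ _ _ _ _ _ _ leadH (fun d => d%:Z == e) _
  (fun c Cc ce => step_top vwr_fan v_fits w_fits Cc
    (ltac:(by move/eqP: ce; rewrite /monomial_height in e2 *; lia))) hf.
have [c0 [E0 _]] := toric_map_surj (hC o0).
have [c1 [E1 _]] := toric_map_surj (hC o1).
have [c2 [E2 _]] := toric_map_surj (hC o2).
by apply: (@toric_sum3 f c0 c1 c2); rewrite fE sum_ord3 /= E0 E1 E2.
Qed.

Lemma v_neq_w j : (j <= r)%N -> v <> w j.
Proof.
move=> jr vw; have [jr'|jr'] := ltnP j r.
  have := D_gt0 vwr_fan jr'; rewrite /ray -vw.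
  by have -> : det3 v v (w j.+1) = 0 by rewrite /det3; ring.
have r0 := fan_size vwr_fan; have rE : r.-1.+1 = j by lia.
have := @D_gt0 _ _ _ vwr_fan r.-1; rewrite prednK // leqnn => /(_ isT).
rewrite /ray (_ : r = j) -?vw; last by lia.
by have -> : det3 v (w j.-1) v = 0 by rewrite /det3; ring.
Qed.

Section Pivots.
Variables i0 i1 i2 : 'I_N.
Hypotheses (i0E : a i0 = v) (i1E : a i1 = w 0) (i2E : a i2 = w 1).

Lemma color0 i : color o0 i = (i == i0).
Proof.
rewrite /color /color_class /= inE -i0E.
by apply/eqP/eqP => [/a_inj|->].
Qed.

Lemma color_w (s : 'I_3) i : (0 < s)%N -> color s i ->
  exists j, [/\ (j <= r)%N, odd j = (s == 2 :> nat) & a i = w j].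
Proof.
move=> s0; rewrite /color /color_class (gtn_eqF s0) => /mapP[j].
by rewrite mem_filter mem_iota add0n ltnS => /and3P[/eqP oj _ jr] ->; exists j.
Qed.

Lemma color1_i1 : color o1 i1.
Proof.
by rewrite /color /color_class i1E; apply: map_f; rewrite mem_filter mem_iota.
Qed.

Lemma color2_i2 : color o2 i2.
Proof.
rewrite /color /color_class i2E; apply: map_f; rewrite mem_filter mem_iota /=.
exact: (fan_size vwr_fan).
Qed.

Lemma color1_P i : color o1 i -> ~~ [predU1 i0 & pred0] i.
Proof.
move=> /(@color_w o1)[//|j [jr _ aE]]; rewrite /= !inE ?orbF; apply/eqP => ii0.
by apply: (v_neq_w jr); rewrite -aE ii0 i0E.
Qed.

Lemma color2_P i : color o2 i -> ~~ [predU1 i1 & [predU1 i0 & pred0]] i.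
Proof.
move=> /(@color_w o2)[//|j [jr oj aE]]; rewrite /= !inE ?orbF; apply/norP; split.
  apply/eqP => ii1; have j0 : j = 0%N.
    by apply: (w_inj vwr_fan jr) => //; rewrite -aE ii1 i1E.
  by rewrite j0 in oj.
by apply/eqP => ii0; apply: (v_neq_w jr); rewrite -aE ii0 i0E.
Qed.

Local Notation P3 := [predU1 i2 & [predU1 i1 & [predU1 i0 & pred0]]].

Lemma elimination1 : elimination [predU1 i0 & pred0] J1.
Proof.
apply: elimination_step; [exact: elimination0|by []|].
by rewrite color0.
Qed.

Lemma elimination2 : elimination [predU1 i1 & [predU1 i0 & pred0]] J2.
Proof.
apply: elimination_step color1_i1; [exact: elimination1|exact: color1_P].
Qed.

Lemma elimination3 : elimination P3 J3.
Proof.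
apply: elimination_step color2_i2; [exact: elimination2|exact: color2_P].
Qed.

Variable F : free_seq k N.
Hypotheses (gradF : graded_maps F) (exF : exact_seq toric_kernel F).

Lemma exact_mod_J3 : exact_mod F J3.
Proof.
have hI := toric_kernel_ideal.
apply: (exact_mod_add_gen hI exF) toric_nonzerodivisor2 _.
- by case: elimination2.
- by apply: elimination_nonzerodivisor color2_i2; [exact: elimination2|exact: color2_P].
apply: (exact_mod_add_gen hI exF) toric_nonzerodivisor1 _.
- by case: elimination1.
- by apply: elimination_nonzerodivisor color1_i1; [exact: elimination1|exact: color1_P].
apply: (exact_mod_add_gen hI exF) toric_nonzerodivisor0 _.
- exact: zero_ideal.
- apply: (@elimination_nonzerodivisor _ _ pred0 _ _ i0) => //; first exact: elimination0.
  by rewrite color0.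
exact: (exact_mod0 exF).
Qed.

(** M modulo the three thetas lives in degrees at most 2, and F modulo [J3] stays exact beyond
    position 0. *)
Lemma vanishing_mod_J3 : vanishing_mod F J3 0 2.
Proof.
split=> [e u hu e2|p e u _ _]; last exact: exact_mod_J3.
have [hJ _] := elimination3.
apply/(boundary_mod0P toric_kernel_ideal exF u hJ); apply: (@toric_top e) => //.
have [_ haug] := gradF; rewrite mxE; apply: homog_sum => j _.
by rewrite -(subrK (Defs.shift j) e); apply: homogM.
Qed.

Lemma linear_form1 j : linear_form k (pred1 j) = mpolyX k (mnm1 j) :> S.
Proof. exact: big_pred1_eq. Qed.

Lemma add_gen_constant_term J Q : (forall f, J f -> irrelevant_ideal f) ->
  forall f, add_gen J (linear_form k Q : S) f -> irrelevant_ideal f.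
Proof.
move=> Jm f [g /Jm]; rewrite /irrelevant_ideal mcoeffB constant_termM.
rewrite [X in _ - X * _](homog_constant_term (@linear_form_homog _ _ Q)) //.
by rewrite mul0r subr0.
Qed.

(** The remaining variables are killed one at a time. Each is a nonzerodivisor on the polynomial
    ring S/J, so it lengthens the range of possible homology by one and keeps the degree bound. *)
Lemma vanishing_mod_variables (ls : seq 'I_N) : uniq ls -> (forall i, i \in ls -> ~~ P3 i) ->
  exists J : S -> Prop, [/\ elimination (fun i => (i \in ls) || P3 i) J,
    vanishing_mod F J (size ls) 2, forall f, J3 f -> J f,
    forall i, i \in ls -> J (mpolyX k (mnm1 i)) &
    forall f, J f -> irrelevant_ideal f].
Proof.
elim: ls => [_ _|j ls IH /= /andP[jls uls] lsP].
  exists J3; split=> //; first exact: elimination3.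
  - exact: vanishing_mod_J3.
  - do 3!apply: add_gen_constant_term; move=> f ->.
    exact: mcoeff0.
have [i ils|J [eJ vJ J3J JX Jm]] := IH uls _.
  by apply: lsP; rewrite in_cons ils orbT.
have jP : forall i, pred1 j i -> ~~ ((i \in ls) || P3 i).
  by move=> i /eqP ->; rewrite (negPf jls) lsP ?mem_head.
have [hJ _] := eJ.
exists (add_gen J (linear_form k (pred1 j))); split.
- have := elimination_step eJ jP (eqxx j).
  have -> // : [predU1 j & (fun i => (i \in ls) || P3 i)] =
     (fun i => (i \in j :: ls) || P3 i) :> pred 'I_N.
  by apply/funext => i; rewrite in_cons -orbA.
- apply: (vanishing_mod_add_gen gradF exF) => //; first exact: linear_form_homog.
  exact: elimination_nonzerodivisor eJ jP (eqxx j).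
- by move=> f /J3J; exact: add_genW.
- move=> i; rewrite in_cons => /orP[/eqP ->|/JX]; last exact: add_genW.
  by have := @add_gen_self _ _ J (linear_form k (pred1 j)) 1 hJ; rewrite mulr1 linear_form1.
- exact: add_gen_constant_term.
Qed.

Lemma irrelevant_ideal_gen J : graded_ideal J ->
  (forall i, J (mpolyX k (mnm1 i) : S)) -> forall f, irrelevant_ideal f -> J f.
Proof.
move=> hJ JX f f0; rewrite (mpolyE f) big_seq; apply: hip_sum => // m mf.
rewrite -mul_mpolyC; apply: hipM => //.
elim/mnm_rec: m mf => [|i m _ _]; first by rewrite mcoeff_msupp f0 eqxx.
by rewrite mpolyXD mulrC; exact: hipM.
Qed.

Lemma toric_vanishing : vanishing_mod F irrelevant_ideal (N - 3) 2.
Proof.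
pose ls := enum (predC P3).
have uls : uniq ls by exact: enum_uniq.
have lsE i : (i \in ls) = ~~ P3 i by rewrite mem_enum.
have lsP i : i \in ls -> ~~ P3 i by rewrite lsE.
have [J [[hJ _] vJ J3J JX Jm]] := vanishing_mod_variables uls lsP.
have sz : size ls = (N - 3)%N.
  have n01 : i0 != i1.
    by apply/eqP => E; apply: (@v_neq_w 0) => //; rewrite -i0E E.
  have n02 : i0 != i2.
    by apply/eqP => E; apply: (v_neq_w (fan_size vwr_fan)); rewrite -i0E E.
  have n12 : i1 != i2.
    by apply/eqP => E; have := w_inj vwr_fan (leq0n r) (fan_size vwr_fan);
      rewrite -i1E -i2E E => /(_ erefl).
  have P3c : #|P3| = 3%N.
    have -> : #|P3| = #|[:: i2; i1; i0]| by apply: eq_card => i; rewrite !inE ?orbF.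
    apply/card_uniqP; rewrite /= !inE negb_or.
    by rewrite (eq_sym i2 i1) (eq_sym i2 i0) (eq_sym i1 i0) n01 n02 n12.
  have := cardC P3; rewrite card_ord P3c => cE; rewrite /ls -cardE.
  by apply/eqP; rewrite -(eqn_add2l 3) cE subnKC // -cE leq_addr.
(* Every variable lies in J: those of [ls] by construction, and each pivot because it is its theta
   minus variables of [ls]. *)
rewrite -sz; have J_irr f : irrelevant_ideal f <-> J f.
  split; last exact: Jm.
  apply: irrelevant_ideal_gen => // i; have [/JX//|] := boolP (i \in ls).
  have Th_in s p : J (Th s) -> (forall i', color s i' -> i' != p -> i' \in ls) ->
      color s p -> J (mpolyX k (mnm1 p) : S).
    move=> Js hs sp; have -> : mpolyX k (mnm1 p) = Th s -
        \sum_(i' | color s i' && (i' != p)) mpolyX k (mnm1 i').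
      by rewrite /linear_form (bigD1 p) //= addrK.
    apply: hipB => //; apply: hip_sum => // i' /andP[si' ne]; apply: JX.
    exact: hs.
  have Th_J s' J' : graded_ideal J' -> add_gen J' (Th s') (Th s').
    by move=> hJ'; have := @add_gen_self _ _ J' (Th s') 1 hJ'; rewrite mulr1.
  rewrite lsE negbK => /or3P[/eqP ->|/eqP ->|/orP[/eqP ->|//]].
  - apply: (Th_in o2); last exact: color2_i2.
      by apply: J3J; apply: Th_J; case: elimination2.
    move=> i' c2 ne; rewrite lsE; apply/negP => /or3P[|/eqP E|/orP[/eqP E|//]].
    + by rewrite (negPf ne).
    + by have := color2_P c2; rewrite E /= !inE eqxx.
    + by have := color2_P c2; rewrite E /= !inE eqxx orbT.
  - apply: (Th_in o1); last exact: color1_i1.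
      apply: J3J; have [hJ1 _] := elimination1; have [hJ2 _] := elimination2.
      by apply: add_genW => //; exact: Th_J.
    move=> i' c1 ne; rewrite lsE; apply/negP => /or3P[/eqP E|/eqP E|/orP[/eqP E|//]].
    + have := color2_i2; rewrite -E => /(@color_w o2)[//|j [jr oj aj]].
      have [//|j' [jr' oj' aj']] := @color_w o1 i' _ c1.
      by move: oj oj'; rewrite (w_inj vwr_fan jr jr') => [->|]; rewrite -?aj -?aj'.
    + by rewrite E eqxx in ne.
    + by have := color1_P c1; rewrite E /= !inE eqxx.
  - apply: (Th_in o0); last by rewrite color0.
      apply: J3J; have [hJ1 _] := elimination1; have [hJ2 _] := elimination2.
      apply: add_genW => //; apply: add_genW => //; apply: Th_J.
      exact: zero_ideal.
    by move=> i'; rewrite color0 => ->.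
have [v0 v1] := vJ; split=> [e u hu e2|p e u hu hp hc].
  by have [x hx] := v0 e u hu e2; exists x => i; apply/J_irr.
have [|x hx] := v1 p e u hu hp _; first by move=> i; apply/J_irr.
by exists x => i; apply/J_irr.
Qed.

End Pivots.

End ToricMap.

(** Undoing a difference leaves a constant, which is fixed by the common values at negative
    arguments. *)
Lemma difference_inj n (f g : int -> int) : (forall q, q < 0 -> f q = g q) ->
  difference n f =1 difference n g -> f =1 g.
Proof.
elim: n f g => [//|n IH] f g fg0 E.
have dfg : diff f =1 diff g.
  apply: IH => [q q0|]; first by rewrite /diff !fg0; lia.
  by move=> q; rewrite -!differenceSr.
move=> q; have [m] := ubnP `|q|%N; elim: m q => // m IHm q qm.
have [q0|q0] := ltP q 0; first exact: fg0.
have := dfg q; rewrite /diff; have -> : f (q - 1) = g (q - 1).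
  have [q1|q1] := ltP (q - 1) 0; first exact: fg0.
  by apply: IHm; lia.
by move=> /addIr.
Qed.

(** * The Hilbert function of the coordinate ring *)

Section HilbertFunction.
Variables (k : fieldType) (N : nat) (v : pt3) (w : nat -> pt3) (r B : nat).
Variable a : 'I_N -> pt3.
Hypothesis toric_a : toric_points v w r B a.
Let vwr_fan := tp_fan toric_a.
Let v_fits := tp_apex_fits toric_a.
Let w_fits := tp_fits toric_a.
Let leadH := fan_leading_terms vwr_fan v_fits w_fits.
Local Notation S := (mpoly N k).
Local Notation C := (cone_monomial v w r B).
Local Notation ht := monomial_height.
Local Notation stp := (step (lead_monomial v w r B)).

Definition height_monomials (e : nat) : seq (multinom 3) :=
  undup [seq weight B a (bmnm m) | m <- enum {: bmultinom N e.+1} & mdeg (bmnm m) == e].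

Definition hilbert_function (e : nat) := size (height_monomials e).

Lemma mem_height_monomials e c :
  (c \in height_monomials e) = C c && (ht c == e).
Proof.
rewrite mem_undup; apply/mapP/andP.
  case=> m; rewrite mem_filter => /andP[/eqP me _] ->.
  by rewrite (weight_cone toric_a) (weight_height toric_a) me.
case=> /(weight_surj toric_a)[m <-]; rewrite (weight_height toric_a) => /eqP me.
have mb : (mdeg m < e.+1)%N by rewrite me.
exists (BMultinom mb) => //; rewrite mem_filter /= me eqxx /=.
by rewrite mem_enum.
Qed.

Lemma height_monomials_uniq e : uniq (height_monomials e).
Proof. exact: undup_uniq. Qed.

Definition height_coords e (f : S) : 'rV[k]_(hilbert_function e) :=
  \row_c mcoeff (nth (@mnm0 3) (height_monomials e) c) (toric_map B a f).

Lemma height_coords_ker e f : homog_of_degree e%:Z f ->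
  toric_kernel B a f <-> height_coords e f = 0.
Proof.
move=> hf; split=> [f0|h0].
  by apply/rowP => c; rewrite !mxE f0 mcoeff0.
apply/mpolyP => c; rewrite mcoeff0; apply/eqP/negPn/negP => cf.
have /andP[Cc hc] := toric_map_homog toric_a hf cf.
have cs : c \in height_monomials e by rewrite mem_height_monomials Cc /= -eqz_nat.
have ci : (index c (height_monomials e) < hilbert_function e)%N by rewrite index_mem.
have := congr1 (fun u : 'rV_ _ => u 0 (Ordinal ci)) h0.
by rewrite !mxE /= nth_index // => /eqP; rewrite (negPf cf).
Qed.

Lemma height_coords_surj e (u : 'rV[k]_(hilbert_function e)) :
  exists2 f, homog_of_degree e%:Z f & height_coords e f = u.
Proof.
pose g : mpoly 3 k := \sum_c u 0 c *: mpolyX k (nth (@mnm0 3) (height_monomials e) c).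
have gE c : mcoeff (nth (@mnm0 3) (height_monomials e) (val c)) g = u 0 c.
  rewrite raddf_sum /= (bigD1 c) //= mcoeffZ mcoeffX eqxx mulr1 big1 ?addr0 // => c' ne.
  rewrite mcoeffZ mcoeffX nth_uniq ?height_monomials_uniq ?ltn_ord //.
  by rewrite val_eqE (negPf ne) mulr0.
have gC : supported (fun c => C c && (ht c == e)) g.
  apply: supported_sum => c _; apply: supportedZ; apply: supportedX.
  by rewrite -mem_height_monomials mem_nth // ltn_ord.
have [f [fE fh]] : exists f : S, toric_map B a f = g /\ forall e',
    (forall c, mcoeff c g != 0 -> (ht c)%:Z = e') -> homog_of_degree e' f.
  by apply: (toric_map_surj toric_a) => c /gC /andP[].
exists f; first by apply: fh => c /gC /andP[_ /eqP ->].
by apply/rowP => c; rewrite mxE fE gE.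
Qed.

Lemma hilbert_euler (F : free_seq k N) (e P : nat) : graded_maps F ->
  exact_seq (toric_kernel B a) F ->
  (forall p (i : 'I_(rk F p)), p%:Z <= Defs.shift i) -> (e <= P)%N ->
  (hilbert_function e)%:Z = \sum_(p < P.+1)
    (-1) ^+ p * #|{: piece_index N (@Defs.shift k N F p) e}|%:Z.
Proof.
move=> gradF exF lowF eP.
apply: (@euler_pieces k N (toric_kernel B a) F
  (toric_kernel_ideal k toric_a) gradF exF lowF e
  (hilbert_function e) (height_coords e)) => //.
- by move=> f g; apply/rowP => c; rewrite !mxE raddfD mcoeffD.
- by move=> c f; apply/rowP => i; rewrite !mxE toric_mapC mcoeffZ.
- exact: height_coords_ker.
- exact: height_coords_surj.
Qed.

Definition in_image (s : 'I_3) c :=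
  has (fun c' => stp s c' == c) (height_monomials (ht c).-1).

Lemma in_imageP s c : reflect (exists2 c', C c' & stp s c' = c) (in_image s c).
Proof.
apply: (iffP hasP) => [[c']|[c' Cc' E]].
  by rewrite mem_height_monomials => /andP[Cc' _] /eqP E; exists c'.
exists c'; last exact/eqP.
rewrite mem_height_monomials Cc' -E /step.
by rewrite (lt_deg leadH c' (lt_lead_mem leadH s Cc')) eqxx.
Qed.

(* A basis of the degree [e] part of the quotient of M by the first [t] thetas. *)
Definition avoiding (t e : nat) : seq (multinom 3) :=
  [seq c <- height_monomials e | [forall s : 'I_3, (s < t)%N ==> ~~ in_image s c]].

Lemma avoidingP t e c : reflect [/\ C c, ht c = e &
  forall s : 'I_3, (s < t)%N -> ~~ in_image s c] (c \in avoiding t e).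
Proof.
rewrite mem_filter mem_height_monomials; apply: (iffP and3P) => -[].
  by move=> /forallP h Cc /eqP hc; split=> // s st; have /implyP := h s; exact.
move=> Cc hc h; split=> //; last exact/eqP.
by apply/forallP => s; apply/implyP; exact: h.
Qed.

Lemma avoiding0 e : avoiding 0 e = height_monomials e.
Proof.
rewrite /avoiding (eq_filter (a2 := predT)) ?filter_predT // => c.
exact/forallP.
Qed.

Lemma step_height s c : C c -> ht (stp s c) = (ht c).+1.
Proof. by move=> Cc; rewrite (lt_deg leadH c (lt_lead_mem leadH s Cc)). Qed.

Lemma step_cone s c : C c -> C (stp s c).
Proof. by move=> Cc; exact: (lt_closed leadH Cc (lt_lead_mem leadH s Cc)). Qed.

Lemma avoiding_uniq t e : uniq (avoiding t e).
Proof. by rewrite filter_uniq // height_monomials_uniq. Qed.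

Lemma avoidingS0 (s : 'I_3) : avoiding s.+1 0 = avoiding s 0.
Proof.
apply: eq_in_filter => c; rewrite mem_height_monomials => /andP[Cc /eqP hc].
have noimg t : ~~ in_image t c.
  apply/in_imageP => -[c' Cc' E]; move: hc; rewrite -E step_height //.
by apply/forallP/forallP => _ t; rewrite noimg implybT.
Qed.

(** Combinatorial form of 0 -> Q(-1) -> Q -> Q/theta_s Q -> 0, with Q the quotient of M by the
    earlier thetas: [stp s] embeds the basis of Q in degree e into that in degree e + 1, and what it
    misses avoids s as well. Swapping steps shows that preimages avoid the earlier colors, and
    commuting them that images do. *)
Lemma size_avoidingS (s : 'I_3) e :
  size (avoiding s e.+1) = (size (avoiding s.+1 e.+1) + size (avoiding s e))%N.
Proof.
rewrite -(size_map (stp s) (avoiding s e)) -size_cat.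
have perm : perm_eq (avoiding s e.+1) (avoiding s.+1 e.+1 ++ map (stp s) (avoiding s e)).
  apply: uniq_perm; first exact: avoiding_uniq.
    rewrite cat_uniq avoiding_uniq map_inj_in_uniq ?avoiding_uniq ?andbT.
      apply/hasPn => c /mapP[c' /avoidingP[Cc' _ _] ->].
      apply/negP => /avoidingP[_ _ /(_ s (ltnSn s))] /in_imageP[].
      by exists c'.
    by move=> c c' /avoidingP[Cc _ _] /avoidingP[Cc' _ _]; exact: (lt_step_inj leadH).
  move=> c; rewrite mem_cat; apply/avoidingP/orP.
    move=> [Cc hc h]; have [/in_imageP[c' Cc' E]|nimg] := boolP (in_image s c).
      right; apply/mapP; exists c' => //; apply/avoidingP; split=> //.
        by move: hc; rewrite -E step_height // => -[].
      move=> t ts; apply/in_imageP => -[c'' Cc'' E'].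
      have /in_imageP[] := h t ts; exists (stp s c''); first exact: step_cone.
      by rewrite (lt_step_swap leadH) // E' E.
    left; apply/avoidingP; split=> // t; rewrite ltnS leq_eqVlt => /orP[/eqP ts|]; last exact: h.
    by have -> : t = s by exact: val_inj.
  case=> [/avoidingP[Cc hc h]|/mapP[c' /avoidingP[Cc' hc' h] ->]].
    by split=> // t ts; apply: h; rewrite ltnS ltnW.
  split; [exact: step_cone|by rewrite step_height ?hc'|move=> t ts].
  apply/in_imageP => -[c'' Cc'' E]; have /in_imageP[] := h t ts.
  have st : s != t by rewrite -val_eqE gtn_eqF.
  by have [x Cx ->] := lt_step_comm leadH st Cc' Cc'' (esym E); exists x.
exact: perm_size perm.
Qed.

Definition avoiding_count t (q : int) : int :=
  if q is Posz e then (size (avoiding t e))%:Z else 0.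

Lemma avoiding_countS (s : 'I_3) : avoiding_count s.+1 =1 diff (avoiding_count s).
Proof.
case=> [[|e]|e]; rewrite /diff.
- by rewrite /= avoidingS0 subr0.
- have -> : e.+1%:Z - 1 = e%:Z by lia.
  by rewrite /= size_avoidingS PoszD addrK.
- by have -> : Negz e - 1 = Negz e.+1 by lia.
Qed.

Lemma difference_avoiding : difference 3 (hilbert hilbert_function) =1 avoiding_count 3.
Proof.
move=> q; have E3 : avoiding_count 3 =1 diff (avoiding_count 2) := avoiding_countS o2.
have E2 : avoiding_count 2 =1 diff (avoiding_count 1) := avoiding_countS o1.
have E1 : avoiding_count 1 =1 diff (avoiding_count 0) := avoiding_countS o0.
rewrite E3 -[RHS]/(difference 1 (avoiding_count 2) q).
rewrite (difference_ext 1 E2) -differenceSr (difference_ext 2 E1) -differenceSr.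
by apply: difference_ext => -[e|e] //=; rewrite avoiding0.
Qed.

Lemma avoiding_top e : (3 <= e)%N -> avoiding 3 e = [::].
Proof.
move=> e3; apply/eqP; rewrite -size_eq0 -leqn0 leqNgt -has_predT.
apply/hasP => -[c /avoidingP[Cc hc h] _].
have [|s [c' Cc' E]] := step_top vwr_fan v_fits w_fits Cc; first by rewrite hc.
by have /in_imageP[] := h s (ltn_ord s); exists c'.
Qed.

Lemma hilbert_function0 : hilbert_function 0 = 1%N.
Proof.
rewrite /hilbert_function; have : perm_eq (height_monomials 0) [:: @mnm0 3].
  apply: uniq_perm; [exact: height_monomials_uniq|by []|move=> c].
  rewrite mem_height_monomials inE; apply/andP/eqP => [[Cc /eqP hc]|->].
    have [m mE] := weight_surj toric_a Cc.
    have := weight_height toric_a m; rewrite mE hc => /esym/eqP.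
    by rewrite mdeg_eq0 -mE => /eqP ->; rewrite weight0.
  have := weight_cone toric_a (@mnm0 N); have := weight_height toric_a (@mnm0 N).
  by rewrite weight0 mdeg0 => -> ->.
by move/perm_size.
Qed.

Lemma hilbert_function1 : hilbert_function 1 = N.
Proof.
rewrite /hilbert_function.
have : perm_eq (height_monomials 1) [seq weight B a (mnm1 i) | i : 'I_N].
  apply: uniq_perm; first exact: height_monomials_uniq.
    rewrite map_inj_uniq ?enum_uniq // => i j; rewrite !weight1.
    move=> /(congr1 (monomial_point B)); rewrite !point_monomialK.
    - exact: (tp_inj toric_a).
    - exact: (a_fits toric_a).
    - exact: (a_fits toric_a).
  move=> c; rewrite mem_height_monomials; apply/andP/mapP => [[Cc /eqP hc]|[i _ ->]].
    have [m mE] := weight_surj toric_a Cc.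
    have /mdeg1P[i /eqP mi] : mdeg m == 1%N.
      by rewrite -(weight_height toric_a) mE hc.
    by exists i; rewrite ?mem_enum // -mE mi.
  by rewrite (weight_cone toric_a) (weight_height toric_a) mdeg1.
by move/perm_size; rewrite size_map size_enum_ord.
Qed.

End HilbertFunction.

(** * Lattice polygons *)

Definition vec := (int * int)%type.

Section PlaneVectors.
Implicit Types (d x y z p q : vec).

Definition cross x y : int := x.1 * y.2 - x.2 * y.1.
Definition dot x y : int := x.1 * y.1 + x.2 * y.2.
(** Directions at an angle in (0, pi] counterclockwise from d: -d is included and d is not, so no
    two of them are opposite. *)
Definition half d z := 0 < cross d z \/ (cross d z = 0 /\ dot d z < 0).

Lemma crossB x y z : cross x (y - z) = cross x y - cross x z.
Proof. by case: y z => [a b] [a' b']; rewrite /cross /=; ring. Qed.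

Lemma crossN x y : cross x (- y) = - cross x y.
Proof. by case: y => a b; rewrite /cross /=; ring. Qed.

Lemma crossC x y : cross x y = - cross y x.
Proof. by rewrite /cross; ring. Qed.

Lemma cross_cramer d x y z :
  cross x y * cross d z + cross y d * cross x z + cross d x * cross y z = 0.
Proof. by rewrite /cross; ring. Qed.

Lemma dot_cross d x y : dot d d * cross x y = dot d x * cross d y - cross d x * dot d y.
Proof. by rewrite /dot /cross; ring. Qed.

Lemma dot_ge0 d : 0 <= dot d d.
Proof. by rewrite addr_ge0 // -expr2 sqr_ge0. Qed.

Lemma dot_eq0 d : dot d d = 0 -> d = 0.
Proof. by case: d => [a b]; rewrite /dot /= => h; congr pair; nia. Qed.

Lemma dot_gt0 d x : dot d x < 0 -> 0 < dot d d.
Proof.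
move=> h; have := dot_ge0 d; rewrite le_eqVlt => /orP[/eqP/esym/dot_eq0 d0|//].
by move: h; rewrite d0 /dot /= !mul0r.
Qed.

(** Parallel vectors of [half d] are positive multiples of each other, since no two are opposite. *)
Lemma half_parallel_cross d x y z : half d x -> half d y -> cross x y = 0 ->
  0 < cross x z -> 0 < cross y z.
Proof.
move=> hx hy xy xz; have E := cross_cramer d x y z; rewrite xy mul0r add0r in E.
have {}E : cross d x * cross y z = cross d y * cross x z.
  by rewrite (crossC y d) in E; lia.
case: hx => [hx|[hx dx]].
  case: hy => [hy|[hy dy]].
    by rewrite -(pmulr_rgt0 _ hx) E mulr_gt0.
  have E1 := dot_cross d x y; rewrite xy hy mulr0 in E1.
  have : cross d x * dot d y < 0 by rewrite pmulr_rlt0.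
  by move: E1; lia.
case: hy => [hy|[hy dy]].
  by move: (mulr_gt0 hy xz) => yz; move: yz; rewrite -E hx mul0r ltxx.
have dd := dot_gt0 dx.
have E1 := dot_cross d x z; have E2 := dot_cross d y z.
rewrite hx mul0r subr0 in E1; rewrite hy mul0r subr0 in E2.
rewrite -(pmulr_rgt0 _ dd) E2 nmulr_rgt0 //.
have : 0 < dot d x * cross d z by rewrite -E1 mulr_gt0.
by rewrite nmulr_rgt0.
Qed.

Lemma half_cross_trans d x y z : half d x -> half d y -> half d z ->
  0 <= cross x y -> 0 <= cross y z -> 0 <= cross x z.
Proof.
move=> hx hy hz xy yz; rewrite leNgt; apply/negP => xz.
have E := cross_cramer d x y z; rewrite (crossC y d) in E.
have ge0 u : half d u -> 0 <= cross d u by case=> [/ltW//|[-> _]].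
have [xy0|xy0] := eqVneq (cross x y) 0.
  have yx : cross y x = 0 by rewrite crossC xy0 oppr0.
  have := @half_parallel_cross d y x (- z) hy hx yx.
  have := @half_parallel_cross d x y (- z) hx hy xy0; rewrite !crossN; lia.
have [yz0|yz0] := eqVneq (cross y z) 0.
  have zx : 0 < cross z x by rewrite crossC; lia.
  have zy : cross z y = 0 by rewrite crossC yz0 oppr0.
  have := half_parallel_cross hz hy zy zx; rewrite crossC; lia.
have xy1 : 0 < cross x y by lia.
have yz1 : 0 < cross y z by lia.
have dx := ge0 x hx; have dy := ge0 y hy; have dz := ge0 z hz.
have [a1 a2 a3] : [/\ 0 <= cross x y * cross d z, 0 <= - (cross d y * cross x z) &
    0 <= cross d x * cross y z].
  by split; rewrite ?mulr_ge0 // ?(ltW xy1) ?(ltW yz1) // -mulrN mulr_ge0 // oppr_ge0 ltW.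
have dz0 : cross d z = 0.
  have /eqP : cross x y * cross d z = 0 by lia.
  by rewrite mulf_eq0 (gt_eqF xy1) => /eqP.
have dx0 : cross d x = 0.
  have /eqP : cross d x * cross y z = 0 by lia.
  by rewrite mulf_eq0 (gt_eqF yz1) orbF => /eqP.
have dotx : dot d x < 0 by case: hx => [|[]]; rewrite ?dx0.
have := dot_cross d x z; rewrite dx0 dz0 mulr0 mul0r subr0 => /eqP.
by rewrite mulf_eq0 (gt_eqF (dot_gt0 dotx)) => /eqP; lia.
Qed.

(** By angle first, and on a common ray the farther point first, so that the least element is a
    corner and not a point inside an edge. *)
Definition sweep x y := 0 < cross x y \/ (cross x y = 0 /\ dot y y <= dot x x).

Lemma sweep_total x y : sweep x y \/ sweep y x.
Proof. by rewrite /sweep (crossC y x); lia. Qed.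

Lemma sweep_trans d x y z : half d x -> half d y -> half d z ->
  sweep x y -> sweep y z -> sweep x z.
Proof.
move=> hx hy hz sxy syz.
have cxy : 0 <= cross x y by case: sxy => [/ltW|[->]].
have cyz : 0 <= cross y z by case: syz => [/ltW|[->]].
have := half_cross_trans hx hy hz cxy cyz.
rewrite le_eqVlt => /orP[/eqP/esym xz|]; last by left.
right; split=> //; have zx : cross z x = 0 by rewrite crossC xz oppr0.
case: sxy => [xy|[_ nxy]].
  by have := half_parallel_cross hx hz xz xy; rewrite crossC; lia.
case: syz => [yz|[_ nyz]]; last exact: le_trans nxy.
have zy : 0 < cross (- z) y by move: yz; rewrite /cross /=; case: (z) => a b /=; lia.
have xmy : 0 < cross x (- y).
  by apply: (half_parallel_cross hz hx zx); rewrite crossN crossC; lia.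
by move: xmy cxy; rewrite /cross /=; case: (y) => a b /=; lia.
Qed.

Lemma sweep_min d (s : seq vec) : s != [::] -> (forall x, x \in s -> half d x) ->
  exists2 m, m \in s & forall x, x \in s -> sweep m x.
Proof.
elim: s => // a [_ _ ha|b s IH _ hs].
  exists a; first by rewrite mem_head.
  by move=> x; rewrite inE => /eqP ->; have [] := sweep_total a a.
have [||m ms hm] := IH => //; first by move=> x xs; apply: hs; rewrite in_cons xs orbT.
have ha : half d a by apply: hs; rewrite mem_head.
have hm' : half d m by apply: hs; rewrite in_cons ms orbT.
have [am|ma] := sweep_total a m.
  exists a => [|x]; first by rewrite mem_head.
  rewrite in_cons => /orP[/eqP ->|xs]; first by have [] := sweep_total a a.
  by apply: (sweep_trans ha hm' _ am (hm x xs)); apply: hs; rewrite in_cons xs orbT.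
exists m => [|x]; first by rewrite in_cons ms orbT.
by rewrite in_cons => /orP[/eqP ->|/hm].
Qed.

Section GiftWrapping.
Variable V : seq vec.

(* The invariant of gift wrapping: the corner [p] was reached in direction [d]. *)
Definition pivot d p := forall x, x \in V -> x != p -> half d (x - p).

(** The gift wrapping step: q is the vertex that comes first in the sweep around p. *)
Lemma next_pivot d p : pivot d p -> (exists2 x, x \in V & x != p) ->
  exists q, [/\ q \in V, q != p & pivot (q - p) q].
Proof.
move=> hp [x0 x0V x0p]; pose s := [seq x - p | x <- V & x != p].
have sP z : z \in s -> exists2 x, (x \in V) && (x != p) & z = x - p.
  by case/mapP => x; rewrite mem_filter andbC => h ->; exists x.
have sI x : x \in V -> x != p -> x - p \in s.
  by move=> xV xp; apply: map_f; rewrite mem_filter xp.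
have [||m /sP[q /andP[qV qp] ->] hm] := @sweep_min d s.
- by apply/eqP => s0; have := sI _ x0V x0p; rewrite s0.
- by move=> z /sP[x /andP[xV xp] ->]; exact: hp.
exists q; split=> // x xV xq.
have E : x - q = (x - p) - (q - p) by rewrite opprB addrA subrK.
have c0 : cross (q - p) (x - q) = cross (q - p) (x - p).
  by rewrite E crossB; suff -> : cross (q - p) (q - p) = 0; [rewrite subr0|rewrite /cross; ring].
have dotE : dot (q - p) (x - q) = dot (q - p) (x - p) - dot (q - p) (q - p).
  by rewrite E; case: (x - p) (q - p) => [a b] [a' b']; rewrite /dot /=; ring.
have qq : 0 < dot (q - p) (q - p).
  have := dot_ge0 (q - p); rewrite le_eqVlt => /orP[/eqP/esym/dot_eq0/eqP|//].
  by rewrite subr_eq0 (negPf qp).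
have [xp|xp] := eqVneq x p.
  right; rewrite c0 dotE xp subrr; split; first by rewrite /cross /=; ring.
  have -> : dot (q - p) 0 = 0 by rewrite /dot /= !mulr0.
  by lia.
case: (hm _ (sI _ xV xp)) => [h|[h hn]]; first by left; rewrite c0.
right; split; first by rewrite c0.
rewrite dotE subr_lt0; have xx : x - p != q - p by rewrite (inj_eq (addIr _)).
move: h hn xx qq; case: (x - p) (q - p) => [a b] [a' b']; rewrite /cross /dot /=.
move=> h hn xx qq; rewrite ltNge; apply/negP => hd.
(* On the ray from p through q the vector x - p is no longer than q - p; a dot product with q - p as
   large as that of q - p itself would make the squared distance of x and q at most 0. *)
have h1 : (a - a') * (a - a') + (b - b') * (b - b') <= 0 by lia.
have sq0 (u t : int) : u * u + t * t <= 0 -> u = 0.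
  move=> ut; have := sqr_ge0 u; have := sqr_ge0 t; rewrite !expr2 => t0 u0.
  have /eqP : u * u = 0 by lia.
  by rewrite mulf_eq0 orbb => /eqP.
have e1 := subr0_eq (sq0 _ _ h1); rewrite addrC in h1.
by have e2 := subr0_eq (sq0 _ _ h1); rewrite e1 e2 eqxx in xx.
Qed.

Lemma pivot_cross d p x : pivot d p -> x \in V -> 0 <= cross d (x - p).
Proof.
move=> hp xV; have [->|xp] := eqVneq x p.
  by rewrite subrr /cross /= !mulr0 subrr.
by case: (hp x xV xp) => [/ltW|[->]].
Qed.

Lemma half_cross_trans_lt d x y z : half d x -> half d y -> half d z ->
  0 < cross x y -> 0 < cross y z -> 0 < cross x z.
Proof.
move=> hx hy hz xy yz.
have := half_cross_trans hx hy hz (ltW xy) (ltW yz).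
rewrite le_eqVlt => /orP[/eqP/esym xz|//].
by have := half_parallel_cross hx hz xz xy; rewrite crossC; lia.
Qed.

Lemma count_lt (T : Type) (f g : pred T) (s : seq T) : subpred f g ->
  has (fun a => g a && ~~ f a) s -> (count f s < count g s)%N.
Proof.
move=> fg; elim: s => //= a s IH /orP[/andP[ga /negPf fa]|/IH h].
  by rewrite ga fa add0n add1n ltnS sub_count.
by rewrite -addnS leq_add //; case fa : (f a) => //; rewrite (fg a fa).
Qed.

Variable v : vec.
Hypotheses (vV : v \in V) (v_pivot : pivot (0, -1) v).

Definition turn x y := cross (x - v) (y - v).

Lemma turn_cross x y : cross (y - x) (v - x) = turn x y.
Proof.
case: x y => [a b] [a' b']; rewrite /turn /cross; case: (v) => [s t] /=; ring.
Qed.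

Lemma turn_cross2 x y : cross (v - x) (y - x) = - turn x y.
Proof.
case: x y => [a b] [a' b']; rewrite /turn /cross; case: (v) => [s t] /=; ring.
Qed.

Lemma turn_cross3 x y z : cross (y - x) (z - x) = turn x y + turn y z - turn x z.
Proof.
case: x y z => [a b] [a' b'] [a'' b'']; rewrite /turn /cross; case: (v) => [s t] /=; ring.
Qed.

Lemma cross_shift p q x : cross (q - p) (x - q) = cross (q - p) (x - p).
Proof. by case: p q x => [a b] [a' b'] [c e]; rewrite /cross /=; ring. Qed.

Lemma turn_trans x y z : x \in V -> y \in V -> z \in V -> x != v -> y != v -> z != v ->
  0 < turn x y -> 0 < turn y z -> 0 < turn x z.
Proof.
move=> xV yV zV xv yv zv; apply: half_cross_trans_lt.
- exact: v_pivot.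
- exact: v_pivot.
- exact: v_pivot.
Qed.

(** Otherwise v, which is not to the right of the new edge, lies on its line, and in the direction
    of q; then x, being to the left when turning around v, would be on the wrong side of that
    supporting line. *)
Lemma next_turn d p q x : p \in V -> p != v -> pivot d p -> q \in V -> q != p ->
  pivot (q - p) q -> x \in V -> 0 < turn p x -> 0 < turn p q.
Proof.
move=> pV pv hp qV qp hq xV px; rewrite ltNge; apply/negP => pq.
have pq0 : cross (q - p) (v - p) = 0.
  have := pivot_cross hq vV; rewrite cross_shift turn_cross; lia.
have vp : v != p by rewrite eq_sym.
have vq0 : cross (v - p) (q - p) = 0 by rewrite crossC pq0 oppr0.
have := half_parallel_cross (hp _ vV vp) (hp _ qV qp) vq0 (z := - (x - p)).
have := pivot_cross hq xV; rewrite cross_shift !crossN turn_cross2; lia.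
Qed.

(** Wrapping goes on while some vertex lies further around v, and so stops just before returning to
    v. *)
Fixpoint chain p (s : seq vec) : Prop :=
  if s is q :: s' then
    [/\ q \in V, q != p, pivot (q - p) q, 0 < turn p q & chain q s']
  else forall x, x \in V -> turn p x <= 0.

(** Each step lowers the number of vertices still ahead: those ahead of q are ahead of p, by
    transitivity, and q itself drops out. *)
Lemma chain_exists d p : p \in V -> p != v -> pivot d p -> exists s, chain p s.
Proof.
have [m] := ubnP (count (fun x => 0 < turn p x) V).
elim: m d p => // m IH d p hm pV pv hp.
have [/hasP[x xV px]|/hasPn no] := boolP (has (fun x => 0 < turn p x) V); last first.
  by exists [::] => x /no; rewrite -leNgt.
have [|q [qV qp hq]] := next_pivot hp.
  by exists v => //; rewrite eq_sym.
have pq := next_turn pV pv hp qV qp hq xV px.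
have qv : q != v.
  by apply: contraTneq pq => ->; rewrite /turn subrr /cross /= !mulr0 subrr ltxx.
have [|s hs] := IH (q - p) q _ qV qv hq; last by exists (q :: s).
rewrite -ltnS (leq_trans _ hm) // ltnS.
rewrite -(eq_in_count (a1 := fun x => (x \in V) && (0 < turn q x))); last by move=> y ->.
rewrite -[X in (_ < X)%N](eq_in_count (a1 := fun x => (x \in V) && (0 < turn p x))); last first.
  by move=> y ->.
apply: count_lt => [y /andP[yV qy]|].
  rewrite yV /=; have [yv|yv] := eqVneq y v.
    by move: qy; rewrite yv /turn subrr /cross /= !mulr0 subrr ltxx.
  exact: turn_trans pq qy.
apply/hasP; exists q => //; rewrite qV pq /=.
by rewrite /turn /cross mulrC subrr ltxx.
Qed.

Lemma chain_nth d p s : p \in V -> p != v -> pivot d p -> chain p s ->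
  [/\ forall i, (i <= size s)%N -> [/\ nth v (p :: s) i \in V, nth v (p :: s) i != v &
        exists d', pivot d' (nth v (p :: s) i)],
      forall i, (i < size s)%N -> let x := nth v (p :: s) i in let y := nth v s i in
        [/\ y != x, pivot (y - x) y & 0 < turn x y] &
      forall x, x \in V -> turn (nth v (p :: s) (size s)) x <= 0].
Proof.
elim: s d p => [|q s IH] d p pV pv hp /=.
  by move=> h; split=> // -[|//] _; split=> //; exists d.
case=> qV qp hq pq hs; have qv : q != v.
  by apply: contraTneq pq => ->; rewrite /turn subrr /cross /= !mulr0 subrr ltxx.
have [h1 h2 h3] := IH _ q qV qv hq hs; split=> //.
- by case=> [_|i]; [split=> //; exists d|exact: h1].
- by case=> [_|i]; [split|exact: h2].
Qed.

Definition hom p : pt3 := (p.1, p.2, 1).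

Lemma det3_hom p q x : det3 (hom p) (hom q) (hom x) = cross (q - p) (x - p).
Proof. by case: p q x => [a b] [a' b'] [c e]; rewrite /det3 /cross /=; ring. Qed.

Lemma pivot_fan : (exists x y z, [/\ x \in V, y \in V, z \in V & cross (y - x) (z - x) != 0]) ->
  exists w r, [/\ fan (hom v) (fun i => hom (w i)) r, forall i, (i <= r)%N -> w i \in V &
    forall x, x \in V -> cone (hom v) (fun i => hom (w i)) r (hom x)].
Proof.
move=> [x [y [z [xV yV zV xyz]]]].
have [|p [pV pv hp]] := next_pivot v_pivot.
  have [xv|xv] := eqVneq x v; last by exists x.
  exists y => //; apply: contraNneq xyz => ->; rewrite xv subrr.
  by rewrite /cross /= !mul0r subrr.
have p_turn u : u \in V -> 0 <= turn p u.
  by move=> uV; have := pivot_cross hp uV; rewrite cross_shift.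
have [s hs] := chain_exists pV pv hp.
have [h1 h2 h3] := chain_nth pV pv hp hs.
set w := nth v (p :: s) in h1 h2 h3; set r := size s in h1 h2 h3.
have r0 : (0 < r)%N.
  (* A chain without edges would put all vertices on the line through v and p. *)
  rewrite lt0n; apply/eqP => r0; rewrite r0 /w /= in h3.
  have t0 u : u \in V -> turn p u = 0 by move=> uV; have := h3 u uV; have := p_turn u uV; lia.
  have pp : 0 < dot (p - v) (p - v).
    have := dot_ge0 (p - v); rewrite le_eqVlt => /orP[/eqP/esym/dot_eq0/eqP|//].
    by rewrite subr_eq0 (negPf pv).
  have tt u u' : u \in V -> u' \in V -> turn u u' = 0.
    move=> uV uV'; have := dot_cross (p - v) (u - v) (u' - v).
    rewrite -![cross (p - v) _]/(turn p _) !t0 // mulr0 mul0r subrr => /eqP.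
    by rewrite mulf_eq0 (gt_eqF pp) => /eqP.
  by move: xyz; rewrite turn_cross3 !tt // addr0 subrr eqxx.
have w_turn i j : (i < j <= r)%N -> 0 < turn (w i) (w j).
  case/andP; elim: j => // j IH; rewrite ltnS leq_eqVlt => /orP[/eqP ->|ij] jr.
    by have [] := h2 j jr.
  have [_ _ tj] := h2 j jr.
  have [a1 a2 _] := h1 i (ltnW (ltn_trans ij jr)); have [b1 b2 _] := h1 j (ltnW jr).
  have [c1 c2 _] := h1 j.+1 jr.
  by apply: turn_trans (IH ij (ltnW jr)) tj.
exists w, r; split.
- split=> //.
  + by move=> i j ij; rewrite /ray det3_hom; exact: w_turn.
  + move=> i j ir jr; rewrite farE det3_hom -cross_shift.
    by have [_ hi _] := h2 i ir; apply: pivot_cross => //; have [] := h1 j jr.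
  + move=> i j ir jr; rewrite farE det3_hom => far0.
    have [yx hy txy] := h2 i ir; rewrite -[nth v s i]/(w i.+1) in yx hy txy.
    have [wjV wjv _] := h1 j jr; have [wiV wiv [d' hd']] := h1 i (ltnW ir).
    case: (ltngtP j i) => [ji|ij|->]; last by left.
      (* An earlier w_j on the line of the edge would lie in the same direction from w_i as w_(i+1),
         so that the turn from w_i to it would be positive. *)
      exfalso; have tji := w_turn j i; rewrite ji (ltnW ir) in tji.
      have wji : w j != w i.
        apply: contraTneq (tji isT) => ->; rewrite /turn /cross mulrC subrr ltxx.
        by [].
      have := half_parallel_cross (hd' _ (let: And3 h _ _ := h1 i.+1 ir in h) yx) (hd' _ wjV wji)
        far0 (z := v - w i).
      rewrite !turn_cross => /(_ txy); move: (tji isT).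
      by rewrite /turn (crossC (w i - v)) oppr_gt0 => /ltW/le_gtF ->.
    have [->|nij] := eqVneq j i.+1; first by right.
    exfalso; have ij' : (i.+1 < j)%N by rewrite ltn_neqAle eq_sym nij.
    have tj := w_turn i.+1 j; rewrite ij' jr in tj.
    have wji : w j != w i.+1.
      apply: contraTneq (tj isT) => ->; rewrite /turn /cross mulrC subrr ltxx.
      by [].
    (* A later w_j would lie behind w_(i+1) on that line, and the turn from w_(i+1) to it would be
       negative. *)
    case: (hy _ wjV wji); rewrite cross_shift far0 ?ltxx // => -[_ dneg].
    have E := dot_cross (w i.+1 - w i) (w j - w i.+1) (v - w i.+1).
    rewrite turn_cross !cross_shift far0 mul0r subr0 turn_cross in E.
    have : 0 < dot (w i.+1 - w i) (w i.+1 - w i) * turn (w i.+1) (w j).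
      by rewrite mulr_gt0 ?tj // (dot_gt0 dneg).
    by rewrite E nmulr_rgt0 // ltNge (ltW txy).
- by move=> i ir; have [] := h1 i ir.
- move=> u uV; apply/coneP; split.
  + by rewrite /ray det3_hom; exact: p_turn.
  + by rewrite /ray det3_hom; exact: h3.
  + move=> i ir; rewrite farE det3_hom -cross_shift.
    by have [_ hi _] := h2 i ir; apply: pivot_cross.
Qed.

End GiftWrapping.

End PlaneVectors.

Local Open Scope classical_set_scope.

(** For the direction (0, -1) [half] is lexicographic positivity, so v is the lexicographically
    least vertex. *)
Lemma exists_pivot (V : seq vec) : V != [::] -> exists2 v, v \in V & pivot V (0, -1) v.
Proof.
elim: V => // a [_ _|b s IH _].
  by exists a => [|x]; rewrite ?mem_head // inE => /eqP ->; rewrite eqxx.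
have [//|v vs hv] := IH.
have lex (z : vec) : half (0, -1) z <-> 0 < z.1 \/ z.1 = 0 /\ 0 < z.2.
  by rewrite /half /cross /dot /= !mul0r !mulN1r; lia.
have B1 (x y : vec) : (x - y).1 = x.1 - y.1 by case: x y => [? ?] [].
have B2 (x y : vec) : (x - y).2 = x.2 - y.2 by case: x y => [? ?] [].
have [/lex va|nva] := pselect (half (0, -1) (v - a)).
  exists a => [|x]; first exact: mem_head.
  rewrite in_cons => /orP[/eqP ->|xs _]; first by rewrite eqxx.
  apply/lex; rewrite B1 B2; have [->|xv] := eqVneq x v; first by rewrite -B1 -B2.
  by have /lex := hv x xs xv; move: va; rewrite !B1 !B2; lia.
exists v => [|x]; first by rewrite in_cons vs orbT.
rewrite in_cons => /orP[/eqP -> av|xs]; last exact: hv.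
apply/lex; rewrite B1 B2; have : ~ (0 < (v - a).1 \/ (v - a).1 = 0 /\ 0 < (v - a).2).
  by move=> /lex.
have : a.1 <> v.1 \/ a.2 <> v.2.
  case: (a =P v) => [E|ne]; first by rewrite E eqxx in av.
  have [e1|] := eqVneq a.1 v.1; last by move/eqP; left.
  right => e2; apply: ne; move: e1 e2; case: (a) (v) => [? ?] [? ?] /= -> ->.
  by [].
by rewrite !B1 !B2; move: (a.1) (v.1) (a.2) (v.2) => a1 v1 a2 v2; clear; lia.
Qed.

(** * Real points and convex hulls *)

Section RealPolygon.
Variable R : realType.
Implicit Types (x y : R * R) (p q c : pt3).

(** The form [det3 p q] at the real point with homogeneous coordinates (x, t). *)
Definition rdet p q x (t : R) : R :=
  (p.1.2 * q.2 - p.2 * q.1.2)%:~R * x.1 + (p.2 * q.1.1 - p.1.1 * q.2)%:~R * x.2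
  + (p.1.1 * q.1.2 - p.1.2 * q.1.1)%:~R * t.

Lemma rdetE p q c : rdet p q (c.1.1%:~R, c.1.2%:~R) c.2%:~R = (det3 p q c)%:~R.
Proof.
rewrite /rdet /det3 /= -!intrM -!intrD; congr (_%:~R); ring.
Qed.

Lemma rdet_hom p q (z : int * int) : rdet p q (lattice_pt R z) 1 = (det3 p q (hom z))%:~R.
Proof. by rewrite -rdetE. Qed.

Lemma rdet_lincomb p q n (t : 'I_n -> R) (P : 'I_n -> R * R) : \sum_i t i = 1 ->
  rdet p q (lincomb t P) 1 = \sum_i t i * rdet p q (P i) 1.
Proof.
move=> t1; rewrite /rdet /lincomb /=.
set A := (_ - _)%:~R; set A' := (_ - _)%:~R; set C := (_ - _)%:~R.
have E : C * 1 = \sum_i t i * (C * 1) by rewrite -mulr_suml t1 mul1r.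
rewrite {1}E !mulr_sumr -!big_split /=.
by apply: eq_bigr => i _; ring.
Qed.

Variables (v : pt3) (w : nat -> pt3) (r : nat).
Hypothesis vwr_fan : fan v w r.

Definition constraints : seq (pt3 * pt3) :=
  (v, w 0) :: (w r, v) :: [seq (w i, w i.+1) | i <- iota 0 r].

Lemma coneE c : cone v w r c <-> forall pq, pq \in constraints -> 0 <= det3 pq.1 pq.2 c.
Proof.
have E : det3 (w r) v c = - ray v w r c by rewrite /ray /det3; ring.
split=> [/coneP[h0 hr hf] pq|h].
  rewrite !in_cons => /or3P[/eqP ->|/eqP ->|/mapP[i]] //=.
    by rewrite E oppr_ge0.
  by rewrite mem_iota => ir -> /=; rewrite -farE; exact: hf.
apply/coneP; split.
- by apply: (h (v, w 0)); rewrite mem_head.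
- by rewrite -oppr_ge0 -E; apply: (h (w r, v)); rewrite !in_cons eqxx orbT.
- move=> i ir; rewrite farE; apply: (h (w i, w i.+1)); rewrite !in_cons.
  by apply/orP; right; apply/orP; right; apply/mapP; exists i; rewrite ?mem_iota.
Qed.

Definition fan_region : set (R * R) :=
  [set x | forall pq, pq \in constraints -> 0 <= rdet pq.1 pq.2 x 1].

Lemma rdet_cramer (a b e p q : pt3) x t :
  rdet a b x t * (det3 p q e)%:~R + rdet e a x t * (det3 p q b)%:~R
   + rdet b e x t * (det3 p q a)%:~R = (det3 a b e)%:~R * rdet p q x t.
Proof.
rewrite /rdet /det3 !(intrM, intrD, intrB); ring.
Qed.

(** The search for a sector, repeated over the reals; Cramer's rule then yields barycentric
    coordinates. *)
Lemma fan_region_triangle x : fan_region x -> exists i (l m n : R),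
  [/\ (i < r)%N, [/\ 0 <= l, 0 <= m & 0 <= n], l + m + n = 1,
    x.1 = l * v.1.1%:~R + m * (w i).1.1%:~R + n * (w i.+1).1.1%:~R &
    x.2 = l * v.1.2%:~R + m * (w i).1.2%:~R + n * (w i.+1).1.2%:~R].
Proof.
move=> hx; have r0 := fan_size vwr_fan.
pose i := find (fun i => rdet (w i.+1) v x 1 >= 0) (iota 0 r).
have hr : 0 <= rdet (w r) v x 1 by apply: (hx (w r, v)); rewrite !in_cons eqxx orbT.
have hs : has (fun i => rdet (w i.+1) v x 1 >= 0) (iota 0 r).
  by apply/hasP; exists r.-1; rewrite ?prednK // mem_iota; lia.
have ir : (i < r)%N by move: hs; rewrite has_find size_iota.
have hi1 : 0 <= rdet (w i.+1) v x 1.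
  by have := nth_find 0%N hs; rewrite -/i nth_iota.
have N p q : rdet p q x 1 = - rdet q p x 1.
  by rewrite /rdet !(intrM, intrD, intrB); ring.
have hi : 0 <= rdet v (w i) x 1.
  case: (posnP i) => [->|i0].
    by apply: (hx (v, w 0)); rewrite mem_head.
  have ip : (i.-1 < i)%N by rewrite prednK.
  have := @before_find _ 0%N (fun i => rdet (w i.+1) v x 1 >= 0) (iota 0 r) _ ip.
  rewrite nth_iota; last exact: ltn_trans ip ir.
  by rewrite add0n prednK // leNgt => /negbFE; rewrite N oppr_lt0 => /ltW.
have hf : 0 <= rdet (w i) (w i.+1) x 1.
  apply: (hx (w i, w i.+1)); rewrite !in_cons.
  by apply/orP; right; apply/orP; right; apply/mapP; exists i; rewrite ?mem_iota.
pose D : R := (det3 v (w i) (w i.+1))%:~R.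
have D0 : 0 < D by rewrite ltr0z; exact: (D_gt0 vwr_fan ir).
have cr p q := rdet_cramer v (w i) (w i.+1) p q x 1.
exists i, (rdet (w i) (w i.+1) x 1 / D), (rdet (w i.+1) v x 1 / D), (rdet v (w i) x 1 / D).
have E1 : D = rdet (w i) (w i.+1) x 1 + rdet (w i.+1) v x 1 + rdet v (w i) x 1.
  (* For unit vectors p and q the form [det3 p q] reads off one coordinate: the third here, the
     first and the second below. *)
  have := cr (1, 0, 0) (0, 1, 0).
  have F (z : pt3) : det3 (1, 0, 0) (0, 1, 0) z = z.2 by rewrite /det3 /=; ring.
  rewrite !F (fan_apex_degree vwr_fan) !(fan_degree vwr_fan) //; last exact: ltnW.
  have -> : rdet (1, 0, 0) (0, 1, 0) x 1 = 1 by rewrite /rdet /=; ring.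
  rewrite !mulr1 -/D => <-; ring.
have F1 (z : pt3) : det3 (0, 1, 0) (0, 0, 1) z = z.1.1 by rewrite /det3 /=; ring.
have F2 (z : pt3) : det3 (0, 0, 1) (1, 0, 0) z = z.1.2 by rewrite /det3 /=; ring.
have Dn0 : D != 0 by rewrite gt_eqF.
split=> //.
- by split; apply: divr_ge0 => //; exact: ltW.
- by rewrite -!mulrDl -E1 divff.
- have := cr (0, 1, 0) (0, 0, 1); rewrite !F1 -/D => E.
  have -> : x.1 = (D * rdet (0, 1, 0) (0, 0, 1) x 1) / D.
    by rewrite mulrC mulKf // /rdet /=; ring.
  rewrite -E; ring.
- have := cr (0, 0, 1) (1, 0, 0); rewrite !F2 -/D => E.
  have -> : x.2 = (D * rdet (0, 0, 1) (1, 0, 0) x 1) / D.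
    by rewrite mulrC mulKf // /rdet /=; ring.
  rewrite -E; ring.
Qed.

End RealPolygon.
Arguments fan_region R v w r : clear implicits.

Section ConvexHulls.
Variable R : realType.

Lemma rdet_convex_hull_ge0 (A : set (R * R)) p q :
  (forall x, A x -> 0 <= rdet p q x 1) ->
  forall x, convex_hull A x -> 0 <= rdet p q x 1.
Proof.
move=> hA x [n [t [P [AP t0 t1 ->]]]]; rewrite rdet_lincomb //.
by apply: sumr_ge0 => i _; rewrite mulr_ge0 // hA.
Qed.

Lemma convex_hull3 (A : set (R * R)) a b c (l m n : R) x : A a -> A b -> A c ->
  0 <= l -> 0 <= m -> 0 <= n -> l + m + n = 1 ->
  x.1 = l * a.1 + m * b.1 + n * c.1 -> x.2 = l * a.2 + m * b.2 + n * c.2 ->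
  convex_hull A x.
Proof.
move=> Aa Ab Ac l0 m0 n0 s1 e1 e2.
exists 3%N, (fun i : 'I_3 => [:: l; m; n]`_i), (fun i : 'I_3 => nth a [:: a; b; c] i).
split.
- by case=> -[|[|[|//]]].
- by case=> -[|[|[|//]]].
- by rewrite !big_ord_recl big_ord0 /= addr0 addrA.
- case: x e1 e2 => x1 x2 /= -> ->; rewrite /lincomb !big_ord_recl !big_ord0 /=.
  by rewrite !addr0 !addrA.
Qed.

Lemma affine_form_hull (A : set (R * R)) (al be ga : R) :
  (forall x, A x -> al * x.1 + be * x.2 + ga = 0) ->
  forall x, affine_hull A x -> al * x.1 + be * x.2 + ga = 0.
Proof.
move=> hA x [n [t [P [AP t1 ->]]]]; rewrite /lincomb /=.
have -> : ga = \sum_i t i * ga by rewrite -mulr_suml t1 mul1r.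
rewrite !mulr_sumr -!big_split /= big1 // => i _.
have -> : al * (t i * (P i).1) + be * (t i * (P i).2) + t i * ga =
  t i * (al * (P i).1 + be * (P i).2 + ga) by ring.
by rewrite hA // mulr0.
Qed.

Lemma affine_form_convex_hull (A : set (R * R)) (al be ga : R) :
  (forall x, A x -> al * x.1 + be * x.2 + ga = 0) ->
  forall x, convex_hull A x -> al * x.1 + be * x.2 + ga = 0.
Proof.
move=> hA x [n [t [P [AP _ t1 xE]]]]; apply: (affine_form_hull hA).
by exists n, t, P; split.
Qed.

Lemma two_dimensional_form (A : set (R * R)) (al be ga : R) :
  two_dimensional (convex_hull A) ->
  (forall x, A x -> al * x.1 + be * x.2 + ga = 0) -> al = 0 /\ be = 0.
Proof.
move=> dimA hA.
have h x : al * x.1 + be * x.2 + ga = 0.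
  apply: (affine_form_hull (affine_form_convex_hull hA)).
  by move: dimA; rewrite /two_dimensional => ->.
have := h (0, 0); have := h (1, 0); have := h (0, 1).
by rewrite /= !mulr0 !mulr1 !add0r addr0 => h1 h2 h3; split; lra.
Qed.

End ConvexHulls.

Section PolygonFan.
Variables (R : realType) (Delta : set (R * R)).
Hypotheses (polyD : lattice_polygon Delta) (dimD : two_dimensional Delta).

Lemma polygon_fan : exists (v : vec) (w : nat -> vec) (r : nat),
  fan (hom v) (fun i => hom (w i)) r /\
  Delta = fan_region R (hom v) (fun i => hom (w i)) r.
Proof.
have [V0 /finite_seqP[V VE] DE] := polyD.
have VP z : V0 z <-> z \in V by rewrite VE.
have dimV := dimD; rewrite DE in dimV.
have nonempty : V != [::].
  apply/eqP => Vnil; have := @two_dimensional_form R _ 1 0 0 dimV.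
  case=> [x [z /VP]|/eqP]; first by rewrite Vnil.
  by rewrite oner_eq0.
have [v vV v_pivot] := exists_pivot nonempty.
have noncol : exists x y z, [/\ x \in V, y \in V, z \in V & cross (y - x) (z - x) != 0].
  (* If all vertices were collinear, an affine form would vanish on them: that of the line through v
     and another vertex, or, if v is the only vertex, that of the vertical line through it. *)
  apply: contrapT => /forallNP h.
  have col y z : y \in V -> z \in V -> cross (y - v) (z - v) = 0.
    move=> yV zV; apply/eqP/negPn/negP => ne; apply: (h v).
    by exists y, z; split.
  have [[u [uV uv]]|all_v] := pselect (exists u, u \in V /\ u != v).
    have crossE z : (cross (u - v) (z - v))%:~R = (- (u.2 - v.2)%:~R) * (lattice_pt R z).1
        + (u.1 - v.1)%:~R * (lattice_pt R z).2 +
        ((u.2 - v.2)%:~R * v.1%:~R - (u.1 - v.1)%:~R * v.2%:~R) :> R.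
      case: u z {uV uv} => [a b] [a' b']; rewrite /cross /lattice_pt /=; case: (v) => [s t] /=.
      by rewrite !(intrM, intrD, intrB); ring.
    have [x [z /VP zV <-]|e1 e2] := two_dimensional_form (al := - (u.2 - v.2)%:~R)
       (be := (u.1 - v.1)%:~R)
       (ga := (u.2 - v.2)%:~R * v.1%:~R - (u.1 - v.1)%:~R * v.2%:~R) dimV.
      by rewrite -crossE col.
    move: uv e1 e2; case: (u) (v) => [a b] [s t] /= uv.
    move=> /eqP; rewrite oppr_eq0 intr_eq0 subr_eq0 => /eqP bt /eqP.
    by rewrite intr_eq0 subr_eq0 => /eqP as'; rewrite bt as' eqxx in uv.
  have [x [z /VP zV <-]|/eqP] := two_dimensional_form (al := 1)
       (be := 0) (ga := - v.1%:~R) dimV.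
    have -> : z = v by apply/eqP/negPn/negP => zv; apply: all_v; exists z.
    by rewrite /lattice_pt /=; ring.
  by rewrite oner_eq0.
have [w [r [vwr wV Vcone]]] := pivot_fan vV v_pivot noncol.
exists v, w, r; split=> //; rewrite DE; apply/seteqP; split=> x.
  move=> hx pq pqc; apply: rdet_convex_hull_ge0 hx => y [z /VP zV <-].
  rewrite rdet_hom ler0z; have /coneE := Vcone z zV; exact.
move=> /(fan_region_triangle vwr)[i [l [m [n [ir [l0 m0 n0] s1 e1 e2]]]]].
apply: (@convex_hull3 R _ (lattice_pt R v) (lattice_pt R (w i)) (lattice_pt R (w i.+1)) l m n) => //.
- by exists v => //; apply/VP.
- by exists (w i) => //; apply/VP/wV; exact: ltnW.
- by exists (w i.+1) => //; apply/VP/wV.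
Qed.

End PolygonFan.

Section LatticePoints.
Variables (R : realType) (Delta : set (R * R)).
Variables (v : vec) (w : nat -> vec) (r : nat).
Local Notation hv := (hom v).
Local Notation hw := (fun i => hom (w i)).
Hypotheses (vwr_fan : fan hv hw r) (DE : Delta = fan_region R hv hw r).

Lemma fan_region_lattice z : fan_region R hv hw r (lattice_pt R z) <-> cone hv hw r (hom z).
Proof.
rewrite coneE; split=> h pq pqc; have := h pq pqc; by rewrite rdet_hom ler0z.
Qed.

(** B bounds the coordinates of the corners, and a point of the polygon lies in a triangle of
    corners, on which linear forms inherit the bound. *)
Lemma fan_bound : exists B : nat, [/\ fits B hv, forall i, (i <= r)%N -> fits B (hw i) &
  forall z, cone hv hw r (hom z) -> `|z.1| <= B%:Z /\ `|z.2| <= B%:Z].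
Proof.
pose f (z : vec) := (absz z.1 + absz z.2)%N.
pose B := (f v + \sum_(i < r.+1) f (w i))%N.
have vB : (f v <= B)%N by exact: leq_addr.
have wB i : (i <= r)%N -> (f (w i) <= B)%N.
  move=> ir; apply: leq_trans (leq_addl _ _).
  by rewrite (bigD1 (Ordinal (ir : (i < r.+1)%N))) //= leq_addr.
have bnd z : (f z <= B)%N -> [/\ `|z.1| <= B%:Z, `|z.2| <= B%:Z & fits B (hom z)].
  by rewrite /f => h; split; [lia|lia|split=> /=; lia].
have vb := bnd _ vB; have wb i ir := bnd _ (wB i ir).
exists B; split; [by case: vb|by move=> i /wb[]|move=> z cz].
have [ir hi] := cone_sector vwr_fan cz; set i := sector _ _ _ _ in ir hi.
have ri := in_sector_ray_ge0 hi; have /and3P[fi ri1 _] := hi.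
have hc : in_cone_of hv (hw i) (hw i.+1) (hom z).
  apply: in_cone_of_det; [exact: (D_gt0 vwr_fan ir)|exact: fi| |exact: ri].
  by rewrite det3_swap oppr_ge0.
have E1 p : det3 (0, 1, 0) (- B%:Z, 0, -1) p = B%:Z * p.2 - p.1.1 by rewrite /det3 /=; ring.
have E2 p : det3 (1, 0, 0) (0, B%:Z, 1) p = B%:Z * p.2 - p.1.2 by rewrite /det3 /=; ring.
have [a1 a2 va] := vb; have [b1 b2 wa] := wb i (ltnW ir); have [c1 c2 wa'] := wb i.+1 ir.
have [/= f1 f2 _] := in_cone_of_fits hc va wa wa'.
have := hc (0, 1, 0) (- B%:Z, 0, -1); have := hc (1, 0, 0) (0, B%:Z, 1).
rewrite !E1 !E2 /= !mulr1 !subr_ge0.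
have le z' (t : vec -> int) : `|t z'| <= B%:Z -> t z' <= B%:Z by apply: le_trans; exact: ler_norm.
move=> /(_ (le _ snd a2) (le _ snd b2) (le _ snd c2)) g2.
move=> /(_ (le _ fst a1) (le _ fst b1) (le _ fst c1)) g1.
rewrite mulr1 in f1 f2.
by split; rewrite ler_norml ?g1 ?g2 andbT -subr_ge0 opprK.
Qed.

Lemma finite_lattice_points : finite_set (@lattice_pt R @^-1` Delta).
Proof.
have [B [_ _ hB]] := fan_bound.
pose s : seq vec := [seq (i%:Z - B%:Z, j%:Z - B%:Z) | i <- iota 0 (2 * B).+1, j <- iota 0 (2 * B).+1].
apply: (@sub_finite_set _ _ [set` s]); last exact: finite_seq.
move=> z; rewrite /preimage /= DE => /fan_region_lattice /hB[h1 h2].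
apply/allpairsP; exists (absz (z.1 + B%:Z), absz (z.2 + B%:Z)); split.
- by rewrite mem_iota /=; lia.
- by rewrite mem_iota /=; lia.
- by case: z h1 h2 => z1 z2 /= h1 h2; congr pair; lia.
Qed.

Lemma mem_lattice_points z : (z \in lattice_points Delta) = cone hv hw r (hom z).
Proof.
rewrite /lattice_points in_fset_set; last exact: finite_lattice_points.
apply/idP/idP => [|h]; rewrite inE /preimage /= DE; first by move/fan_region_lattice.
by apply/fan_region_lattice.
Qed.

Lemma polygon_toric_points : exists B : nat,
  toric_points hv hw r B (fun i : 'I_(npoints Delta) => hom (lpoint i)).
Proof.
have [B [vB wB _]] := fan_bound; exists B.
have hom_inj : injective hom by move=> [a b] [c d] [-> ->].
have mem_lpoint (i : 'I_(npoints Delta)) : lpoint i \in lattice_points Delta.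
  by apply: mem_nth; exact: ltn_ord.
split=> //.
- move=> i j /hom_inj /eqP; rewrite /lpoint nth_uniq ?ltn_ord ?fset_uniq //.
  by move=> /eqP /val_inj.
- by move=> i; rewrite -mem_lattice_points.
- move=> [[a b] d] pc /= d1; rewrite d1 in pc *.
  have zD : (a, b) \in lattice_points Delta by rewrite mem_lattice_points.
  have iN : (index (a, b) (enum_fset (lattice_points Delta)) < npoints Delta)%N.
    by rewrite index_mem.
  by exists (Ordinal iN); rewrite /lpoint /= nth_index.
Qed.

End LatticePoints.

(** * Volume *)

Section Squares.
Variable R : realType.
Notation area := ((@lebesgue_measure R \x @lebesgue_measure R)%E).

(** Half-open, so that distinct squares are disjoint and their areas add up. *)
Definition lattice_square (D : nat) (z : vec) : set (R * R) :=
  [set` `[z.1%:~R / D%:R, (z.1 + 1)%:~R / D%:R[%R] `*`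
  [set` `[z.2%:~R / D%:R, (z.2 + 1)%:~R / D%:R[%R].

Lemma measurable_lattice_square D z : measurable (lattice_square D z).
Proof. by apply: measurableX; exact: measurable_itv. Qed.

Lemma area_lattice_square D z : (0 < D)%N ->
  area (lattice_square D z) = (D%:R ^- 2)%:E.
Proof.
move=> D0; have D1 : 0 < D%:R :> R by rewrite ltr0n.
rewrite /lattice_square product_measure1E; try exact: measurable_itv.
have E (y : int) : lebesgue_measure [set` `[y%:~R / D%:R, (y + 1)%:~R / D%:R[%R] =
    (D%:R^-1 : R)%:E.
  rewrite lebesgue_measure_itv /= lte_fin ltr_pM2r ?invr_gt0 // ltr_int ltrDl ltr01.
  by rewrite -EFinD -mulrBl -intrB addrAC subrr add0r mul1r.
by rewrite [X in (X * _)%E]E [X in (_ * X)%E]E -EFinM -invfM -expr2.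
Qed.

Lemma mem_lattice_square D z (x : R * R) : (0 < D)%N -> lattice_square D z x <->
  [/\ z.1%:~R <= D%:R * x.1 < (z.1 + 1)%:~R & z.2%:~R <= D%:R * x.2 < (z.2 + 1)%:~R].
Proof.
move=> D0; have D1 : 0 < D%:R :> R by rewrite ltr0n.
rewrite /lattice_square /=; split.
  by case; rewrite /= !in_itv /= !ler_pdivrMr // !ltr_pdivlMr // ![_ * D%:R]mulrC.
by move=> [h1 h2]; split; rewrite /= !in_itv /= !ler_pdivrMr // !ltr_pdivlMr // ![_ * D%:R]mulrC.
Qed.

Lemma lattice_square_inj D z z' (x : R * R) : (0 < D)%N ->
  lattice_square D z x -> lattice_square D z' x -> z = z'.
Proof.
move=> D0 /(mem_lattice_square _ _ D0)[a b] /(mem_lattice_square _ _ D0)[a' b'].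
have E (y y' : int) (t : R) : y%:~R <= t < (y + 1)%:~R -> y'%:~R <= t < (y' + 1)%:~R -> y = y'.
  move=> /andP[h1 h2] /andP[h3 h4].
  have := le_lt_trans h1 h4; have := le_lt_trans h3 h2; rewrite !ltr_int !ltzD1 => yy' y'y.
  by apply/eqP; rewrite eq_le yy' y'y.
by case: z z' a b a' b' => [? ?] [? ?] /= a b a' b'; rewrite (E _ _ _ a a') (E _ _ _ b b').
Qed.

Lemma measurable_lattice_squares D (s : seq vec) :
  measurable (\big[setU/set0]_(z <- s) lattice_square D z).
Proof. by apply: bigsetU_measurable => z _; exact: measurable_lattice_square. Qed.

Lemma area_lattice_squares D (s : seq vec) : (0 < D)%N -> uniq s ->
  area (\big[setU/set0]_(z <- s) lattice_square D z) = ((size s)%:R / D%:R ^+ 2)%:E.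
Proof.
move=> D0; elim: s => [_|z s IH /= /andP[zs us]].
  by rewrite big_nil measure0 mul0r.
rewrite big_cons measureU.
- rewrite [X in (X + _)%E]area_lattice_square // [X in (_ + X)%E]IH // -EFinD.
  by congr EFin; rewrite -natr1 mulrDl mul1r addrC.
- exact: measurable_lattice_square.
- exact: measurable_lattice_squares.
- apply/seteqP; split=> // x [xz]; rewrite -bigcup_seq => -[z' z's xz'].
  by move: zs; rewrite (lattice_square_inj D0 xz xz') z's.
Qed.

End Squares.

Lemma det3_natmul p q c n : det3 p q (c *+ n) = det3 p q c * n%:Z.
Proof. by have [E1 E2 E3] := pt3_natmul c n; rewrite /det3 E1 E2 E3; ring. Qed.

Section Volume.
Variables (R : realType) (N : nat) (v : pt3) (w : nat -> pt3) (r B : nat).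
Variable a : 'I_N -> pt3.
Hypothesis toric_a : toric_points v w r B a.
Let vwr_fan := tp_fan toric_a.
Local Notation area := ((@lebesgue_measure R \x @lebesgue_measure R)%E).
Local Notation region := (fan_region R v w r).
Local Notation H := (hilbert_function B a).

(* A bound for the variation of [det3 p q] on a unit square. *)
Definition slope (p q : pt3) : int :=
  `|p.1.2 * q.2 - p.2 * q.1.2| + `|p.2 * q.1.1 - p.1.1 * q.2|.

(** The sum of three corners is positive on every edge form. A large multiple o of it lies so deep
    in the cone that every point within a unit square of a point of the cone translated by o is
    still in the cone. *)
Lemma exists_center : exists o : pt3, 0 <= o.2 /\
  forall pq, pq \in constraints v w r -> slope pq.1 pq.2 <= det3 pq.1 pq.2 o.
Proof.
have r0 := fan_size vwr_fan.
pose u := v + w 0 + w 1; have [_ _ E] := pt3_lin (v + w 0) (w 1).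
have [_ _ E'] := pt3_lin v (w 0).
pose K := (\sum_(pq <- constraints v w r) absz (slope pq.1 pq.2))%N.
exists (u *+ K); split.
  have [_ _ ->] := pt3_natmul u K; rewrite E E' (fan_apex_degree vwr_fan).
  by rewrite !(fan_degree vwr_fan).
move=> pq pqc.
have u_gt0 : 1 <= det3 pq.1 pq.2 u.
  have pos : 0 < det3 pq.1 pq.2 u; last by lia.
  move: pqc; rewrite /u !det3D !in_cons => /or3P[/eqP ->|/eqP ->|/mapP[i]] /=.
  - rewrite -!/(ray _ _ _ _) ray_v ray_self !add0r; exact: (D_gt0 vwr_fan r0).
  - have F p : det3 (w r) v p = - ray v w r p by rewrite /ray /det3; ring.
    rewrite !F ray_v oppr0 add0r; have := ray_ge vwr_fan r0 (leqnn r).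
    have F' : ray v w r (w 0) = - ray v w 0 (w r) by rewrite /ray det3_swap.
    rewrite F'; have := @fan_ray _ _ _ vwr_fan 0%N r; rewrite r0 leqnn => /(_ isT); lia.
  - rewrite mem_iota => /andP[_ ir] -> /=; rewrite -!farE far_v.
    have := D_gt0 vwr_fan ir; have := @fan_far _ _ _ vwr_fan i 0%N ir (leq0n _).
    have := @fan_far _ _ _ vwr_fan i 1%N ir r0; lia.
rewrite det3_natmul; have slopeK : slope pq.1 pq.2 <= K%:Z.
  have s0 : 0 <= slope pq.1 pq.2 by rewrite addr_ge0.
  rewrite -(gez0_abs s0) lez_nat /K (big_rem pq) //=; exact: leq_addr.
apply: le_trans slopeK _; rewrite -[leLHS]mul1r; exact: ler_wpM2r.
Qed.

Lemma rdet_unit_box (p q : pt3) (s t : R) (D : int) : `|s| <= 1 -> `|t| <= 1 ->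
  slope p q <= D -> 0 <= D%:~R +
    (p.1.2 * q.2 - p.2 * q.1.2)%:~R * s + (p.2 * q.1.1 - p.1.1 * q.2)%:~R * t.
Proof.
move=> s1 t1; rewrite /slope; set A := _ - _; set A' := _ - _; rewrite -(ler_int R) intrD.
rewrite !intr_norm => h.
have bnd (x y : R) : `|y| <= 1 -> - `|x| <= x * y.
  move=> y1; have : `|x * y| <= `|x| by rewrite normrM ler_piMr.
  by rewrite ler_norml => /andP[].
have := bnd A%:~R s s1; have := bnd A'%:~R t t1; lra.
Qed.

Lemma rdet_homogeneous p q (x : R * R) (D : R) :
  rdet p q (D * x.1, D * x.2) D = D * rdet p q x 1.
Proof. by rewrite /rdet /=; ring. Qed.

Lemma rdet_translate p q (c o : pt3) (s t : R) :
  rdet p q ((c + o)%R.1.1%:~R + s, (c + o)%R.1.2%:~R + t) (c + o)%R.2%:~R =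
  (det3 p q c)%:~R + ((det3 p q o)%:~R +
  (p.1.2 * q.2 - p.2 * q.1.2)%:~R * s + (p.2 * q.1.1 - p.1.1 * q.2)%:~R * t).
Proof.
have [-> -> ->] := pt3_lin c o.
by rewrite /rdet /det3 /= !(intrM, intrD, intrB); ring.
Qed.

Lemma measurable_fan_region : measurable region.
Proof.
have -> : region = \bigcap_(pq in [set` constraints v w r])
    [set x | 0 <= rdet pq.1 pq.2 x 1].
  by apply/seteqP; split=> x h pq; [exact: h|move=> pqc; exact: h].
apply: fin_bigcap_measurable; first exact: finite_seq.
move=> pq _; rewrite -[X in measurable X]setTI.
have -> : [set x : R * R | 0 <= rdet pq.1 pq.2 x 1] =
  (fun x => rdet pq.1 pq.2 x 1) @^-1` [set` `[0, +oo[%R].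
  by apply/seteqP; split=> x /=; rewrite in_itv /= andbT.
have : measurable_fun setT (fun x : R * R => rdet pq.1 pq.2 x 1).
  apply: measurable_funD => //; apply: measurable_funD; apply: measurable_funM => //.
by move=> h; apply: h => //; exact: measurable_itv.
Qed.

Definition height_points d := map (monomial_point B) (height_monomials B a d).

Lemma height_points_uniq d : uniq (height_points d).
Proof.
by rewrite map_inj_uniq ?height_monomials_uniq //; exact: monomial_point_inj.
Qed.

Lemma mem_height_points d p :
  (p \in height_points d) = cone v w r p && (p.2 == d%:Z).
Proof.
apply/mapP/andP => [[c]|[cp /eqP pd]].
  rewrite (mem_height_monomials toric_a) => /andP[Cc /eqP hc] ->; split=> //.
  by apply/eqP; rewrite -hc.
have fp : fits B p.
  exact: (cone_fits vwr_fan (tp_apex_fits toric_a) (tp_fits toric_a) cp).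
exists (point_monomial B p); last by rewrite point_monomialK.
rewrite (mem_height_monomials toric_a) /cone_monomial point_monomialK // cp /=.
by rewrite /monomial_height; have [_ _ ->] := point_monomialE B p; rewrite pd.
Qed.

(** Translated by o, each lattice point of the cone at height d carries a unit square inside the
    cone at height d + c0; scaled down, these are disjoint squares in the polygon. *)
Lemma area_lower c0 o : o.2 = c0%:Z ->
  (forall pq, pq \in constraints v w r -> slope pq.1 pq.2 <= det3 pq.1 pq.2 o) ->
  forall d, (0 < d + c0)%N -> (((H d)%:R / (d + c0)%:R ^+ 2)%:E <= area region)%E.
Proof.
move=> oc ho d D0; set D := (d + c0)%N in D0 *; have D1 : 0 < D%:R :> R by rewrite ltr0n.
pose f (p : pt3) : vec := (p.1.1 + o.1.1, p.1.2 + o.1.2).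
pose s := [seq f p | p <- height_points d].
have us : uniq s.
  rewrite map_inj_in_uniq ?height_points_uniq // => p q.
  rewrite !mem_height_points => /andP[_ /eqP pd] /andP[_ /eqP qd] [].
  by move=> /addIr E1 /addIr E2; apply: pt3_ext => //; rewrite pd qd.
have <- : size s = H d by rewrite !size_map.
rewrite -area_lattice_squares //; apply: le_measure; rewrite ?inE.
- exact: measurable_lattice_squares.
- exact: measurable_fan_region.
rewrite -bigcup_seq => x [z /mapP[p]]; rewrite mem_height_points => /andP[cp /eqP pd] ->.
have [g1 g2 g3] := pt3_lin p o.
move=> /(mem_lattice_square _ _ D0)[]; rewrite /f /= -g1 -g2 => h1 h2 pq pqc.
rewrite -(pmulr_rge0 _ D1) -rdet_homogeneous.
set c1 := (p + o).1.1 in h1 *; set c2 := (p + o).1.2 in h2 *.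
have -> : (D%:R * x.1, D%:R * x.2) = (c1%:~R + (D%:R * x.1 - c1%:~R),
   c2%:~R + (D%:R * x.2 - c2%:~R)) by congr pair; ring.
have DE : D%:R = (p + o).2%:~R :> R by rewrite g3 pd oc -PoszD.
rewrite [X in rdet _ _ _ X]DE rdet_translate addr_ge0 //; first by rewrite ler0z; have /coneE := cp; exact.
rewrite intrD in h1; rewrite intrD in h2; case/andP: h1 => h1 h1'; case/andP: h2 => h2 h2'.
by apply: rdet_unit_box; rewrite ?ho // ler_norml; apply/andP; split; lra.
Qed.

(** For x in the polygon the lower left corner of the unit square around d x, translated by o, is in
    the cone at height d + c0; hence that many squares of side 1 / d cover the polygon. *)
Lemma area_upper c0 o : o.2 = c0%:Z ->
  (forall pq, pq \in constraints v w r -> slope pq.1 pq.2 <= det3 pq.1 pq.2 o) ->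
  forall d, (0 < d)%N -> (area region <= ((H (d + c0))%:R / d%:R ^+ 2)%:E)%E.
Proof.
move=> oc ho d D0; have D1 : 0 < d%:R :> R by rewrite ltr0n.
pose f (p : pt3) : vec := (p.1.1 - o.1.1, p.1.2 - o.1.2).
pose s := [seq f p | p <- height_points (d + c0)].
have us : uniq s.
  rewrite map_inj_in_uniq ?height_points_uniq // => p q.
  rewrite !mem_height_points => /andP[_ /eqP pd] /andP[_ /eqP qd] [].
  by move=> /addIr E1 /addIr E2; apply: pt3_ext => //; rewrite pd qd.
have <- : size s = H (d + c0) by rewrite !size_map.
rewrite -area_lattice_squares //; apply: le_measure; rewrite ?inE.
- exact: measurable_fan_region.
- exact: measurable_lattice_squares.
rewrite -bigcup_seq => x hx.
pose c : pt3 := (Num.floor (d%:R * x.1), Num.floor (d%:R * x.2), d%:Z).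
have F (y : R) : (Num.floor y)%:~R <= y < (Num.floor y + 1)%:~R := floor_itv y.
have [g1 g2 g3] := pt3_lin c o.
exists (c.1.1, c.1.2); last by apply/(mem_lattice_square _ _ D0); split; exact: F.
apply/mapP; exists (c + o); last by rewrite /f g1 g2 !addrK.
rewrite mem_height_points g3 oc eqxx andbT; apply/coneE => pq pqc.
rewrite -(ler_int R) -rdetE.
have -> : ((c + o).1.1%:~R, (c + o).1.2%:~R) = ((c + o).1.1%:~R + 0, (c + o).1.2%:~R + 0) :> R * R.
  by rewrite !addr0.
rewrite rdet_translate !mulr0 !addr0 -rdetE.
have hdx : 0 <= rdet pq.1 pq.2 (d%:R * x.1, d%:R * x.2) d%:R.
  by rewrite rdet_homogeneous pmulr_rge0 //; exact: hx.
have /andP[a1 a2] := F (d%:R * x.1); have /andP[b1 b2] := F (d%:R * x.2).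
rewrite !intrD in a2 b2.
have := @rdet_unit_box pq.1 pq.2 (c.1.1%:~R - d%:R * x.1) (c.1.2%:~R - d%:R * x.2) _.
have -> : rdet pq.1 pq.2 (c.1.1%:~R, c.1.2%:~R) c.2%:~R =
    rdet pq.1 pq.2 (d%:R * x.1, d%:R * x.2) d%:R +
    ((pq.1.1.2 * pq.2.2 - pq.1.2 * pq.2.1.2)%:~R * (c.1.1%:~R - d%:R * x.1) +
    (pq.1.2 * pq.2.1.1 - pq.1.1.1 * pq.2.2)%:~R * (c.1.2%:~R - d%:R * x.2)).
  by rewrite /rdet /=; ring.
have u1 : `|c.1.1%:~R - d%:R * x.1| <= 1 by rewrite ler_norml; apply/andP; split; rewrite /=; lra.
have u2 : `|c.1.2%:~R - d%:R * x.2| <= 1 by rewrite ler_norml; apply/andP; split; rewrite /=; lra.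
move=> /(_ _ u1 u2 (ho _ pqc)); lra.
Qed.

Lemma area_squeeze : exists c0 : nat, forall d, (0 < d)%N ->
  (H d)%:R <= (d + c0)%:R ^+ 2 * vol region /\
  d%:R ^+ 2 * vol region <= (H (d + c0))%:R.
Proof.
have [u [u0 hu]] := exists_center; exists (absz u.2) => d d0.
have u2E : u.2 = (absz u.2)%:Z by rewrite gez0_abs.
have dc : (0 < d + absz u.2)%N by rewrite addn_gt0 d0.
have area_ge := area_lower u2E hu dc; have area_le := area_upper u2E hu d0.
have area_fin : area region \is a fin_num.
  rewrite ge0_fin_numE ?measure_ge0 //; exact: le_lt_trans area_le (ltry _).
move: area_ge area_le; rewrite -(fineK area_fin) !lee_fin => area_ge area_le.
rewrite ler_pdivrMr ?exprn_gt0 ?ltr0n // in area_ge.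
rewrite ler_pdivlMr ?exprn_gt0 ?ltr0n // in area_le.
by rewrite /vol; split; rewrite mulrC.
Qed.

End Volume.

Lemma quadratic_le_linear (R : realType) (x y z : R) :
  (forall d : nat, (0 < d)%N -> x * d%:R ^+ 2 <= y * d%:R + z) -> x <= 0.
Proof.
move=> h; rewrite leNgt; apply/negP => x0.
pose d := (Num.bound ((`|y| + `|z|) / x)).+1.
have d1 : 1 <= d%:R :> R by rewrite ler1n.
have yz0 : 0 <= `|y| + `|z| by rewrite addr_ge0.
have hd : `|y| + `|z| < x * d%:R.
  rewrite mulrC -ltr_pdivrMr //; apply: lt_le_trans (archi_boundP _) _.
    by rewrite divr_ge0 // ltW.
  by rewrite ler_nat.
have := h d isT; have hy := ler_norm y; have hz := ler_norm z.
have h1 : z <= `|z| * d%:R by apply: le_trans hz _; rewrite ler_peMr.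
have h2 : y * d%:R <= `|y| * d%:R by rewrite ler_wpM2r // (le_trans _ d1).
have h3 : (`|y| + `|z|) * d%:R < x * d%:R * d%:R by rewrite ltr_pM2r // (lt_le_trans _ d1).
rewrite expr2 mulrA; lra.
Qed.

Lemma squeeze_upper (R : realType) (L b V H c d : R) : 2 * H = L * (d + 2) ^+ 2 + b * (d + 2) + 2 ->
  H <= (d + c + 2) ^+ 2 * V ->
  (L - 2 * V) * d ^+ 2 <= (4 * V * (c + 2) - 4 * L - b) * d
     + (2 * V * (c + 2) ^+ 2 - 4 * L - 2 * b - 2).
Proof.
move=> E h; rewrite -subr_ge0.
have -> : (4 * V * (c + 2) - 4 * L - b) * d + (2 * V * (c + 2) ^+ 2 - 4 * L - 2 * b - 2)
   - (L - 2 * V) * d ^+ 2 = 2 * ((d + c + 2) ^+ 2 * V) - (L * (d + 2) ^+ 2 + b * (d + 2) + 2) by ring.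
by rewrite -E -mulrBr mulr_ge0 // subr_ge0.
Qed.

Lemma squeeze_lower (R : realType) (L b V H c d : R) :
  2 * H = L * (d + c + 2) ^+ 2 + b * (d + c + 2) + 2 ->
  (d + 2) ^+ 2 * V <= H ->
  (2 * V - L) * d ^+ 2 <= (2 * L * (c + 2) + b - 8 * V) * d
     + (L * (c + 2) ^+ 2 + b * (c + 2) + 2 - 8 * V).
Proof.
move=> E h; rewrite -subr_ge0.
have -> : (2 * L * (c + 2) + b - 8 * V) * d + (L * (c + 2) ^+ 2 + b * (c + 2) + 2 - 8 * V)
   - (2 * V - L) * d ^+ 2 = (L * (d + c + 2) ^+ 2 + b * (d + c + 2) + 2) - 2 * ((d + 2) ^+ 2 * V) by ring.
by rewrite -E -mulrBr mulr_ge0 // subr_ge0.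
Qed.

(** * The h-vector and the area *)

Section HVector.
Variables (n : nat) (v : pt3) (w : nat -> pt3) (r B : nat).
Variable a : 'I_n.+3 -> pt3.
Hypothesis toric_a : toric_points v w r B a.
Local Notation H := (hilbert_function B a).
Definition h2 := size (avoiding v w r B a 3 2).

Lemma difference_hilbert3 q : difference 3 (hilbert H) q =
  indicator 0 q + n%:Z * indicator 1 q + h2%:Z * indicator 2 q.
Proof.
have D0 := difference_avoiding toric_a 0; have D1 := difference_avoiding toric_a 1.
have E0 : difference 3 (hilbert H) 0 = 1.
  by rewrite !differenceS /difference /= (hilbert_function0 toric_a); lia.
have E1 : difference 3 (hilbert H) 1 = n%:Z.
  rewrite !differenceS /difference /= (hilbert_function0 toric_a) (hilbert_function1 toric_a); lia.
case: q => [[|[|[|d]]]|d]; rewrite /indicator /=.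
- by rewrite E0; lia.
- by rewrite E1; lia.
- by rewrite (difference_avoiding toric_a) /= /h2; lia.
- rewrite (difference_avoiding toric_a) /= avoiding_top //=; lia.
- by rewrite (difference_avoiding toric_a) /=; lia.
Qed.

Lemma hilbert_functionE d :
  (H d)%:Z = mono_count 2 d + n%:Z * mono_count 2 (d%:Z - 1) + h2%:Z * mono_count 2 (d%:Z - 2).
Proof.
pose f q := mono_count 2 q + n%:Z * mono_count 2 (q - 1) + h2%:Z * mono_count 2 (q - 2).
have : hilbert H =1 f; last by move=> /(_ d%:Z).
apply: (@difference_inj 3) => [q|q].
  by rewrite /f; case: q => // q _; rewrite /= !mulr0.
rewrite difference_hilbert3.
pose G (i : 'I_3) := fun q => [:: 1; n%:Z; h2%:Z]`_i * mono_count 2 (q - i%:Z).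
have := @difference_sum 3 _ (index_enum 'I_3) xpredT G q.
rewrite (@difference_ext _ _ f) => [->|x]; last first.
  by rewrite !big_ord_recl big_ord0 /G /f /= addr0 mul1r subr0 addrA.
rewrite !big_ord_recl big_ord0 /G !difference_scale !difference_shift /=.
rewrite !difference_mono_count /indicator subr0 addr0 mul1r addrA !subr_eq0.
by [].
Qed.

(** From degree 2 on all three arguments of [mono_count] are nonnegative, so each is a binomial
    coefficient. *)
Lemma hilbert_function_quadratic (R : realType) d : 2 * (H d.+2)%:R =
  (1 + n%:R + h2%:R) * d.+2%:R ^+ 2 + (3 + n%:R - h2%:R) * d.+2%:R + 2 :> R.
Proof.
have -> : H d.+2 = ('C(d.+2 + 2, d.+2) + n * 'C(d.+1 + 2, d.+1) + h2 * 'C(d + 2, d))%N.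
  apply/eqP; rewrite -eqz_nat hilbert_functionE !PoszD !PoszM.
  have -> : d.+2%:Z - 1 = d.+1%:Z by lia.
  by have -> : d.+2%:Z - 2 = d%:Z by lia.
have C2 m : 2 * 'C(m + 2, m)%:R = m.+2%:R * m.+1%:R :> R.
  rewrite -natrM -natrM; congr (_%:R); rewrite -bin_sub ?leq_addr // addKn addn2.
  by rewrite -mul_bin_diag bin1.
rewrite 2!natrD 2!natrM; have := C2 d.+2; have := C2 d.+1; have := C2 d.
move: 'C(d.+2 + 2, d.+2)%:R 'C(d.+1 + 2, d.+1)%:R 'C(d + 2, d)%:R => z y x ex ey ez.
have -> : 2 * (z + n%:R * y + h2%:R * x) = 2 * z + n%:R * (2 * y) + h2%:R * (2 * x) by ring.
by rewrite ex ey ez -!natr1; ring.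
Qed.

(** The counts of lattice points grow like d^2 times the area, while their quadratic coefficient is
    half the sum of the h-vector; the growth is compared in both directions. *)
Lemma hvector_volume (R : realType) :
  1 + n%:R + h2%:R = 2 * vol (fan_region R v w r).
Proof.
have [c hc] := area_squeeze R toric_a; set V := vol _ in hc *.
set L := _ + _; have c0 : 0 <= c%:R :> R by [].
have V0 : 0 <= V by rewrite fine_ge0 // measure_ge0.
pose b := 3 + n%:R - h2%:R : R; have HE d : 2 * (H d.+2)%:R = L * d.+2%:R ^+ 2 + b * d.+2%:R + 2.
  exact: hilbert_function_quadratic.
have N2 (d : nat) : d.+2%:R = d%:R + 2 :> R by rewrite -addn2 natrD.
apply/eqP; rewrite eq_le; apply/andP; split; rewrite -subr_le0.
  apply: (@quadratic_le_linear _ _ (4 * V * (c%:R + 2) - 4 * L - b)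
     (2 * V * (c%:R + 2) ^+ 2 - 4 * L - 2 * b - 2)) => d d0; have [h _] := hc d.+2 isT.
  by apply: squeeze_upper; rewrite -?N2 -?HE // -natrD -N2.
apply: (@quadratic_le_linear _ _ (2 * L * (c%:R + 2) + b - 8 * V)
     (L * (c%:R + 2) ^+ 2 + b * (c%:R + 2) + 2 - 8 * V)) => d d0; have [_ h] := hc d.+2 isT.
apply: (squeeze_lower (H := (H (d + c).+2)%:R)); last by rewrite -N2.
by rewrite -natrD -N2 HE.
Qed.
End HVector.

(** * The ideal of the torus closure in characteristic 0 *)

Section CharZero.
Variables (k : fieldType).
Hypothesis char_k : [pchar k] =i pred0.

(** In characteristic 0 the elements 1, 2, ..., [size p] are distinct and nonzero, which is more
    roots than a nonzero p can have. *)
Lemma poly_eq0_nonzero (p : {poly k}) : (forall t, t != 0 -> p.[t] = 0) -> p = 0.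
Proof.
move=> p0; apply/eqP/negPn/negP => pn0.
have /pcharf0P natr_eq0 := char_k.
pose s : seq k := [seq i.+1%:R | i <- iota 0 (size p)].
have us : uniq s.
  rewrite map_inj_uniq ?iota_uniq // => i j.
  wlog ij : i j / (i <= j)%N => [h|].
    by case: (leqP i j) => [/h|/ltnW /h h' /esym] //; move=> /h'.
  move=> /eqP; rewrite eq_sym -subr_eq0 -natrB // natr_eq0 subSS => ji.
  by apply/eqP; rewrite eqn_leq ij.
have := @max_poly_roots _ p s pn0 _ us; rewrite size_map size_iota ltnn => h.
suff : false by [].
apply: h; apply/allP => _ /mapP[i _ ->].
by rewrite /root p0 // natr_eq0.
Qed.

(* Kronecker's substitution a = t, b = t ^ K separates the monomials. *)
Lemma mpoly3_eq0 (G : mpoly 3 k) (d : nat) (s : k -> k -> k) :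
  (forall c, c \in msupp G -> c o2 = d) ->
  (forall a b, a != 0 -> b != 0 -> s a b != 0 /\
     \sum_(c <- msupp G) mcoeff c G * (a ^+ c o0 * b ^+ c o1 * s a b ^+ c o2) = 0) ->
  G = 0.
Proof.
move=> Gd hG; pose K := (\sum_(c <- msupp G) c o0).+1.
have cK c : c \in msupp G -> (c o0 < K)%N.
  by move=> cG; rewrite /K ltnS (big_rem c) //= leq_addr.
pose e (c : multinom 3) := (c o0 + K * c o1)%N.
(* K exceeds every exponent of the first variable, so the first two exponents are remainder and
   quotient of [e c] by K; the third is the common d. *)
have e_inj c c' : c \in msupp G -> c' \in msupp G -> e c = e c' -> c = c'.
  move=> cG cG' E; have := congr1 (modn^~ K) E; have := congr1 (divn^~ K) E.
  rewrite /e ![(_ + K * _)%N]addnC ![(K * _)%N]mulnC !divnMDl // !modnMDl.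
  rewrite !modn_small ?cK // !divn_small ?cK // !addn0 => E1 E0.
  by apply: multinom3P => //; rewrite !Gd.
pose p : {poly k} := \sum_(c <- msupp G) mcoeff c G *: 'X^(e c).
have p0 : p = 0.
  apply: poly_eq0_nonzero => t t0; have [s0] := hG t (t ^+ K) t0 (expf_neq0 _ t0).
  move=> E; apply: (mulIf (expf_neq0 d s0)); rewrite mul0r -[RHS]E /p horner_sum mulr_suml.
  rewrite !big_seq; apply: eq_bigr => c cG.
  by rewrite hornerZ hornerXn /e exprD exprM Gd // -!mulrA.
apply/mpolyP => c; rewrite mcoeff0; have [cG|] := boolP (c \in msupp G); last first.
  by rewrite mcoeff_msupp negbK => /eqP.
have := congr1 (fun q : {poly k} => q`_(e c)) p0.
rewrite coef0 /p coef_sum (big_rem c) //= coefZ coefXn eqxx mulr1 big1_seq ?addr0 //.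
move=> c' /andP[_]; rewrite (rem_filter _ (msupp_uniq G)) mem_filter => /andP[ne c'G].
rewrite coefZ coefXn; case: eqP => [E|]; last by rewrite mulr0.
by rewrite /= (e_inj c c') // eqxx in ne.
Qed.

End CharZero.

Section TorusPoints.
Variables (k : fieldType) (N : nat) (v : pt3) (w : nat -> pt3) (r B : nat).
Variable z : 'I_N -> vec.
Local Notation pts := (fun i => hom (z i)).
Hypothesis toric_a : toric_points v w r B pts.

(** The value of the third variable that undoes the offset B in the exponents of a and b. *)
Definition scale B (a b : k) := a ^- B * b ^- B.

Lemma meval_toric_map (a b : k) (g : mpoly N k) : a != 0 -> b != 0 ->
  meval (fun i => a ^ (z i).1 * b ^ (z i).2) g =
  \sum_(c <- msupp (toric_map B pts g)) mcoeff c (toric_map B pts g) *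
    (a ^+ c o0 * b ^+ c o1 * scale B a b ^+ c o2).
Proof.
move=> a0 b0; pose u (j : 'I_3) := [:: a; b; scale B a b]`_j.
have u3 (f : 'I_3 -> nat) : \prod_j u j ^+ f j = a ^+ f o0 * b ^+ f o1 * scale B a b ^+ f o2.
  rewrite !big_ord_recl big_ord0 mulr1 mulrA /u /=.
  by congr (_ ^+ f _ * _ ^+ f _ * _ ^+ f _); exact: val_inj.
transitivity (meval u (toric_map B pts g)); last first.
  by rewrite mevalE; apply: eq_bigr => c _; rewrite u3.
rewrite [LHS]mevalE toric_mapE raddf_sum; apply: eq_bigr => m _ /=.
rewrite mevalZ mevalX; congr (_ * _).
under [RHS]eq_bigr => j _ do rewrite weightE -prodrXr.
rewrite exchange_big /=; apply: eq_bigr => i _.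
under [RHS]eq_bigr => j _ do rewrite exprM.
rewrite prodrXl u3; congr (_ ^+ _).
have [f1 f2 f3] := a_fits toric_a i; have [-> -> ->] := point_monomialE B (hom (z i)).
rewrite /= in f1 f2 *; rewrite /scale expr1 mulr1 in f1 f2 *.
rewrite !exprnP !gez0_abs // !expfzDr // mulrACA; congr (_ * _).
  by rewrite mulfK // expfz_neq0.
by rewrite mulfK // expfz_neq0.
Qed.

End TorusPoints.

Section ToricIdeal.
Variables (k : fieldType) (R : realType) (Delta : set (R * R)).
Hypothesis char_k : [pchar k] =i pred0.
Variables (v : pt3) (w : nat -> pt3) (r B : nat).
Local Notation pts := (fun i : 'I_(npoints Delta) => hom (lpoint i)).
Hypothesis toric_a : toric_points v w r B pts.

(** At a torus point a polynomial takes the value of its image under the monomial map, so vanishing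
    of its homogeneous components on the torus means image 0; the closure adds no further
    condition. *)
Lemma toric_idealE f : toric_ideal k Delta f <-> toric_kernel B pts f.
Proof.
have [i0 _] : exists i : 'I_(npoints Delta), hom (lpoint i) = v.
  apply: (tp_surj toric_a); first exact: cone_v (tp_fan toric_a).
  exact: fan_apex_degree (tp_fan toric_a).
split=> [f0|f0 d x].
  rewrite /toric_kernel; apply/mpolyP => c; rewrite mcoeff0.
  have := @mcoeff_toric_hproj k _ _ _ _ _ _ toric_a (monomial_height c)%:Z f c.
  rewrite eqxx => <-; set d := monomial_height c.
  suff -> : toric_map B pts (hproj d f) = 0 by rewrite mcoeff0.
  apply: (mpoly3_eq0 char_k (d := d) (s := scale B)).
    move=> c'; rewrite mcoeff_msupp (mcoeff_toric_hproj toric_a).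
    by case: ifP => [|_]; rewrite ?eqxx // eqz_nat => /eqP.
  move=> a b a0 b0; split; first by rewrite mulf_neq0 // invr_eq0 expf_neq0.
  (* A torus point belongs to the closure: its coordinates are nonzero, so it is a point of
     projective space. *)
  rewrite -(meval_toric_map toric_a) //; apply: f0; split.
    by exists i0; rewrite mulf_neq0 // expfz_neq0.
  move=> e g _; apply; exists a, b; split=> //.
case=> _; apply; first exact: pihomogP.
move=> y [a [b [a0 b0 ->]]].
rewrite (meval_toric_map toric_a) // -[pihomog mdeg d f]/(hproj d%:Z f).
have [_ _ _ hk] := toric_kernel_ideal k toric_a.
by have := hk d%:Z f f0; rewrite /toric_kernel => ->; rewrite msupp0 big_nil.
Qed.

End ToricIdeal.

(** * From the h-vector to the Betti difference *)

Lemma betti_difference_formula (R : realType) (n l h : nat) (V : R) :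
  1 + n%:R + h%:R = 2 * V -> (l <= n)%N ->
  n%:R * 'C(n, l.+1)%:R - 'C(n, l.+2)%:R - h%:R * 'C(n, l)%:R =
  l.+1%:R * 'C(n.+2, l.+2)%:R - 2 * 'C(n, l)%:R * V.
Proof.
move=> hV ln; have mb m j : j.+1%:R * 'C(m, j.+1)%:R = (m%:R - j%:R) * 'C(m, j)%:R :> R.
  have [jm|jm] := leqP j m; first by rewrite -natrB // -!natrM mul_bin_left.
  by rewrite !bin_small ?mulr0 // ltnW.
(* Pascal's rule leaves three binomials in n with lower entries l, l + 1 and l + 2; once h is
   expressed by V, the defect of the identity is the sum of these two ratio relations. *)
have b1 := mb n l; have b2 := mb n l.+1; rewrite !binS !natrD.
move: b1 b2; rewrite -!natr1.
have -> : h%:R = 2 * V - 1 - n%:R by rewrite -hV; ring.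
move: 'C(n, l)%:R 'C(n, l.+1)%:R 'C(n, l.+2)%:R => x y z b1 b2.
apply/eqP; rewrite -subr_eq0; apply/eqP.
transitivity (((n%:R - l%:R) * x - (l%:R + 1) * y) +
  ((n%:R - (l%:R + 1)) * y - (l%:R + 1 + 1) * z)); first ring.
by rewrite -b1 -b2 !subrr addr0.
Qed.

Section ToricPoints.
Variables (k : fieldType) (N : nat) (v : pt3) (w : nat -> pt3) (r B : nat).
Variable a : 'I_N -> pt3.
Hypothesis toric_a : toric_points v w r B a.

Lemma toric_pivots : exists i0 i1 i2 : 'I_N, [/\ a i0 = v, a i1 = w 0, a i2 = w 1 &
  (3 <= N)%N].
Proof.
have vwr := tp_fan toric_a; have r0 := fan_size vwr.
have [i0 e0] := tp_surj toric_a (cone_v vwr) (fan_apex_degree vwr).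
have [i1 e1] := tp_surj toric_a (cone_w vwr (leq0n r)) (fan_degree vwr (leq0n r)).
have [i2 e2] := tp_surj toric_a (cone_w vwr r0) (fan_degree vwr r0).
exists i0, i1, i2; split=> //.
have u : uniq [:: i0; i1; i2].
  rewrite /= !inE negb_or andbT -andbA; apply/and3P; split; apply/eqP => E.
  - by apply: (v_neq_w toric_a (leq0n r)); rewrite -e0 -e1 E.
  - by apply: (v_neq_w toric_a r0); rewrite -e0 -e2 E.
  - by have := w_inj vwr (leq0n r) r0; rewrite -e1 -e2 E => /(_ erefl).
by rewrite -[N]card_ord -[3%N]/(size [:: i0; i1; i2]) -(card_uniqP u) max_card.
Qed.

End ToricPoints.

Lemma toric_betti_difference (k : fieldType) (N : nat) (v : pt3) (w : nat -> pt3)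
    (r B : nat) (a : 'I_N -> pt3) (F : free_seq k N) (R : realType) (l : nat) :
  toric_points v w r B a -> minimal_graded_free_resolution (toric_kernel B a) F ->
  (1 <= l <= N - 2)%N ->
  (b_ F l)%:R - (c_ F (N - 1 - l))%:R = l%:R * 'C(N - 1, l.+1)%:R
    - 2 * 'C(N - 3, l - 1)%:R * vol (fan_region R v w r).
Proof.
move=> toric_a [gradF exF minF].
have [i0 [i1 [i2 [e0 e1 e2 N3]]]] := toric_pivots toric_a.
have van := toric_vanishing toric_a e0 e1 e2 gradF exF.
have hI := toric_kernel_ideal k toric_a.
have s0 := shift_0 hI gradF exF minF.
have sge := shift_ge hI gradF exF minF (toric_kernel_low toric_a).
have slow p (i : 'I_(rk F p)) : p%:Z <= Defs.shift i.
  by case: p i => [|p] i; [rewrite s0|have := sge p i; lia].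
have sle p (i : 'I_(rk F p)) := vanishing_mod_shift minF i van.
have euler e P := @hilbert_euler _ _ _ _ _ _ _ toric_a F e P gradF exF slow.
(* Since N is at least 3 it can be written n + 3, the form in which the difference identities are
   stated. *)
case: N a F toric_a N3 {i0 i1 i2 e0 e1 e2 van hI gradF exF minF slow} s0 sge sle euler =>
  [//|[//|[//|n]]] a F toric_a _ s0 sge sle euler hl.
rewrite !subSS !subn0 in sle hl *; case: l hl => // l /andP[_ ln].
have := betti_difference s0 sge sle euler (difference_hilbert3 toric_a) (l := l.+1).
rewrite ln => /(_ isT) /(congr1 (fun x : int => x%:~R : R)).
rewrite !(intrB, intrM) -!pmulrn subn1 /= => E.
rewrite -(betti_difference_formula (hvector_volume toric_a R)) // -E.
Qed.

Theorem lemma1p3 (k : fieldType) (char_k : [pchar k] =i pred0)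
    (R : realType) (Delta : set (R * R))
    (polyD : lattice_polygon Delta) (dimD : two_dimensional Delta)
    (F : free_seq k (npoints Delta))
    (resF : minimal_graded_free_resolution (toric_ideal k Delta) F)
    (l : nat) (hl : (1 <= l <= npoints Delta - 2)%N) :
  (b_ F l)%:R - (c_ F (npoints Delta - 1 - l))%:R
    = l%:R * 'C(npoints Delta - 1, l.+1)%:R
      - 2 * 'C(npoints Delta - 3, l - 1)%:R * vol Delta.
Proof.
have [v [w [r [vwr DE]]]] := polygon_fan polyD dimD.
have [B toric_a] := polygon_toric_points vwr DE.
have IE : toric_ideal k Delta = toric_kernel B (fun i => hom (lpoint i)).
  by apply/funext => f; apply/propext; exact: (toric_idealE char_k toric_a).
rewrite [in vol _]DE; apply: toric_betti_difference toric_a _ hl.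
by rewrite -IE.
Qed.
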